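(* Suppose that assumption ( * ) is satisfied. There exists a nonnegative function $Z(t,x)$, $t>0$, $x\in \mathbb R^n$, $x\ne 0$, locally integrable in $t$ and infinitely differentiable in $x\ne 0$, such that $$\int_{\mathbb R^n}Z(t,x)\,dx=1,\quad t>0,$$ and for any bounded globally Hölder continuous function $w_0$ (i.e. $|w_0(\xi)-w_0(\eta)|\le C|\xi-\eta|^\gamma$, $0<\gamma\le 1$, for all $\xi,\eta\in\mathbb R^n$), the function $$w(t,x)=\int_{\mathbb R^n}Z(t,x-\xi)w_0(\xi)\,d\xi$$ is an LT-solution of the Cauchy problem $(\mathbb D_{(k)} w)(t,x)=\Delta w(t,x)$, $t>0$, $x\in\mathbb R^n$; $w(0,x)=w_0(x)$.
   Context: Let $k$ be a nonnegative function in $L_1^{\mathrm{loc}}(\mathbb R_+)$, and define the operator $(\mathbb D_{(k)}u)(t)=\frac{d}{dt}\int_0^t k(t-\tau)u(\tau)\,d\tau - k(t)u(0)$. Let $\mathcal K(p)=\int_0^\infty e^{-pt}k(t)\,dt$ be the Laplace transform of $k$. A Stieltjes function is a function of the form $\varphi(\lambda)=\frac{a}{\lambda}+b+\int_0^\infty \frac{1}{\lambda+t}\,\sigma(dt)$ with $a,b\ge 0$ and $\sigma$ a Borel measure on $[0,\infty)$ with $\int_0^\infty (1+t)^{-1}\sigma(dt)<\infty$. Assumption ( * ): the Laplace transform $\mathcal K(p)$ exists for all $p>0$, $\mathcal K$ is a Stieltjes function, $\mathcal K(p)\to\infty$ as $p\to 0$, $\mathcal K(p)\to 0$ as $p\to\infty$,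 $p\mathcal K(p)\to 0$ as $p\to 0$, and $p\mathcal K(p)\to\infty$ as $p\to\infty$. Applying the Laplace transform in $t$ to the problem $\mathbb D_{(k)} w=\Delta w$, $w(0,x)=w_0(x)$, gives for the Laplace transform $\tilde w(p,x)$ the equation $p\mathcal K(p)\tilde w(p,x)-\mathcal K(p)w_0(x)=\Delta \tilde w(p,x)$, $p>0$, $x\in\mathbb R^n$. A bounded function $w(t,x)$ is called an LT-solution of this Cauchy problem if $w$ is continuous in $t$ on $[0,\infty)$ uniformly with respect to $x\in\mathbb R^n$, $w(0,x)=w_0(x)$, and its Laplace transform in $t$, $\tilde w(p,x)$, is twice continuously differentiable in $x$ for each $p>0$ and satisfies the equation $p\mathcal K(p)\tilde w(p,x)-\mathcal K(p)w_0(x)=\Delta \tilde w(p,x)$. *)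

(* Defs.v *)
From HB Require Import structures.
From mathcomp Require Import all_boot all_order all_algebra.
From mathcomp Require Import all_classical all_reals all_analysis.
Set Implicit Arguments. Unset Strict Implicit. Unset Printing Implicit Defensive.
Import Order.TTheory GRing.Theory Num.Theory.
Import numFieldNormedType.Exports.
Local Open Scope classical_set_scope.
Local Open Scope ring_scope.

Section Defs.
Variable R : realType.

Definition halfline : set R := `[0, +oo[.

Definition laplace (f : R -> R) (p : R) : R :=
  Rintegral lebesgue_measure halfline (fun t => expR (- (p * t)) * f t).

(* Stieltjes function (restricted to p > 0):
   phi p = a/p + b + int_[0,oo) 1/(p+t) sigma(dt),
   a, b >= 0, sigma a Borel measure on [0,oo) with int (1+t)^-1 sigma(dt) < oo.
   sigma is a measure on the Borel sets of R; only its restriction to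
   [0,+oo) is used. *)
Definition stieltjes_function (phi : R -> R) : Prop :=
  exists (a b : R) (sigma : {measure set R -> \bar R}),
    [/\ 0 <= a, 0 <= b,
        (\int[sigma]_(t in halfline) ((1 + t)^-1)%:E < +oo)%E &
        forall p : R, 0 < p ->
          (phi p)%:E = ((a / p + b)%:E
                        + \int[sigma]_(t in halfline) ((p + t)^-1)%:E)%E].

Definition kernel_ok (k : R -> R) : Prop :=
  (forall t : R, 0 <= t -> 0 <= k t) /\
  (forall T : R, 0 < T -> lebesgue_measure.-integrable `[0, T] (EFin \o k)).

Definition assumption_star (k : R -> R) : Prop :=
  (forall p : R, 0 < p ->
        lebesgue_measure.-integrable halfline
          (fun t => (expR (- (p * t)) * k t)%:E)) /\
  [/\ stieltjes_function (laplace k),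
      (laplace k p @[p --> 0^'+] --> +oo),
      (laplace k p @[p --> +oo] --> 0),
      (p * laplace k p @[p --> 0^'+] --> 0) &
      (p * laplace k p @[p --> +oo] --> +oo)].


Variable n : nat.

Definition enorm (v : 'rV[R]_n) : R := Num.sqrt (\sum_(i < n) v ord0 i ^+ 2).

Definition evec (i : 'I_n) : 'rV[R]_n := delta_mx ord0 i.

Fixpoint dirD (vs : seq 'rV[R]_n) (f : 'rV[R]_n -> R) : 'rV[R]_n -> R :=
  match vs with
  | [::] => f
  | v :: vs' => 'D_v (dirD vs' f)
  end.

Definition Ck_on (m : option nat) (U : set 'rV[R]_n) (f : 'rV[R]_n -> R) : Prop :=
  forall vs : seq 'rV[R]_n,
    (if m is Some m' then (size vs <= m')%N else true) ->
    forall x, U x ->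
      (dirD vs f @ x --> dirD vs f x) /\
      ((if m is Some m' then (size vs < m')%N else true) ->
       forall v, derivable (dirD vs f) x v).

Definition laplacian (f : 'rV[R]_n -> R) (x : 'rV[R]_n) : R :=
  \sum_(i < n) dirD [:: evec i; evec i] f x.

Definition globally_holder (w0 : 'rV[R]_n -> R) : Prop :=
  exists (C gamma : R), 0 < gamma /\ gamma <= 1 /\
    forall xi eta : 'rV[R]_n, `|w0 xi - w0 eta| <= C * (enorm (xi - eta)) `^ gamma.

Definition LT_solution (k : R -> R) (w : R -> 'rV[R]_n -> R)
    (w0 : 'rV[R]_n -> R) : Prop :=
  [/\
      (exists M : R, forall t x, 0 <= t -> `|w t x| <= M),
      (forall t0 : R, 0 <= t0 -> forall eps : R, 0 < eps ->
         exists2 delta : R, 0 < delta &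
           forall t : R, 0 <= t -> `|t - t0| < delta ->
             forall x, `|w t x - w t0 x| < eps),
      (forall x, w 0 x = w0 x),
      (forall p : R, 0 < p -> Ck_on (Some 2%N) setT (fun x => laplace (w ^~ x) p)) &
      (forall p : R, 0 < p -> forall x : 'rV[R]_n,
         p * laplace k p * laplace (w ^~ x) p - laplace k p * w0 x
         = laplacian (fun y => laplace (w ^~ y) p) x)].

End Defs.

(* Lebesgue integral over R^n, as an iterated Lebesgue integral over the
   coordinates (extended-real valued). *)
Fixpoint iint (R : realType) (n : nat) : ('rV[R]_n -> \bar R) -> \bar R :=
  match n return ('rV[R]_n -> \bar R) -> \bar R with
  | 0 => fun f => f 0
  | n'.+1 => fun f =>
      (\int[@lebesgue_measure R]_s
          iint (fun v : 'rV[R]_n' => f (row_mx (const_mx s : 'rV[R]_1) v)))%E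
  end.

Definition conv_solution (R : realType) (n : nat) (Z : R -> 'rV[R]_n -> R)
    (w0 : 'rV[R]_n -> R) : R -> 'rV[R]_n -> R :=
  fun t x => if t <= 0 then w0 x
             else fine (iint (fun xi => (Z t (x - xi) * w0 xi)%:E)).

(* Main.v *)
(* The symbol [f p = p * K p] of a Stieltjes [K] is
   [\int_(0, oo) p / (p + x) sigma(dx)], that is
   [\int (1 - exp (- (p * y))) q y dy] for the completely monotone jump density
   [q y = \int x * exp (- (x * y)) sigma(dx)], so [f] is the Laplace exponent of a
   pure-jump subordinator [S].  Cutting [sigma] into the pieces carried by the
   intervals [[j, j + 1]] makes [S] an infinite sum of compound Poisson
   processes, whose distribution function [H s t = P (S_s <= t)] is obtained as a
   decreasing limit of explicit Poisson mixtures.  The first passage time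
   [E t = sup [s | w < H s t]], with [w] uniform on (0, 1), is almost surely
   continuous in [t], and at an independent exponential time of rate [p] it is
   exponential of rate [f p].
   The kernel is the heat kernel at the random time [E t]:
   [Z t x = \int_w heat (E t w) x], so that
   [w t x = \int_w (P_(E t w) w0) x] with [P_s] the heat semigroup.  For Hoelder
   [w0] one has [|P_s w0 - P_r w0| <= C * |s^(gamma/2) - r^(gamma/2)|], whence
   uniform continuity in [t], and the second derivatives of [P_s w0] are
   [O(s^(gamma/2 - 1))], hence integrable at [s = 0].  Thus the Laplace transform
   of [w] is [K p * u] with [u = \int_0^oo exp (- (f p * s)) P_s w0 ds] of class
   C^2, and integrating [d/ds (exp (- (f p * s)) P_s w0)] gives
   [f p * u - w0 = Delta u]. *)

Require Import Defs.
From HB Require Import structures.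
From mathcomp Require Import all_boot all_order all_algebra.
From mathcomp Require Import all_classical all_reals all_analysis.
From mathcomp Require Import measurable_realfun.
From mathcomp Require Import ring lra.
Set Implicit Arguments. Unset Strict Implicit. Unset Printing Implicit Defensive.
Import Order.TTheory GRing.Theory Num.Theory.
Import numFieldNormedType.Exports.
Local Open Scope classical_set_scope.
Local Open Scope ring_scope.

(** * Convolution with a jump density *)

Section translation.
Context {R : realType}.
Local Open Scope ereal_scope.
Notation mu := (@lebesgue_measure R).

(** Only the laws of the first passage time at fixed [t] enter the kernel, so no process is built:
    distribution functions are handled directly, and one uniform variable couples all [t] through
    quantiles. Continuity in [t] then holds at each fixed [t0] off a null set of [w] depending on
    [t0], which is enough for dominated convergence. The limits in the assumption have separate
    jobs. [K p -> 0] at infinity removes the constant [b]; [p * K p -> 0] at zero removes [a]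
    together with the atom of [sigma] at 0; [p * K p -> +oo] makes the total jump mass infinite, so
    that [S_s] has no atom for [s > 0], which makes [H s] continuous and the passage time vanish at
    [t = 0]. The jump density of the whole [sigma] may be unbounded near 0, whereas a piece carried
    by []j, j + 1]] has a density bounded by [j + 1] times its mass; this gives each compound
    Poisson factor a Lipschitz modulus off its atom. *)

Lemma lebesgue_measure_shift (a : R) (A : set R) : measurable A ->
  pushforward mu (fun x : measurableTypeR R => (x - a)%R : measurableTypeR R) A = mu A.
Proof.
have mh : measurable_fun [set: measurableTypeR R] (fun x : measurableTypeR R => (x - a)%R : measurableTypeR R).
  exact: measurable_funB.
pose sh : {mfun measurableTypeR R >-> measurableTypeR R} := HB.pack
  (fun x : measurableTypeR R => (x - a)%R : measurableTypeR R) (isMeasurableFun.Build _ _ _ _ _ mh).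
move=> mA; apply/esym.
apply: (@lebesgue_measure_unique _ (pushforward mu sh)) => //= _ [[x y]] _ <-.
rewrite /pushforward /=.
have -> : (fun x : measurableTypeR R => (x - a)%R) @^-1` `]x, y] = `](x + a)%R, (y + a)%R]%classic.
  by apply/seteqP; split => z /=; rewrite !in_itv/= ltrBrDr lerBlDr.
rewrite !lebesgue_measure_itv/= !lte_fin ltrD2r.
by case: ifPn => // _; rewrite -!EFinB; congr EFin; ring.
Qed.

Lemma ge0_integral_shift (f : R -> \bar R) (a : R) :
  measurable_fun setT f -> (forall x, 0 <= f x) ->
  \int[mu]_x f (x - a)%R = \int[mu]_x f x.
Proof.
move=> mf f0.
have mh : measurable_fun [set: measurableTypeR R] (fun x : measurableTypeR R => (x - a)%R : measurableTypeR R).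
  exact: measurable_funB.
rewrite -[LHS](@ge0_integral_pushforward _ _ _ _ _ _ mh mu setT f)//.
apply: eq_measure_integral => A mA _. exact: lebesgue_measure_shift.
Qed.

End translation.

Section conv.
Context {R : realType}.
Local Open Scope ereal_scope.
Notation mu := (@lebesgue_measure R).

(** The profile of [t |-> P (X <= t)] for a nonnegative [X], with mass at most [M] instead of 1
    because convolving with [q] multiplies masses by [c]. *)
Definition subcdf (M : R) (g : R -> \bar R) : Prop :=
  [/\ measurable_fun setT g, forall t, 0 <= g t, forall t, g t <= M%:E,
      forall s t, (s <= t)%R -> g s <= g t & forall t, (t < 0)%R -> g t = 0].

(** The bound [B] will become a Lipschitz constant; for a piece of [sigma] it is the right endpoint
    times the mass, and monotonicity holds because the density is a mixture of decaying
    exponentials. *)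
Definition jump_density (c B : R) (q : R -> R) : Prop :=
  [/\ measurable_fun setT q, forall y, (0 <= q y <= B)%R,
      forall y, (y < 0)%R -> q y = 0%R,
      forall x y, (0 <= x)%R -> (x <= y)%R -> (q y <= q x)%R &
      \int[mu]_y (q y)%:E = c%:E].

Definition conv (q : R -> R) (g : R -> \bar R) (t : R) : \bar R :=
  \int[mu]_y (g (t - y)%R * (q y)%:E).

Definition laplaceT (p : R) (g : R -> \bar R) : \bar R :=
  \int[mu]_t ((expR (- (p * t)))%:E * g t).

Lemma measurable_sub_snd : measurable_fun setT (fun x : R * R => (x.1 - x.2)%R).
Proof. by apply: measurable_funB; [exact: measurable_fst|exact: measurable_snd]. Qed.

Variables (c B : R) (q : R -> R).
Hypothesis hq : jump_density c B q.

Let mq : measurable_fun setT q. Proof. by case: hq. Qed.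
Let q0 y : (0 <= q y)%R. Proof. by case: hq => _ /(_ y)/andP[]. Qed.
Let qB y : (q y <= B)%R. Proof. by case: hq => _ /(_ y)/andP[]. Qed.
Let qlt0 y : (y < 0)%R -> q y = 0%R. Proof. by case: hq => _ _ /(_ y). Qed.
Let qc : \int[mu]_y (q y)%:E = c%:E. Proof. by case: hq. Qed.
Let c0 : (0 <= c)%R.
Proof. by rewrite -lee_fin -qc; apply: integral_ge0 => y _; rewrite lee_fin. Qed.
Let B0 : (0 <= B)%R. Proof. exact: le_trans (q0 0%R) (qB 0%R). Qed.

Section measurable.
Variable (g : R -> \bar R).
Hypotheses (mg : measurable_fun setT g) (g0 : forall t, 0 <= g t).

Lemma measurable_conv_kernel :
  measurable_fun setT (fun x : R * R => g (x.1 - x.2)%R * (q x.2)%:E).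
Proof.
apply: emeasurable_funM; first exact: measurableT_comp measurable_sub_snd.
by apply/measurable_EFinP; exact: measurableT_comp measurable_snd.
Qed.

Lemma measurable_conv_integrand t :
  measurable_fun setT (fun y : R => g (t - y)%R * (q y)%:E).
Proof. exact: (measurable_fun_pair2 t measurable_conv_kernel). Qed.

Lemma conv_integrand_ge0 t y : 0 <= g (t - y)%R * (q y)%:E.
Proof. by rewrite mule_ge0// lee_fin. Qed.

Lemma measurable_conv : measurable_fun setT (conv q g).
Proof.
exact: (@measurable_fun_fubini_tonelli_F _ _ _ _ _ mu _ measurable_conv_kernel
  (fun x => conv_integrand_ge0 x.1 x.2)).
Qed.

Lemma conv_ge0 t : 0 <= conv q g t.
Proof. by apply: integral_ge0 => y _; exact: conv_integrand_ge0. Qed.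

(** By Tonelli and shift invariance, since [exp (- p t)] factors as [exp (- p (t - y))] times
    [exp (- p y)]. *)
Lemma laplaceT_conv p Q : (\int[mu]_y ((expR (- (p * y)) * q y)%:E) = Q%:E) ->
  laplaceT p (conv q g) = Q%:E * laplaceT p g.
Proof.
move=> hQ.
have me : measurable_fun setT (fun t : R => (expR (- (p * t)))%:E).
  by apply/measurable_EFinP; apply: measurableT_comp => //; apply: measurableT_comp => //; exact: mulrl_measurable.
have meg : measurable_fun setT (fun t : R => (expR (- (p * t)))%:E * g t).
  exact: emeasurable_funM.
have e0 t : 0 <= (expR (- (p * t)))%:E by rewrite lee_fin expR_ge0.
rewrite /laplaceT.
transitivity (\int[mu]_t \int[mu]_y ((expR (- (p * t)))%:E * (g (t - y)%R * (q y)%:E))).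
  apply: eq_integral => t _; rewrite ge0_integralZl//.
    exact: measurable_conv_integrand.
  by move=> y _; exact: conv_integrand_ge0.
rewrite (@fubini_tonelli _ _ _ _ _ mu mu (fun x => (expR (- (p * x.1)))%:E * (g (x.1 - x.2)%R * (q x.2)%:E))); last 2 first.
- apply: emeasurable_funM; last exact: measurable_conv_kernel.
  exact: (measurableT_comp me measurable_fst).
- by move=> x; rewrite mule_ge0// conv_integrand_ge0.
transitivity (\int[mu]_y ((expR (- (p * y)) * q y)%:E * laplaceT p g)).
  apply: eq_integral => y _ /=.
  rewrite /laplaceT -(@ge0_integral_shift _ _ y meg); last by move=> t; rewrite mule_ge0.
  rewrite -ge0_integralZl//=; last 3 first.
  - by apply: (measurableT_comp meg); exact: measurable_funB.
  - by move=> t _; rewrite mule_ge0.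
  - by rewrite lee_fin mulr_ge0// expR_ge0.
  apply: eq_integral => t _; rewrite muleA muleC !muleA.
  congr (_ * _); rewrite -!EFinM; congr EFin.
  rewrite [RHS]mulrAC -expRD mulrC; congr (expR _ * _)%R; ring.
rewrite ge0_integralZr//.
- by rewrite hQ.
- apply/measurable_EFinP; apply: measurable_funM => //; exact/measurable_EFinP.
- by move=> y _; rewrite lee_fin mulr_ge0// expR_ge0.
- by apply: integral_ge0 => t _; rewrite mule_ge0.
Qed.

(** A modulus valid at every point survives averaging over shifts, scaled by the mass of [q]. *)
Lemma conv_le_add eps d t : (0 <= eps)%R ->
  (forall s, g (s + d)%R <= g s + eps%:E) ->
  conv q g (t + d)%R <= conv q g t + (c * eps)%:E.
Proof.
move=> eps0 H.
have -> : (c * eps)%:E = \int[mu]_y ((q y)%:E * eps%:E).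
  rewrite ge0_integralZr//; last by move=> y _; rewrite lee_fin.
    by rewrite qc EFinM.
  exact/measurable_EFinP.
rewrite -ge0_integralD//; last 4 first.
- by move=> y _; exact: conv_integrand_ge0.
- exact: measurable_conv_integrand.
- by move=> y _; rewrite -EFinM lee_fin mulr_ge0.
- by apply: emeasurable_funM => //; exact/measurable_EFinP.
apply: ge0_le_integral => //.
- by move=> y _; exact: conv_integrand_ge0.
- exact: measurable_conv_integrand.
- apply: emeasurable_funD; first exact: measurable_conv_integrand.
  by apply: emeasurable_funM => //; exact/measurable_EFinP.
move=> y _; rewrite (muleC (q y)%:E) -ge0_muleDl// ?lee_fin//.
by apply: lee_wpmul2r; rewrite ?lee_fin// addrAC; exact: H.
Qed.

End measurable.

Lemma subcdf_conv M g : subcdf M g -> subcdf (c * M) (conv q g).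
Proof.
case=> mg g0 gM ndg g00; split.
- exact: measurable_conv.
- exact: conv_ge0.
- move=> t; rewrite mulrC EFinM -qc -ge0_integralZl ?lee_fin//; last 3 first.
  + exact/measurable_EFinP.
  + by move=> y _; rewrite lee_fin.
  + by have := le_trans (g0 0%R) (gM 0%R); rewrite lee_fin.
  apply: ge0_le_integral => //.
  + by move=> y _; exact: conv_integrand_ge0.
  + exact: measurable_conv_integrand.
  + by apply: emeasurable_funM => //; exact/measurable_EFinP.
  + by move=> y _; apply: lee_wpmul2r; rewrite ?lee_fin.
- move=> s t st; apply: ge0_le_integral => //.
  + by move=> y _; exact: conv_integrand_ge0.
  + exact: measurable_conv_integrand.
  + exact: measurable_conv_integrand.
  + by move=> y _; apply: lee_wpmul2r; rewrite ?lee_fin// ndg// lerB.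
- move=> t t0; apply: integral0_eq => y _.
  have [y0|y0] := ltP y 0%R; first by rewrite qlt0// mule0.
  by rewrite g00 ?mul0e//; apply: le_lt_trans t0; rewrite lerBlDr lerDl.
Qed.

(** Jumps are nonnegative, so only values of [g] to the left of [t] are averaged. *)
Lemma conv_le M g t : subcdf M g -> conv q g t <= c%:E * g t.
Proof.
case=> mg g0 gM ndg g00; rewrite -qc -ge0_integralZr//; last 2 first.
- exact/measurable_EFinP.
- by move=> y _; rewrite lee_fin.
apply: ge0_le_integral => //.
+ by move=> y _; exact: conv_integrand_ge0.
+ exact: measurable_conv_integrand.
+ by apply: emeasurable_funM => //; exact/measurable_EFinP.
move=> y _; rewrite muleC.
have [y0|y0] := ltP y 0%R; first by rewrite qlt0// !mul0e.
by apply: lee_wpmul2l; rewrite ?lee_fin// ndg// lerBlDr lerDl.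
Qed.

(* Shifting the convolution variable by [d] moves the translation from [g] to
   [q], which is nonincreasing on the half-line. *)
Lemma conv_lipschitz M g d t : subcdf M g -> (0 <= d)%R ->
  conv q g (t + d)%R <= conv q g t + (M * B * d)%:E.
Proof.
case=> mg g0 gM ndg g00 d0.
have M0 : (0 <= M)%R by have := le_trans (g0 0%R) (gM 0%R); rewrite lee_fin.
rewrite /conv -(@ge0_integral_shift _ _ (- d)%R); last 2 first.
- exact: measurable_conv_integrand.
- by move=> y; exact: conv_integrand_ge0.
have -> : (M * B * d)%:E = \int[mu]_y (M * B * \1_(`[-d, 0]%classic : set R) y)%:E.
  under eq_integral do rewrite EFinM.
  rewrite ge0_integralZl//.
  - rewrite integral_indic//= setIT lebesgue_measure_itv/= lte_fin oppr_lt0.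
    by case: ltgtP d0 => //= [dp _|<- _]; rewrite ?mulr0 ?mule0// -EFinB opprK add0r EFinM.
  - by apply/measurable_EFinP; exact: measurable_indic.
  - by rewrite lee_fin mulr_ge0.
rewrite -ge0_integralD//; last 4 first.
- by move=> y _; exact: conv_integrand_ge0.
- exact: measurable_conv_integrand.
- by move=> y _; rewrite lee_fin !mulr_ge0.
- by apply/measurable_EFinP; apply: measurable_funM => //; exact: measurable_indic.
apply: ge0_le_integral => //.
- by move=> y _; rewrite mule_ge0// lee_fin.
- have := @measurableT_comp _ _ _ _ _ _ _ _ _ (measurable_conv_integrand mg (t + d)%R) (@measurable_funD _ _ R setT id (cst d) (@measurable_id _ _ setT) (measurable_cst _)).
  by apply: eq_measurable_fun => y _ /=; rewrite opprK.
- apply: emeasurable_funD; first exact: measurable_conv_integrand.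
  by apply/measurable_EFinP; apply: measurable_funM => //; exact: measurable_indic.
move=> y _.
have -> : (t + d - (y - - d) = t - y)%R by ring.
rewrite opprK indicE; have [y0|y0] := ltP 0%R y.
  rewrite memNset ?mulr0 ?adde0; last by rewrite /= in_itv/= => /andP[_]; rewrite leNgt y0.
  apply: lee_wpmul2l => //; rewrite lee_fin; case: hq => _ _ _ nq _; apply: nq; first exact: ltW.
  by rewrite lerDl.
have [yd|yd] := ltP y (- d)%R.
  rewrite memNset ?mulr0 ?adde0; last by rewrite /= in_itv/= leNgt yd.
  by rewrite qlt0 ?mule0 ?conv_integrand_ge0// -[ltRHS](addNr d) ltrD2r.
rewrite mem_set ?mulr1; last by rewrite /= in_itv/= yd y0.
rewrite -[leLHS]add0e; apply: leeD; first exact: conv_integrand_ge0.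
by rewrite EFinM; apply: lee_pmul; rewrite ?lee_fin.
Qed.

End conv.

(** * Compound Poisson mixtures *)

Section poisson_mixture.
Context {R : realType}.
Local Open Scope ereal_scope.
Notation mu := (@lebesgue_measure R).

Lemma exp_nneseries (x : R) : \sum_(i <oo) (x ^+ i / i`!%:R)%:E = (expR x)%:E.
Proof.
rewrite /expR -EFin_lim; last exact: is_cvg_series_exp_coeff.
by apply/congr_lim/funext => n/=; rewrite /series/= -sumEFin.
Qed.

(** The Poisson probability of mean [s * c] is [pweight c s i * c ^+ i]; the factor [c ^+ i] is left
    to the [i]-fold convolution because [q] has mass [c]. *)
Definition pweight (c s : R) (i : nat) : R := (expR (- (s * c)) * (s ^+ i / i`!%:R))%R.

Lemma pweight_ge0 c s i : (0 <= s)%R -> (0 <= pweight c s i)%R.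
Proof. by move=> s0; rewrite mulr_ge0 ?expR_ge0// divr_ge0// exprn_ge0. Qed.


(** Used at [x = c], where the weights sum to 1, and at the Laplace transform [x = Q] of [q], where
    the exponent of the compound Poisson law appears. *)
Lemma pweight_sum c s x : (0 <= s)%R -> (0 <= x)%R ->
  \sum_(i <oo) (pweight c s i)%:E * (x ^+ i)%:E = (expR (s * (x - c)))%:E.
Proof.
move=> s0 x0.
transitivity (\sum_(i <oo) (expR (- (s * c)))%:E * ((s * x) ^+ i / i`!%:R)%:E).
  apply: eq_eseriesr => i _; rewrite -!EFinM; congr EFin.
  by rewrite /pweight exprMn; ring.
rewrite nneseriesZl; last by move=> i _; rewrite lee_fin divr_ge0// exprn_ge0// mulr_ge0.
by rewrite exp_nneseries -EFinM -expRD; congr (expR _)%:E; ring.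
Qed.

Variables (c b : R) (q : R -> R).
Hypothesis hq : jump_density c (b * c) q.

Let qc : \int[mu]_y (q y)%:E = c%:E. Proof. by case: hq. Qed.
Let q0 y : (0 <= q y)%R. Proof. by case: hq => _ /(_ y)/andP[]. Qed.
Let c0 : (0 <= c)%R.
Proof. by rewrite -lee_fin -qc; apply: integral_ge0 => y _; rewrite lee_fin. Qed.

Definition cpois (s : R) (g : R -> \bar R) (t : R) : \bar R :=
  \sum_(i <oo) (pweight c s i)%:E * iter i (conv q) g t.

Lemma subcdf_iter M g i : subcdf M g -> subcdf (c ^+ i * M) (iter i (conv q) g).
Proof.
by move=> hg; elim: i => [|i ih]; rewrite ?expr0 ?mul1r// exprS -mulrA; exact: (subcdf_conv hq ih).
Qed.

Lemma iter_conv_le M g i t : subcdf M g -> iter i (conv q) g t <= (c ^+ i)%:E * g t.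
Proof.
move=> hg; elim: i => [|i ih]; first by rewrite expr0 mul1e.
rewrite iterS; apply: le_trans (conv_le hq t (subcdf_iter i hg)) _.
by rewrite exprS EFinM -muleA; apply: lee_wpmul2l; rewrite ?lee_fin.
Qed.

Lemma iter_conv_mono M g1 g2 i : subcdf M g1 -> subcdf M g2 ->
  (forall t, g1 t <= g2 t) -> forall t, iter i (conv q) g1 t <= iter i (conv q) g2 t.
Proof.
move=> h1 h2 h12; elim: i => [//|i ih] t; rewrite !iterS.
have [m1 p1 _ _ _] := subcdf_iter i h1; have [m2 p2 _ _ _] := subcdf_iter i h2.
apply: ge0_le_integral => //.
- by move=> y _; exact: (conv_integrand_ge0 hq p1).
- exact: (measurable_conv_integrand hq m1).
- exact: (measurable_conv_integrand hq m2).
- by move=> y _; apply: lee_wpmul2r; rewrite ?lee_fin.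
Qed.

Section fix_s.
Variables (s M : R) (g : R -> \bar R).
Hypotheses (s0 : (0 <= s)%R) (hg : subcdf M g).

Let M0 : (0 <= M)%R.
Proof. by case: hg => _ /(_ 0%R) g0 /(_ 0%R) /(le_trans g0); rewrite lee_fin. Qed.

Let g0 t : 0 <= g t. Proof. by case: hg. Qed.
Let gi0 i t : 0 <= iter i (conv q) g t. Proof. by case: (subcdf_iter i hg). Qed.
Let mgi i : measurable_fun setT (iter i (conv q) g). Proof. by case: (subcdf_iter i hg). Qed.
Let w0 i : 0 <= (pweight c s i)%:E. Proof. by rewrite lee_fin pweight_ge0. Qed.
Let wg0 i t : 0 <= (pweight c s i)%:E * iter i (conv q) g t. Proof. exact: mule_ge0. Qed.

Let w1 : \sum_(i <oo) (pweight c s i)%:E * (c ^+ i)%:E = 1.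
Proof. by rewrite pweight_sum// subrr mulr0 expR0. Qed.

Lemma cpois_le t : cpois s g t <= g t.
Proof.
case: hg => mg _ gM ndg g00.
have gf : g t \is a fin_num by rewrite ge0_fin_numE//; apply: le_lt_trans (gM t) _; rewrite ltry.
rewrite -[leRHS]mul1e -w1 muleC -(fineK gf) -nneseriesZl; last by move=> i _; rewrite mule_ge0// lee_fin exprn_ge0.
apply: lee_nneseries => [i _ _|i _]; first exact: wg0.
rewrite fineK// muleCA; apply: lee_wpmul2l => //; rewrite muleC.
exact: iter_conv_le hg.
Qed.

Lemma subcdf_cpois : subcdf M (cpois s g).
Proof.
case: (hg) => mg _ gM ndg g00; split.
- apply: ge0_emeasurable_sum => [k x _ _|k _]; first exact: wg0.
  by apply: emeasurable_funM.
- by move=> t; apply: nneseries_ge0 => i _ _; exact: wg0.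
- by move=> t; exact: le_trans (cpois_le t) _.
- move=> x y xy; apply: lee_nneseries => [i _ _|i _]; first exact: wg0.
  apply: lee_wpmul2l => //; by case: (subcdf_iter i hg) => _ _ _ h _; exact: h.
- by move=> t t0; apply: eseries0 => i _ _; case: (subcdf_iter i hg) => _ _ _ _ ->//; rewrite mule0.
Qed.

Lemma laplaceT_cpois p Q : (0 <= Q)%R -> \int[mu]_y ((expR (- (p * y)) * q y)%:E) = Q%:E ->
  laplaceT p (cpois s g) = (expR (s * (Q - c)))%:E * laplaceT p g.
Proof.
move=> Q0 hQ.
have me : measurable_fun setT (fun t : R => (expR (- (p * t)))%:E).
  by apply/measurable_EFinP; apply: measurableT_comp => //; apply: measurableT_comp => //; exact: mulrl_measurable.
have hi i : laplaceT p (iter i (conv q) g) = (Q ^+ i)%:E * laplaceT p g.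
  elim: i => [|i ih]; first by rewrite expr0 mul1e.
  by rewrite iterS (laplaceT_conv hq _ _ hQ)// ih muleA -EFinM -exprS.
have meg i : measurable_fun setT (fun t : R => (expR (- (p * t)))%:E * iter i (conv q) g t).
  exact: emeasurable_funM.
rewrite /laplaceT.
transitivity (\int[mu]_t \sum_(i <oo) (pweight c s i)%:E * ((expR (- (p * t)))%:E * iter i (conv q) g t)).
  apply: eq_integral => t _; rewrite -nneseriesZl//.
  by apply: eq_eseriesr => i _; rewrite muleCA.
rewrite integral_nneseries//; last 2 first.
- by move=> i; apply: measurable_funeM; exact: meg.
- by move=> i t _; rewrite mule_ge0// mule_ge0// lee_fin expR_ge0.
have L0 : 0 <= laplaceT p g by apply: integral_ge0 => t _; rewrite mule_ge0// lee_fin expR_ge0.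
transitivity (\sum_(i <oo) ((pweight c s i)%:E * (Q ^+ i)%:E * laplaceT p g)).
  apply: eq_eseriesr => i _; rewrite ge0_integralZl//; last 2 first.
  - exact: meg.
  - by move=> t _; rewrite mule_ge0// lee_fin expR_ge0.
  by rewrite -muleA -hi.
rewrite -pweight_sum//.
have Qw i : 0 <= (pweight c s i)%:E * (Q ^+ i)%:E by rewrite mule_ge0// lee_fin exprn_ge0.
move: L0; rewrite -/(laplaceT p g); case: (laplaceT p g) => [r| |//] r0.
- rewrite muleC -nneseriesZl//; by apply: eq_eseriesr => i _; rewrite muleC.
(* [laplaceT p g] is not known to be finite; if it is infinite, the term of index 0, whose weight is
   positive, already makes the series infinite. *)
- rewrite pweight_sum// gt0_muley ?lte_fin ?expR_gt0//.
  apply: (@nneseries_pinfty _ _ _ 0%N) => //.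
    by move=> i _; rewrite mule_ge0.
  by rewrite expr0 gt0_muley// mule1 lte_fin /pweight expr0 mulr_gt0 ?expR_gt0// divr1.
Qed.

(* The atom of the compound Poisson law at [0] has mass [expR (- (s * c))]. *)
Lemma cpois_modulus eps d t : (0 <= eps)%R -> (0 <= d)%R -> (0 <= b)%R ->
  (forall s, g (s + d)%R <= g s + eps%:E) ->
  cpois s g (t + d)%R <= cpois s g t + (expR (- (s * c)) * eps + M * b * d)%:E.
Proof.
move=> eps0 d0 b0 hd.
have step i : iter i (conv q) g (t + d)%R <= iter i (conv q) g t +
    (c ^+ i)%:E * ((i == 0%N)%:R * eps + M * b * d)%:E.
  case: i => [|i]; first by rewrite expr0 mul1e mul1r; apply: le_trans (hd t) _; rewrite leeD2l// lee_fin lerDl !mulr_ge0.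
  rewrite iterS mul0r add0r -EFinM.
  apply: le_trans (conv_lipschitz hq t (subcdf_iter i hg) d0) _.
  by rewrite leeD2l// lee_fin exprS le_eqVlt; apply/orP; left; apply/eqP; ring.
have X0 i : 0 <= (c ^+ i)%:E * ((i == 0%N)%:R * eps + M * b * d)%:E.
  by rewrite -EFinM lee_fin mulr_ge0// ?exprn_ge0// addr_ge0// !mulr_ge0.
apply: (@le_trans _ _ (\sum_(i <oo) ((pweight c s i)%:E * iter i (conv q) g t +
    (pweight c s i)%:E * ((c ^+ i)%:E * ((i == 0%N)%:R * eps + M * b * d)%:E)))).
  apply: lee_nneseries => [i _ _|i _]; first exact: wg0.
  by rewrite -ge0_muleDr//; apply: lee_wpmul2l.
rewrite nneseriesD//; last by move=> i _ _; rewrite mule_ge0.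
have p0 i : (0 <= pweight c s i)%R by rewrite pweight_ge0.
have wc0 i : 0 <= (pweight c s i)%:E * (c ^+ i)%:E by rewrite mule_ge0// lee_fin exprn_ge0.
rewrite leeD2l//.
rewrite [X in X <= _](_ : _ = \sum_(i <oo) ((eps * (pweight c s i * (i == 0%N)%:R))%:E
    + (M * b * d)%:E * ((pweight c s i)%:E * (c ^+ i)%:E))); last first.
  apply: eq_eseriesr => -[|i] _; rewrite -!EFinM -EFinD; congr EFin => /=; first by rewrite !expr0; ring.
  by ring.
rewrite nneseriesD//; last 2 first.
- by move=> i _ _; rewrite lee_fin mulr_ge0// mulr_ge0.
- by move=> i _ _; apply: mule_ge0; [rewrite lee_fin !mulr_ge0|exact: wc0].
rewrite EFinD; apply: leeD.
  rewrite nneseries_recl//; last by move=> i _; rewrite lee_fin mulr_ge0// mulr_ge0.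
  rewrite eseries0; last by move=> [//|i] _ _; rewrite !mulr0.
  by rewrite adde0 lee_fin /pweight expr0 divr1 !mulr1 mulrC.
by rewrite nneseriesZl ?w1 ?mule1.
Qed.

(** A mixture of total weight one keeps every modulus, so further pieces can be added at no cost. *)
Lemma cpois_le_add eps d t : (0 <= eps)%R ->
  (forall s, g (s + d)%R <= g s + eps%:E) ->
  cpois s g (t + d)%R <= cpois s g t + eps%:E.
Proof.
move=> eps0 hd.
have step i : forall t, iter i (conv q) g (t + d)%R <= iter i (conv q) g t + (c ^+ i * eps)%:E.
  elim: i => [|i ih] t'; first by rewrite mul1r.
  by rewrite !iterS exprS -mulrA; apply: (conv_le_add hq) => //; rewrite mulr_ge0// exprn_ge0.
apply: (@le_trans _ _ (\sum_(i <oo) ((pweight c s i)%:E * iter i (conv q) g t +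
    eps%:E * ((pweight c s i)%:E * (c ^+ i)%:E)))).
  apply: lee_nneseries => [i _ _|i _]; first exact: wg0.
  rewrite (muleCA eps%:E) -(EFinM eps) (mulrC eps) -ge0_muleDr//; last by rewrite lee_fin mulr_ge0// exprn_ge0.
  exact: lee_wpmul2l.
have w0' i : 0 <= (pweight c s i)%:E * (c ^+ i)%:E by rewrite mule_ge0// lee_fin exprn_ge0.
rewrite nneseriesD//; last by move=> i _ _; rewrite mule_ge0.
by rewrite nneseriesZl// w1 mule1.
Qed.

End fix_s.

Lemma cpois_mono M g1 g2 s t : (0 <= s)%R -> subcdf M g1 -> subcdf M g2 ->
  (forall t, g1 t <= g2 t) -> cpois s g1 t <= cpois s g2 t.
Proof.
move=> s0 h1 h2 h12; apply: lee_nneseries => [i _ _|i _].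
  by rewrite mule_ge0 ?lee_fin ?pweight_ge0//; case: (subcdf_iter i h1).
by apply: lee_wpmul2l; rewrite ?lee_fin ?pweight_ge0//; exact: (iter_conv_mono _ h1 h2).
Qed.

End poisson_mixture.

(** * Derivative rules in one real variable *)

Section real_derivatives.
Context {R : realType}.
Implicit Types (f g : R -> R) (x : R).

Lemma is_derive1D f g x df dg : is_derive x 1 f df -> is_derive x 1 g dg ->
  is_derive x 1 (fun y => f y + g y) (df + dg).
Proof. exact: is_deriveD. Qed.

Lemma is_derive1M f g x df dg : is_derive x 1 f df -> is_derive x 1 g dg ->
  is_derive x 1 (fun y => f y * g y) (df * g x + f x * dg).
Proof.
by move=> hf hg; apply: (is_derive_eq (is_deriveM hf hg)); rewrite /GRing.scale/=; ring.
Qed.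

Lemma is_derive1Ml f (k x : R) df : is_derive x 1 f df ->
  is_derive x 1 (fun y => k * f y) (k * df).
Proof. exact: is_deriveZ. Qed.

Lemma is_derive1N f x df : is_derive x 1 f df -> is_derive x 1 (fun y => - f y) (- df).
Proof. exact: is_deriveN. Qed.

Lemma is_derive1X f n x df : is_derive x 1 f df ->
  is_derive x 1 (fun y => f y ^+ n) (n%:R * f x ^+ n.-1 * df).
Proof.
move=> hf; have -> : (fun y => f y ^+ n) = f ^+ n by apply/funext => y; rewrite exprfctE.
exact: is_deriveX.
Qed.

Lemma is_derive1_expR f x df : is_derive x 1 f df ->
  is_derive x 1 (fun y => expR (f y)) (expR (f x) * df).
Proof. by move=> hf; exact: (@is_derive1_comp _ expR f). Qed.

Lemma is_derive_le0_nincr (F dF : R -> R) (a b : R) :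
  (forall x, is_derive x 1 F (dF x)) -> (forall x, a < x < b -> dF x <= 0) ->
  a <= b -> F b <= F a.
Proof.
move=> hF h0 ab.
apply: (@ler0_derive1_le_cc _ F a b) => //.
- by move=> x; rewrite in_itv/= => /h0; rewrite derive1E; case: (hF x) => _ ->.
- by apply: derivable_within_continuous => x _.
- by rewrite in_itv/= lexx ab.
- by rewrite in_itv/= lexx ab.
Qed.

End real_derivatives.

(** * Monotonicity of the mixtures in the time parameter *)

Section poisson_mixture_time.
Context {R : realType}.

Lemma is_derive_exp_partial_sum (a : nat -> R) n (s : R) :
  is_derive s 1 (fun s => \sum_(i < n.+1) (s ^+ i / i`!%:R) * a i)
    (\sum_(i < n) (s ^+ i / i`!%:R) * a i.+1).
Proof.
elim: n => [|n ih].
  rewrite big_ord0; under eq_fun do rewrite big_ord1 expr0.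
  exact: is_derive_cst.
under eq_fun do rewrite big_ord_recr /=.
rewrite big_ord_recr/=; apply: is_derive1D.
have -> : (fun x : R => x ^+ n.+1 / n.+1`!%:R * a n.+1) =
    (fun x : R => (n.+1`!%:R^-1 * a n.+1) * x ^+ n.+1).
  by apply/funext => x /=; ring.
apply: (is_derive_eq (is_derive1Ml _ (is_derive1X _ (is_derive_id _ _)))).
rewrite factS natrM mulr1 /=.
have h1 : (n`!%:R : R) != 0 by rewrite pnatr_eq0 -lt0n fact_gt0.
by field; rewrite h1 addrC natr1 pnatr_eq0.
Qed.

(** Differentiating the sum turns [a i] into [a i.+1], while the exponential contributes
    [- c * a i]; truncation leaves one extra top term, of favourable sign. Working with partial sums
    avoids differentiating a series. *)
Lemma exp_partial_sum_nincr (a : nat -> R) (c : R) n (s s' : R) :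
  (forall i, 0 <= a i) -> (forall i, a i.+1 <= c * a i) -> 0 <= c ->
  0 <= s -> s <= s' ->
  expR (- (s' * c)) * (\sum_(i < n) (s' ^+ i / i`!%:R) * a i) <=
  expR (- (s * c)) * (\sum_(i < n) (s ^+ i / i`!%:R) * a i).
Proof.
move=> a0 ac c0 s0 ss'.
case: n => [|n]; first by rewrite !big_ord0 !mulr0.
pose F (s : R) := expR (- (s * c)) * (\sum_(i < n.+1) (s ^+ i / i`!%:R) * a i).
apply: (@is_derive_le0_nincr _ F (fun x => expR (- (x * c)) * - (1 * c + x * 0) * (\sum_(i < n.+1) (x ^+ i / i`!%:R) * a i) + expR (- (x * c)) * (\sum_(i < n) (x ^+ i / i`!%:R) * a i.+1))) => //.
  move=> x; apply: is_derive1M; last exact: is_derive_exp_partial_sum.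
  apply: is_derive1_expR; apply: is_derive1N; apply: is_derive1M.
move=> x /andP[sx _]; have x0 : 0 <= x by rewrite (le_trans s0)// ltW.
rewrite mul1r mulr0 addr0 -mulrA -mulrDr; apply: mulr_ge0_le0; first exact: expR_ge0.
rewrite mulNr addrC subr_le0 mulr_sumr.
have w0 i : 0 <= x ^+ i / i`!%:R by rewrite divr_ge0// exprn_ge0.
rewrite big_ord_recr/= -[leLHS]addr0 lerD//; last by rewrite !mulr_ge0// ?divr_ge0// exprn_ge0.
by apply: ler_sum => i _; rewrite mulrCA ler_wpM2l.
Qed.

(** The coefficients are the iterated convolutions at [t], whose successive ratios are at most [c]
    by [conv_le]; the inequality between partial sums passes to the limit. *)
Lemma cpois_nincr (c b : R) (q : R -> R) M g s s' t :
  jump_density c (b * c) q -> subcdf M g -> 0 <= s -> s <= s' ->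
  (cpois c q s' g t <= cpois c q s g t)%E.
Proof.
move=> hq hg s0 ss'.
have s'0 : 0 <= s' by exact: le_trans ss'.
have c0 : 0 <= c.
  by case: hq => _ q0 _ _ qc; rewrite -lee_fin -qc; apply: integral_ge0 => y _; rewrite lee_fin; case/andP: (q0 y).
have fi i : iter i (conv q) g t \is a fin_num.
  have [_ h0 hM _ _] := subcdf_iter hq i hg.
  by rewrite ge0_fin_numE//; apply: le_lt_trans (hM t) _; rewrite ltry.
pose a i := fine (iter i (conv q) g t).
have a0 i : 0 <= a i by rewrite fine_ge0//; case: (subcdf_iter hq i hg).
have ac i : a i.+1 <= c * a i.
  by rewrite -lee_fin EFinM /a !fineK//; exact: (conv_le hq _ (subcdf_iter hq i hg)).
have E s1 : 0 <= s1 -> forall n, (\sum_(0 <= i < n) (pweight c s1 i)%:E * iter i (conv q) g t)%E =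
    (expR (- (s1 * c)) * (\sum_(i < n) (s1 ^+ i / i`!%:R) * a i))%:E.
  move=> s10 n; rewrite big_mkord mulr_sumr -sumEFin; apply: eq_bigr => i _.
  by rewrite -(fineK (fi i)) -EFinM mulrA.
apply: lee_lim.
- by apply: is_cvg_nneseries => n _ _; rewrite -(fineK (fi n)) lee_fin mulr_ge0 ?pweight_ge0//; exact: a0.
- by apply: is_cvg_nneseries => n _ _; rewrite -(fineK (fi n)) lee_fin mulr_ge0 ?pweight_ge0//; exact: a0.
apply: nearW => n; rewrite !E// lee_fin.
exact: exp_partial_sum_nincr.
Qed.

End poisson_mixture_time.

(** * Subordinators with a Stieltjes Laplace exponent *)

Section subordinator.
Context {R : realType}.
Local Open Scope ereal_scope.
Notation mu := (@lebesgue_measure R).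

(** [H s t] stands for the probability that [S_s <= t], which is also the probability that the first
    passage time at level [t] is at least [s]. The modulus clause is confined to [s > 0] because
    [S_0] is the constant 0, whose distribution function jumps. *)
Definition inverse_subordinator (f : R -> R) (H : R -> R -> R) : Prop :=
  (forall s t, (0 <= s)%R -> (0 <= H s t <= 1)%R) /\
  (forall s t, (0 <= s)%R -> (t < 0)%R -> H s t = 0%R) /\
  (forall s t t', (0 <= s)%R -> (t <= t')%R -> (H s t <= H s t')%R) /\
  (forall s s' t, (0 <= s)%R -> (s <= s')%R -> (H s' t <= H s t)%R) /\
  (forall p s, (0 < p)%R -> (0 <= s)%R ->
    laplaceT p (fun t => (H s t)%:E) = (expR (- (s * f p)) / p)%:E) /\
  (forall s eps, (0 < s)%R -> (0 < eps)%R -> exists2 d : R, (0 < d)%R &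
     forall t, (H s (t + d) <= H s t + eps)%R).

Lemma laplaceT_heaviside (p : R) : (0 < p)%R ->
  laplaceT p (fun t => (\1_(`[0%R, +oo[%classic : set R) t)%:E) = (p^-1)%:E.
Proof.
move=> p0; rewrite /laplaceT.
rewrite -[RHS]mule1 -(integral_exponential_pdf p0) -ge0_integralZl//=.
- apply: eq_integral => x _; rewrite -!EFinM; congr EFin.
  rewrite /exponential_pdf patchE indicE; case: ifPn => _; last by rewrite !mulr0.
  by rewrite mulr1 mulrA mulVf ?gt_eqF// mul1r mulNr.
- by apply/measurable_EFinP; exact: measurable_exponential_pdf.
- by move=> x _; rewrite lee_fin exponential_pdf_ge0// ltW.
- by rewrite lee_fin invr_ge0 ltW.
Qed.

Variables (q_ : nat -> R -> R) (c_ : nat -> R) (Q_ : nat -> R -> R) (f : R -> R).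
Hypothesis hq : forall j, jump_density (c_ j) (j.+1%:R * c_ j) (q_ j).
Hypothesis hQ : forall j p, (0 < p)%R ->
  \int[mu]_y ((expR (- (p * y)) * q_ j y)%:E) = (Q_ j p)%:E.
Hypothesis Qc : forall j p, (0 < p)%R -> (0 <= Q_ j p <= c_ j)%R.
Hypothesis hf : forall p, (0 < p)%R -> \sum_(j <oo) (c_ j - Q_ j p)%:E = (f p)%:E.
Hypothesis hc : \sum_(j <oo) (c_ j)%:E = +oo.

(** Starts from the distribution function of the constant 0; applying [cpois] to the previous
    function adds an independent compound Poisson variable. *)
Fixpoint subord_approx (s : R) (N : nat) : R -> \bar R :=
  if N is N'.+1 then cpois (c_ N') (q_ N') s (subord_approx s N')
  else fun t => (\1_(`[0%R, +oo[%classic : set R) t)%:E.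

Let HN := subord_approx.

Let c0 j : (0 <= c_ j)%R.
Proof. by have /andP[a b] := Qc j ltr01; exact: le_trans b. Qed.

Lemma subcdf_approx s N : (0 <= s)%R -> subcdf 1 (HN s N).
Proof.
move=> s0; elim: N => [|N ih] /=; last exact: (subcdf_cpois (hq N)).
split=> //.
- by apply/measurable_EFinP; exact: measurable_indic.
- by move=> t; rewrite lee_fin indicE; case: (_ \in _).
- move=> x y xy; rewrite lee_fin !indicE ler_nat.
  case: (boolP (x \in _)) => //; rewrite inE/= in_itv/= andbT => x0.
  by rewrite mem_set//= in_itv/= andbT (le_trans x0).
- by move=> t t0; rewrite indicE memNset//= in_itv/= andbT leNgt t0.
Qed.

Lemma approx_decr s N t : (0 <= s)%R -> HN s N.+1 t <= HN s N t.
Proof. by move=> s0; exact: (cpois_le (hq N) s0 (subcdf_approx N s0)). Qed.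

Lemma approx_nincr_s s s' N t : (0 <= s)%R -> (s <= s')%R -> HN s' N t <= HN s N t.
Proof.
move=> s0 ss'; have s'0 := le_trans s0 ss'.
elim: N t => [//|N ih] t /=.
apply: (le_trans (cpois_mono (hq N) t s'0 (subcdf_approx N s'0) (subcdf_approx N s0) ih)).
exact: cpois_nincr (hq N) (subcdf_approx N s0) s0 ss'.
Qed.

Lemma laplaceT_approx p s N : (0 < p)%R -> (0 <= s)%R ->
  laplaceT p (HN s N) = (expR (- (s * (\sum_(j < N) (c_ j - Q_ j p))%R)) / p)%:E.
Proof.
move=> p0 s0; elim: N => [|N ih].
  by rewrite big_ord0 mulr0 oppr0 expR0 mul1r laplaceT_heaviside.
rewrite /= (laplaceT_cpois (hq N) s0 (subcdf_approx N s0) _ (hQ N p0)); last by case/andP: (Qc N p0).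
rewrite -/(HN s N) ih -EFinM; congr EFin.
rewrite mulrA -expRD big_ord_recr/=; congr (expR _ / _)%R; ring.
Qed.

(** The exponential is the mass of the atom left at 0 by the first [N] pieces. Off the atom, piece
    [j] adds at most [j + 1] to the Lipschitz constant, and these add up to at most [N ^ 2]. Pieces
    of index at least [N] do not worsen the modulus. *)
Lemma approx_modulus s N M d t : (0 <= s)%R -> (0 <= d)%R -> (N <= M)%N ->
  HN s M (t + d)%R <= HN s M t +
   (expR (- (s * \sum_(j < N) c_ j)) + (N ^ 2)%:R * d)%:E.
Proof.
move=> s0 d0.
have base t' : HN s N (t' + d)%R <= HN s N t' +
    (expR (- (s * \sum_(j < N) c_ j)) + (N ^ 2)%:R * d)%:E.
  elim: N t' => [|N ih] t'.
    rewrite big_ord0 mulr0 oppr0 expR0 mul0r addr0.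
    have [_ h0 h1 _ _] := subcdf_approx 0 s0.
    by rewrite -[leLHS]add0e; apply: leeD.
  have e0 : (0 <= expR (- (s * \sum_(j < N) c_ j)) + (N ^ 2)%:R * d)%R.
    by rewrite addr_ge0 ?expR_ge0// mulr_ge0.
  have := cpois_modulus (hq N) s0 (subcdf_approx N s0) t' e0 d0 (ler0n _ _) ih.
  move/le_trans; apply; rewrite leeD2l// lee_fin.
  have -> : (expR (- (s * \sum_(j < N.+1) c_ j)) =
      expR (- (s * c_ N)) * expR (- (s * \sum_(j < N) c_ j)))%R.
    by rewrite -expRD big_ord_recr/=; congr expR; ring.
  rewrite mulrDr -addrA lerD2l// mul1r.
  have h1 : (expR (- (s * c_ N)) * ((N ^ 2)%:R * d) <= (N ^ 2)%:R * d)%R.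
    by rewrite ler_piMl// ?mulr_ge0// -expR0 ler_expR lerNl oppr0 mulr_ge0.
  apply: le_trans (lerD h1 (lexx _)) _.
  by rewrite -mulrDl ler_wpM2r// -natrD ler_nat -!mulnn mulnS addnC leq_add2l leq_mul2r leqnSn orbT.
move=> NM; rewrite -(subnKC NM); elim: (M - N)%N t => [|k ih] t; first by rewrite addn0.
rewrite addnS; apply: (cpois_le_add (hq _) s0 (subcdf_approx _ s0)) => //.
by rewrite addr_ge0 ?expR_ge0// mulr_ge0.
Qed.

Definition subord_lim s t : \bar R := limn (fun N => HN s N t).

Lemma approx_cvg s t : (0 <= s)%R -> HN s N t @[N --> \oo] --> subord_lim s t.
Proof.
move=> s0; apply: ereal_nonincreasing_is_cvgn.
by apply/nonincreasing_seqP => N; exact: approx_decr.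
Qed.

Lemma exists_inverse_subordinator : exists H, inverse_subordinator f H.
Proof.
pose H s t := fine (subord_lim s t).
have L01 s t : (0 <= s)%R -> 0 <= subord_lim s t <= 1.
  move=> s0; apply/andP; split.
    by apply: lime_ge; [exact: approx_cvg|apply: nearW => N; case: (subcdf_approx N s0)].
  by apply: lime_le; [exact: approx_cvg|apply: nearW => N; case: (subcdf_approx N s0)].
have Hfin s t : (0 <= s)%R -> (H s t)%:E = subord_lim s t.
  move=> s0; have /andP[a b] := L01 s t s0; rewrite fineK// ge0_fin_numE//.
  by rewrite (le_lt_trans b)// ltry.
exists H; split; [|split; [|split; [|split; [|split]]]].
- by move=> s t s0; rewrite -!lee_fin Hfin// L01.
- move=> s t s0 t0; apply: EFin_inj; rewrite Hfin//; apply/cvg_lim => //.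
  apply: (cvg_trans (near_eq_cvg _) (cvg_cst 0)).
  by apply: nearW => N; case: (subcdf_approx N s0) => _ _ _ _ /(_ _ t0).
- move=> s t t' s0 tt'; rewrite -lee_fin !Hfin//; apply: lee_lim; [exact: approx_cvg..|].
  by apply: nearW => N; case: (subcdf_approx N s0) => _ _ _ /(_ _ _ tt').
- move=> s s' t s0 ss'; have s'0 := le_trans s0 ss'; rewrite -lee_fin !Hfin//.
  apply: lee_lim; [exact: approx_cvg..|].
  by apply: nearW => N; exact: approx_nincr_s.
- move=> p s p0 s0.
  have me : measurable_fun setT (fun t : R => (expR (- (p * t)))%:E).
    by apply/measurable_EFinP; apply: measurableT_comp => //; apply: measurableT_comp => //; exact: mulrl_measurable.
  have mN N : measurable_fun setT (fun t : R => (expR (- (p * t)))%:E * HN s N t).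
    by apply: emeasurable_funM => //; case: (subcdf_approx N s0).
  have cN t : (expR (- (p * t)))%:E * HN s N t @[N --> \oo] --> (expR (- (p * t)))%:E * (H s t)%:E.
    by rewrite Hfin//; apply: cvgeZl => //; exact: approx_cvg.
  have e0 t : 0 <= (expR (- (p * t)))%:E by rewrite lee_fin expR_ge0.
  (* The approximations decrease in [N], so the one at [N = 0], the Heaviside function,
     dominates. *)
  have := @dominated_convergence _ _ R mu setT measurableT _ _
    (fun t => (expR (- (p * t)))%:E * HN s 0 t) mN (emeasurable_fun_cvg _ _ mN (fun t _ => cN t)).
  case.
  + by apply: aeW => t _; exact: cN.
  + apply/integrableP; split; first exact: mN.
    under eq_integral => t _ do rewrite gee0_abs ?mule_ge0//=.
    by have := laplaceT_approx 0 p0 s0; rewrite /laplaceT => ->; rewrite ltry.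
  + apply: aeW => t N _; rewrite gee0_abs.
      apply: lee_wpmul2l => //; elim: N => [//|N ih].
      exact: le_trans (approx_decr _ _ s0) ih.
    by rewrite mule_ge0//; case: (subcdf_approx N s0).
  move=> _ _ cint.
  rewrite /laplaceT; rewrite -(cvg_lim _ cint)//; apply/cvg_lim => //.
  under eq_fun do rewrite -/(laplaceT p _) laplaceT_approx//.
  apply: cvg_EFin; first exact: nearW.
  rewrite /comp/=.
  apply: cvgM; last exact: cvg_cst.
  apply: continuous_cvg; first exact: continuous_expR.
  apply: cvgN; apply: cvgM; first exact: cvg_cst.
  have : cvgn (fun n => \sum_(0 <= j < n) (c_ j - Q_ j p)%:E).
    by apply: is_cvg_nneseries => n _ _; rewrite lee_fin subr_ge0; case/andP: (Qc n p0).
  rewrite hf// => /fine_cvg; rewrite /comp/=.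
  by under eq_fun do rewrite big_mkord sumEFin/=.
- move=> s eps s0 eps0.
  (* Divergence of the total jump mass brings the atom of the first [N] pieces below [eps / 2]. *)
  have [N hN] : exists N, (expR (- (s * \sum_(j < N) c_ j)) < eps / 2)%R.
    have : (\sum_(0 <= j < n) (c_ j)%:E) @[n --> \oo] --> +oo.
      by rewrite -hc; apply: is_cvg_nneseries => n _ _; rewrite lee_fin.
    move/cvgeyPgt => /(_ (- ln (eps / 2) / s)%R) [N _ /(_ N (leqnn N))].
    rewrite /= big_mkord sumEFin lte_fin => h; exists N.
    rewrite -[ltRHS]lnK ?posrE ?divr_gt0// ltr_expR ltrNl.
    by rewrite -ltr_pdivrMl// mulrC.
  (* The Lipschitz part takes the other half; the successor keeps the divisor positive when
     [N = 0]. *)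
  exists (eps / 2 / (N ^ 2).+1%:R)%R; first by rewrite !divr_gt0.
  move=> t; have s0' := ltW s0; rewrite -lee_fin EFinD !Hfin//.
  have cR : HN s n t + eps%:E @[n --> \oo] --> subord_lim s t + eps%:E.
    by apply: cvgeD; [rewrite fin_num_adde_defl|exact: approx_cvg|exact: cvg_cst].
  rewrite -(cvg_lim _ cR)//; apply: lee_lim.
  + exact: approx_cvg.
  + by apply/cvg_ex; exists (subord_lim s t + eps%:E).
  exists N => // M /= NM; have d0 : (0 <= eps / 2 / (N ^ 2).+1%:R)%R by rewrite !divr_ge0// ltW.
  apply: le_trans (approx_modulus t s0' d0 NM) _; rewrite leeD2l// lee_fin.
  rewrite [leRHS](splitr eps) lerD// ?ltW//.
  rewrite mulrCA gtr_pMr ?divr_gt0//.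
  by rewrite ltr_pdivrMr// mul1r ltr_nat.
Qed.

End subordinator.

(** * Jump densities from the pieces of a Stieltjes measure *)

Section stieltjes_piece.
Context {R : realType}.
Local Open Scope ereal_scope.
Notation mu := (@lebesgue_measure R).

Lemma expR_half_line_integral (p : R) : (0 < p)%R ->
  \int[mu]_y (expR (- (p * y)) * \1_(`[0%R, +oo[%classic : set R) y)%:E = (p^-1)%:E.
Proof.
by move=> p0; rewrite -(laplaceT_heaviside p0); apply: eq_integral => y _; rewrite EFinM.
Qed.

Variables (sigma : {measure set R -> \bar R}) (a b : R).
Hypotheses (a0 : (0 <= a)%R) (ab : (a < b)%R).
Let D : set R := `]a, b]%classic.
Let mD : measurable D. Proof. exact: measurable_itv. Qed.
Hypothesis moo : sigma D < +oo.
Let m := mfrestr mD moo.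
Let c := fine (sigma D).

Let Dpos x : D x -> (0 < x <= b)%R.
Proof. by rewrite /D/= in_itv/= => /andP[ax ->]; rewrite (le_lt_trans a0 ax). Qed.

Let b0 : (0 < b)%R. Proof. exact: le_lt_trans a0 ab. Qed.

Let cE : c%:E = sigma D. Proof. by rewrite fineK// ge0_fin_numE. Qed.

Let c0 : (0 <= c)%R. Proof. by rewrite -lee_fin cE. Qed.

(** The indicator of [D] is part of the kernel so that integrals run over the whole space against
    the finite restriction [m], to which Tonelli applies; [sigma] itself is not assumed
    sigma-finite. *)
Definition exp_kernel (x y : R) : R :=
  (x * expR (- (x * y)) * \1_(`[0%R, +oo[%classic : set R) y * \1_D x)%R.

Lemma exp_kernel_ge0 x y : (0 <= exp_kernel x y)%R.
Proof.
rewrite /exp_kernel (indicE _ D); case: (boolP (x \in D)) => [/set_mem/Dpos/andP[x0 _]|_]; last by rewrite mulr0.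
by rewrite mulr1 !mulr_ge0// ?expR_ge0// ltW.
Qed.

Lemma exp_kernel_le x y : (exp_kernel x y <= b * \1_D x)%R.
Proof.
rewrite /exp_kernel (indicE _ D); case: (boolP (x \in D)) => [/set_mem/Dpos/andP[x0 xb]|_]; last by rewrite !mulr0.
rewrite !mulr1 indicE; case: (boolP (y \in _)) => [|_]; last by rewrite mulr0 ltW.
rewrite inE/= in_itv/= andbT => y0; rewrite mulr1 (le_trans _ xb)// (ler_piMr (ltW x0))//.
by rewrite -expR0 ler_expR lerNl oppr0 mulr_ge0// ltW.
Qed.

Lemma measurable_exp_kernel : measurable_fun setT (fun z : R * R => exp_kernel z.1 z.2).
Proof.
have mI (A : set R) : measurable A -> measurable_fun setT (\1_A : R -> R).
  by move=> mA; exact: measurable_indic.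
apply: measurable_funM; last exact: (measurableT_comp (mI _ mD) measurable_fst).
apply: measurable_funM; last first.
  by apply: (measurableT_comp (mI _ _) measurable_snd); exact: measurable_itv.
apply: measurable_funM; first exact: measurable_fst.
apply: measurableT_comp => //; apply: measurableT_comp => //.
by apply: measurable_funM; [exact: measurable_fst|exact: measurable_snd].
Qed.

Let mk_ y : measurable_fun setT (fun x => (exp_kernel x y)%:E).
Proof. by apply/measurable_EFinP; exact: (measurable_fun_pair1 y measurable_exp_kernel). Qed.

Lemma integral_piece (g : R -> \bar R) :
  \int[m]_(x in D) g x = \int[sigma]_(x in D) g x.
Proof.
apply: eq_measure_integral => A mA AD.
by rewrite /= /mfrestr /mrestr (setIidl AD).
Qed.

Let m1 : \int[m]_x (\1_D x)%:E = c%:E.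
Proof. by rewrite integral_indic// setIT cE /= /mfrestr /mrestr setIid. Qed.

Definition piece_density (y : R) : R := fine (\int[m]_x (exp_kernel x y)%:E).

Lemma piece_density_bounds y : 0 <= \int[m]_x (exp_kernel x y)%:E <= (b * c)%:E.
Proof.
apply/andP; split; first by apply: integral_ge0 => x _; rewrite lee_fin exp_kernel_ge0.
rewrite EFinM -m1 -ge0_integralZl//; last 2 first.
- by apply/measurable_EFinP; exact: measurable_indic.
- by rewrite lee_fin ltW.
apply: ge0_le_integral => //.
- by move=> x _; rewrite lee_fin exp_kernel_ge0.
- by apply: emeasurable_funM => //; apply/measurable_EFinP; exact: measurable_indic.
- by move=> x _; rewrite -EFinM lee_fin exp_kernel_le.
Qed.

Lemma piece_densityE y : (piece_density y)%:E = \int[m]_x (exp_kernel x y)%:E.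
Proof.
have /andP[h1 h2] := piece_density_bounds y.
by rewrite fineK// ge0_fin_numE// (le_lt_trans h2)// ltry.
Qed.

(* Tonelli: the transform of the mixture is the mixture of the transforms. *)
Lemma piece_density_fubini (w : R -> R) (W : R -> R) :
  measurable_fun setT w -> (forall y, (0 <= w y)%R) ->
  (forall x, D x -> \int[mu]_y (w y * (x * expR (- (x * y)) * \1_(`[0%R, +oo[%classic : set R) y))%:E = (W x)%:E) ->
  \int[mu]_y (w y * piece_density y)%:E = \int[sigma]_(x in D) (W x)%:E.
Proof.
move=> mw w0 hW.
transitivity (\int[mu]_y \int[m]_x (w y * exp_kernel x y)%:E).
  apply: eq_integral => y _; rewrite EFinM piece_densityE -ge0_integralZl//.
  - by move=> x _; rewrite lee_fin exp_kernel_ge0.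
  - by rewrite lee_fin.
rewrite -(@fubini_tonelli _ _ _ _ _ m mu (fun z => (w z.2 * exp_kernel z.1 z.2)%:E)); last 2 first.
- apply/measurable_EFinP; apply: measurable_funM; last exact: measurable_exp_kernel.
  exact: (measurableT_comp mw measurable_snd).
- by move=> z; rewrite lee_fin mulr_ge0// exp_kernel_ge0.
rewrite -integral_piece [RHS]integral_mkcond; apply: eq_integral => x _ /=.
rewrite patchE; case: ifPn => [xD|xD].
  rewrite -hW; last exact/set_mem.
  by apply: eq_integral => y _; rewrite /exp_kernel (indicE _ D) xD mulr1.
by apply: integral0_eq => y _; rewrite /exp_kernel (indicE _ D) (negbTE xD) !mulr0.
Qed.

(** Subtracting this from the mass of [D] leaves the integral of [p / (p + x)], the share of the
    piece in the symbol. *)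
Lemma piece_laplace p : (0 < p)%R ->
  \int[mu]_y (expR (- (p * y)) * piece_density y)%:E = \int[sigma]_(x in D) (x / (p + x))%:E.
Proof.
move=> p0; apply: piece_density_fubini.
- by apply: measurableT_comp => //; apply: measurableT_comp => //; exact: mulrl_measurable.
- by move=> y; exact: expR_ge0.
move=> x /Dpos/andP[x0 _].
rewrite EFinM -expR_half_line_integral ?addr_gt0// -ge0_integralZl//.
- apply: eq_integral => y _; rewrite -EFinM; congr EFin.
  by rewrite mulrDl opprD expRD; ring.
- apply/measurable_EFinP; apply: measurable_funM; last by apply: measurable_indic; exact: measurable_itv.
  by apply: measurableT_comp => //; apply: measurableT_comp => //; exact: mulrl_measurable.
- by rewrite lee_fin ltW.
Qed.

(** The bound comes from [x <= b], the monotonicity from that of each exponential, and the mass from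
    the fact that [x * exp (- (x * y))] integrates to 1 over the half-line when [x > 0]. *)
Lemma jump_density_piece : jump_density c (b * c) piece_density.
Proof.
have m1y : measurable_fun setT (fun y => \int[m]_x (exp_kernel x y)%:E).
  apply: (@measurable_fun_fubini_tonelli_G _ _ _ _ _ m (fun z => (exp_kernel z.1 z.2)%:E)).
    by apply/measurable_EFinP; exact: measurable_exp_kernel.
  by move=> z; rewrite lee_fin exp_kernel_ge0.
split.
- exact: (measurableT_comp (fine_measurable measurableT) m1y).
- by move=> y; rewrite -!lee_fin piece_densityE piece_density_bounds.
- move=> y y0; apply: EFin_inj; rewrite piece_densityE; apply: integral0_eq => x _.
  by rewrite /exp_kernel (indicE _ (`[0%R, +oo[%classic : set R)) memNset ?mulr0 ?mul0r//= in_itv/= andbT leNgt y0.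
- move=> x y x0 xy; rewrite -lee_fin !piece_densityE; apply: ge0_le_integral => //.
  + by move=> z _; rewrite lee_fin exp_kernel_ge0.
  + move=> z _; rewrite lee_fin /exp_kernel (indicE _ D); case: (boolP (z \in D)) => [/set_mem/Dpos/andP[z0 _]|_]; last by rewrite !mulr0.
    rewrite !mulr1 !indicE !mem_set/=; last 2 first.
    - by rewrite in_itv/= x0.
    - by rewrite in_itv/= (le_trans x0).
    by rewrite !mulr1 (ler_wpM2l (ltW z0))// ler_expR lerN2 (ler_wpM2l (ltW z0)).
- under eq_integral do rewrite -[piece_density _]mul1r.
  rewrite (@piece_density_fubini (fun=> 1%R) (fun=> 1%R))//; first by rewrite integral_cst// mul1e cE.
  move=> x /Dpos/andP[x0 _]; under eq_integral do rewrite mul1r -mulrA EFinM.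
  rewrite ge0_integralZl//.
  - by rewrite expR_half_line_integral// -EFinM mulfV// gt_eqF.
  - apply/measurable_EFinP; apply: measurable_funM; last by apply: measurable_indic; exact: measurable_itv.
    by apply: measurableT_comp => //; apply: measurableT_comp => //; exact: mulrl_measurable.
  - by rewrite lee_fin ltW.
Qed.

End stieltjes_piece.

(** * Subordinators attached to Stieltjes symbols *)

Section stieltjes.
Context {R : realType}.
Local Open Scope ereal_scope.
Notation mu := (@lebesgue_measure R).

Lemma measurable_inv_shift (p : R) : (0 < p)%R ->
  measurable_fun (`[0%R, +oo[%classic : set R) (fun x => (p + x)^-1%R).
Proof.
move=> p0.
(* On the half-line the inverse agrees with a composition of functions measurable on the whole line,
   which bypasses the pole. *)
apply: (eq_measurable_fun (fun x => expR (- ln (p + x)))).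
  move=> x /set_mem; rewrite /= in_itv/= andbT => x0.
  by rewrite expRN lnK// posrE ltr_wpDr.
apply: measurable_funTS; apply: measurableT_comp => //; apply: measurableT_comp => //.
apply: measurableT_comp; first exact: measurable_ln.
exact: measurable_funD.
Qed.

Lemma itv0y_bigcup : (`]0%R, +oo[%classic : set R) = \bigcup_j (`]j%:R, j.+1%:R]%classic : set R).
Proof.
apply/seteqP; split => x /=; last first.
  by move=> [j _ /=]; rewrite !in_itv/= andbT => /andP[jx _]; exact: le_lt_trans jx.
rewrite in_itv/= andbT => x0.
have xr : (x : R) \is Num.real by exact: num_real.
(* Right-closed intervals make the index [ceil x - 1], also when [x] is an integer. *)
exists (absz (Num.ceil x)).-1 => //=.
have c0 : (0 < Num.ceil x)%R by rewrite ceil_gt0.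
have e : (absz (Num.ceil x))%:R = (Num.ceil x)%:~R :> R.
  by rewrite natr_absz gtr0_norm.
have h : (0 < absz (Num.ceil x))%N by rewrite absz_gt0 gt_eqF.
rewrite in_itv/= (prednK h) e ceil_ge andbT.
rewrite -(ltrD2r 1%R) natr1 (prednK h) e.
by have := ceilB1_lt x; rewrite intrD rmorphN/= ltrBlDr.
Qed.

Lemma stieltjes_inverse_subordinator (sigma : {measure set R -> \bar R}) (f : R -> R) :
  (forall p, (0 < p)%R -> \int[sigma]_(x in `]0%R, +oo[%classic) (p / (p + x))%:E = (f p)%:E) ->
  f p @[p --> +oo%R] --> +oo%R ->
  exists H, inverse_subordinator f H.
Proof.
move=> hf foo.
pose D (j : nat) : set R := `]j%:R, j.+1%:R]%classic.
have mD j : measurable (D j) by exact: measurable_itv.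
have D0 j x : D j x -> (0 < x)%R.
  by rewrite /D /= in_itv/= => /andP[jx _]; exact: le_lt_trans jx.
have mi p : (0 < p)%R -> forall N : R -> R, measurable_fun setT N ->
    measurable_fun (`]0%R, +oo[%classic : set R) (fun x => (N x / (p + x))%:E).
  move=> p0 N mN; apply/measurable_EFinP; apply: measurable_funM; first exact: measurable_funTS.
  apply: measurable_funS (measurable_inv_shift p0) => //.
  by apply: subset_itvr; rewrite bnd_simp.
have DS j : D j `<=` `]0%R, +oo[%classic.
  by move=> x /D0; rewrite /= in_itv/= andbT.
have miD j p : (0 < p)%R -> forall N : R -> R, measurable_fun setT N ->
    measurable_fun (D j) (fun x => (N x / (p + x))%:E).
  by move=> p0 N mN; apply: measurable_funS (mi p p0 N mN) => //; exact: DS.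
(* On [D j] one has [1 <= (j + 2) / (1 + x)], and the integral of [1 / (1 + x)] is at most [f 1]. *)
have moo j : sigma (D j) < +oo.
  apply: (@le_lt_trans _ _ (\int[sigma]_(x in D j) ((1 + j.+1%:R)%:E * (1 / (1 + x))%:E))).
    rewrite -[leLHS]mul1e -integral_cst//; apply: ge0_le_integral => //.
    - by apply: measurable_funeM; exact: (miD j 1%R ltr01 (fun=> 1%R)).
    - move=> x /[dup] /D0 x0; rewrite /D/= in_itv/= => /andP[_ xj].
      by rewrite -EFinM lee_fin mul1r ler_pdivlMr ?addr_gt0// mul1r lerD2l.
  rewrite ge0_integralZl//; last 2 first.
  - exact: (miD j 1%R ltr01 (fun=> 1%R)).
  - by move=> x /D0 x0; rewrite lee_fin divr_ge0// addr_ge0// ltW.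
  apply: lte_mul_pinfty => //.
  apply: (@le_lt_trans _ _ (f 1)%:E); last by rewrite ltry.
  rewrite -hf//; apply: ge0_subset_integral => //.
  - exact: (mi 1%R ltr01 (fun=> 1%R)).
  - by move=> x; rewrite /= in_itv/= andbT => x0; rewrite lee_fin divr_ge0// addr_ge0// ltW.
have jj j : (j%:R < j.+1%:R :> R)%R by rewrite ltr_nat.
pose c j := fine (sigma (D j)).
have cE j : (c j)%:E = sigma (D j) by rewrite /c fineK// ge0_fin_numE.
pose A j p := \int[sigma]_(x in D j) (x / (p + x))%:E.
pose B j p := \int[sigma]_(x in D j) (p / (p + x))%:E.
(* [x / (p + x)] and [p / (p + x)] add up to 1. *)
have AB j p : (0 < p)%R -> (c j)%:E = A j p + B j p.
  move=> p0; rewrite cE -[LHS]mul1e -integral_cst// /A /B -ge0_integralD//.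
  - apply: eq_integral => x /set_mem/D0 x0; rewrite -EFinD /= -mulrDl addrC divff//.
    by rewrite gt_eqF// addr_gt0.
  - by move=> x /D0 x0; rewrite lee_fin divr_ge0 ?ltW// addr_gt0.
  - exact: (miD j p p0 id).
  - by move=> x /D0 x0; rewrite lee_fin divr_ge0 ?ltW// addr_gt0.
  - exact: (miD j p p0 (fun=> p)).
have A0 j p : (0 < p)%R -> 0 <= A j p.
  by move=> p0; apply: integral_ge0 => x /D0 x0; rewrite lee_fin divr_ge0 ?ltW// addr_gt0.
have B0 j p : (0 < p)%R -> 0 <= B j p.
  by move=> p0; apply: integral_ge0 => x /D0 x0; rewrite lee_fin divr_ge0 ?ltW// addr_gt0.
have AE j p : (0 < p)%R -> (fine (A j p))%:E = A j p.
  move=> p0; rewrite fineK// ge0_fin_numE ?A0//; apply: (@le_lt_trans _ _ (c j)%:E); last by rewrite ltry.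
  by rewrite (AB j p p0) leeDl// B0.
have BE j p : (0 < p)%R -> (c j - fine (A j p))%:E = B j p.
  by move=> p0; rewrite EFinB (AB j p p0) AE// addeAC subee ?add0e// -AE.
have SB p : (0 < p)%R -> \sum_(j <oo) (c j - fine (A j p))%:E = (f p)%:E.
  move=> p0; under eq_eseriesr do rewrite BE//.
  rewrite -hf// itv0y_bigcup ge0_integral_bigcup//.
  - by rewrite -itv0y_bigcup; exact: (mi p p0 (fun=> p)).
  - by rewrite -itv0y_bigcup => x; rewrite /= in_itv/= andbT => x0; rewrite lee_fin divr_ge0 ?ltW// addr_gt0.
  - apply/trivIsetP => i j _ _ ij; apply/seteqP; split => [x [] |//].
    rewrite /D /= !in_itv/= => /andP[ix xi] /andP[jx xj].
    apply: (negP ij); rewrite eqn_leq; apply/andP; split.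
      by rewrite -ltnS -(ltr_nat R); exact: lt_le_trans xj.
    by rewrite -ltnS -(ltr_nat R); exact: lt_le_trans xi.
apply: (@exists_inverse_subordinator _ (fun j => piece_density (moo j)) c (fun j p => fine (A j p))).
- by move=> j; exact: (jump_density_piece (ler0n R j) (jj j)).
- by move=> j p p0; rewrite (piece_laplace (ler0n R j) (jj j))// AE.
- move=> j p p0; rewrite fine_ge0 ?A0//= -lee_fin AE// (AB j p p0) leeDl// B0//.
- exact: SB.
(* Each mass [c j] is at least its share of [f p], so the total mass is at least [f p] for every
   [p], and [f] is unbounded. *)
apply/eqyP => M M0.
have : \forall p \near +oo%R, (0 < p)%R /\ (M <= f p)%R.
  near=> p; split; near: p; first exact: nbhs_pinfty_gt.
  by move/cvgryPge : foo; apply.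
move/filter_ex => [p [p0 Mp]]; apply: (@le_trans _ _ (f p)%:E); first by rewrite lee_fin.
rewrite -SB//; apply: lee_nneseries => [j _ _|j _]; first by rewrite BE// B0.
by rewrite BE// (AB j p p0) leeDr// A0.
Unshelve. all: by end_near. Qed.

End stieltjes.

(** * Consequences of the limits of the Laplace transform of the kernel *)

Section star.
Context {R : realType}.

Lemma cvg0_ge_eq0 (T : Type) (F : set_system T) {FF : ProperFilter F} (g : T -> R) (a : R) :
  0 <= a -> g x @[x --> F] --> 0 -> (\forall x \near F, a <= g x) -> a = 0.
Proof.
move=> a0 cg ag; apply/eqP; rewrite eq_le a0 andbT.
rewrite -(cvg_lim _ cg)//; apply: limr_ge => //.
by apply/cvg_ex; exists 0.
Qed.

Lemma star_inverse_subordinator (k : R -> R) : assumption_star k ->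
  (exists H, inverse_subordinator (fun p => p * laplace k p) H) /\
  (forall p, 0 < p -> 0 < p * laplace k p).
Proof.
case=> _ [[a [b [sigma [a0 b0 _ hK]]]] _ K0 pK0 pKoo].
have mi (D : set R) p : 0 < p -> (D `<=` `[0, +oo[) -> measurable D ->
    measurable_fun D (fun x => ((p + x)^-1)%:E).
  move=> p0 DS mD; apply/measurable_EFinP.
  by apply: measurable_funS (measurable_inv_shift p0) => //; exact: measurable_itv.
have S0 : `]0, +oo[%classic `<=` (`[0, +oo[%classic : set R).
  by apply: subset_itvr; rewrite bnd_simp.
have i0 (D : set R) p : 0 < p -> (D `<=` `[0, +oo[) -> (0 <= \int[sigma]_(x in D) ((p + x)^-1)%:E)%E.
  move=> p0 DS; apply: integral_ge0 => x /DS; rewrite /= in_itv/= andbT => x0.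
  by rewrite lee_fin invr_ge0 addr_ge0// ltW.
(* An atom of [sigma] at 0 contributes a multiple of [1 / p], exactly like the term [a / p];
   isolating it leaves an integral over the open half-line. *)
have split0 p : 0 < p -> (\int[sigma]_(x in @halfline R) ((p + x)^-1)%:E =
   (p^-1)%:E * sigma [set 0%R] + \int[sigma]_(x in `]0%R, +oo[%classic) ((p + x)^-1)%:E)%E.
  move=> p0; have -> : @halfline R = [set 0] `|` `]0, +oo[%classic.
    by rewrite setU1itv.
  have sub : [set 0] `|` `]0, +oo[%classic `<=` (`[0, +oo[%classic : set R).
    by move=> x [->|/S0//]; rewrite /= in_itv/= lexx.
  rewrite ge0_integral_setU//=.
  - congr (_ + _)%E; rewrite -integral_cst//; apply: eq_integral => x.
    by rewrite inE/= => ->; rewrite addr0.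
  - by apply: mi => //; apply: measurableU.
  - move=> x /sub; rewrite /= in_itv/= andbT => x0.
    by rewrite lee_fin invr_ge0 addr_ge0// ltW.
  - by apply/disj_setPS => x [/= ->]; rewrite in_itv/= ltxx.
have fin p : 0 < p -> ((p^-1)%:E * sigma [set 0%R])%E \is a fin_num /\
    (\int[sigma]_(x in `]0%R, +oo[%classic) ((p + x)^-1)%:E)%E \is a fin_num.
  move=> p0; apply/andP; rewrite -fin_numD -split0//.
  rewrite ge0_fin_numE ?i0//; apply: (@le_lt_trans _ _ (laplace k p)%:E); last by rewrite ltry.
  by rewrite hK// leeDr// lee_fin addr_ge0// divr_ge0// ltW.
have s0fin : sigma [set 0] \is a fin_num.
  by have [] := fin 1 ltr01; rewrite invr1 mul1e.
pose s0 := fine (sigma [set 0]).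
have s00 : 0 <= s0 by apply: fine_ge0.
pose G p := fine (\int[sigma]_(x in `]0%R, +oo[%classic) ((p + x)^-1)%:E)%E.
have G0 p : 0 < p -> 0 <= G p by move=> p0; rewrite fine_ge0// i0.
have KE p : 0 < p -> laplace k p = a / p + b + s0 / p + G p.
  move=> p0; have [f1 f2] := fin p p0; apply: EFin_inj.
  rewrite hK// split0// -(fineK s0fin) -(fineK f2) -/s0 -/(G p).
  by rewrite -EFinM -!EFinD; congr EFin; ring.
have b_0 : b = 0.
  apply: (cvg0_ge_eq0 b0 K0); near=> p.
  have p0 : 0 < p by near: p; exact: nbhs_pinfty_gt.
  have h1 := divr_ge0 a0 (ltW p0); have h2 := divr_ge0 s00 (ltW p0); have h3 := G0 p p0.
  by rewrite KE//; lra.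
have as_0 : a + s0 = 0.
  apply: (cvg0_ge_eq0 (addr_ge0 a0 s00) pK0); near=> p.
  have p0 : 0 < p by near: p; exact: nbhs_right_gt.
  have -> : p * laplace k p = a + s0 + p * G p.
    by rewrite KE// b_0; field; rewrite gt_eqF.
  by rewrite lerDl mulr_ge0 ?G0// ltW.
have KG p : 0 < p -> laplace k p = G p.
  by move=> p0; rewrite KE// b_0 addr0 -mulrDl as_0 mul0r add0r.
have fE p : 0 < p -> (\int[sigma]_(x in `]0%R, +oo[%classic) (p / (p + x))%:E = (p * laplace k p)%:E)%E.
  move=> p0; have [_ f2] := fin p p0.
  rewrite KG// EFinM /G fineK// -ge0_integralZl//.
  - by apply: mi.
  - by move=> x; rewrite /= in_itv/= andbT => x0; rewrite lee_fin invr_ge0 addr_ge0// ltW.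
  - by rewrite lee_fin ltW.
split; first exact: (stieltjes_inverse_subordinator fE pKoo).
move=> p p0; rewrite mulr_gt0//.
(* Positivity at [p]: this yields [q >= p] with [laplace k q > 0], and the Stieltjes integral
   decreases in its argument, so [laplace k p >= laplace k q]. *)
have : \forall q \near (+oo : set_system R), p <= q /\ 1 <= q * laplace k q.
  near=> q; split; near: q; first by apply: nbhs_pinfty_ge; rewrite num_real.
  by move/cvgryPge : pKoo; apply.
move/filter_ex => [q [pq h1]].
have q0 : 0 < q by exact: lt_le_trans pq.
apply: (@lt_le_trans _ _ (laplace k q)).
  by rewrite -(pmulr_rgt0 _ q0) (lt_le_trans ltr01).
have [_ f2] := fin p p0; have [_ f3] := fin q q0.
rewrite !KG// -lee_fin /G (fineK f2) (fineK f3).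
apply: ge0_le_integral => //.
- by move=> x; rewrite /= in_itv/= andbT => x0; rewrite lee_fin invr_ge0 addr_ge0// ltW.
- by apply: mi.
- by apply: mi.
- move=> x; rewrite /= in_itv/= andbT => x0.
  by rewrite lee_fin lef_pV2 ?posrE ?addr_gt0// lerD2r.
Unshelve. all: by end_near. Qed.

End star.

(** * Integration against a density *)

Section density.
Local Open Scope ereal_scope.
Context d (T : measurableType d) (R : realType).
Variables (m n : {measure set T -> \bar R}) (g : T -> R).
Hypotheses (mg : measurable_fun setT g) (g0 : forall x, (0 <= g x)%R).
Hypothesis ng : forall A, measurable A -> n A = \int[m]_(x in A) (g x)%:E.

Import HBNNSimple.

Let mge : measurable_fun setT (fun x => (g x)%:E). Proof. exact/measurable_EFinP. Qed.
Let g0e x : 0 <= (g x)%:E. Proof. by rewrite lee_fin. Qed.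

Let density_indic (A : set T) : measurable A ->
  \int[n]_x (\1_A x)%:E = \int[m]_x ((\1_A x)%:E * (g x)%:E).
Proof.
move=> mA; rewrite integral_indic// setIT ng// integral_mkcond; apply: eq_integral => x _.
by rewrite patchE indicE; case: ifPn; rewrite ?mul1e ?mul0e.
Qed.

Let density_nnsfun (h : {nnsfun T >-> R}) :
  \int[n]_x (h x)%:E = \int[m]_x ((h x)%:E * (g x)%:E).
Proof.
under [LHS]eq_integral do rewrite fimfunE -fsumEFin//.
rewrite [LHS]ge0_integral_fsum//; last 2 first.
  - by move=> r; exact/measurable_EFinP/measurableT_comp.
  - by move=> k x _; rewrite EFinM nnfun_muleindic_ge0.
under [RHS]eq_integral.
  move=> x xD; rewrite fimfunE -fsumEFin// muleC ge0_mule_fsumr; last first.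
    by move=> r; rewrite EFinM nnfun_muleindic_ge0.
  over.
rewrite [RHS]ge0_integral_fsum//; last 2 first.
  - by move=> r; apply: emeasurable_funM => //; exact/measurable_EFinP/measurableT_comp.
  - by move=> k x _; rewrite mule_ge0// EFinM nnfun_muleindic_ge0.
apply: eq_fsbigr => r _; have [r0|r0] := leP 0%R r; last first.
  rewrite preimage_nnfun0//; rewrite !integral0_eq// => x _; rewrite indicE in_set0 mulr0 ?mule0//.
under eq_integral do rewrite EFinM.
rewrite ge0_integralZl//; last exact/measurable_EFinP.
rewrite density_indic//.
under [RHS]eq_integral do rewrite EFinM muleC -muleA.
rewrite ge0_integralZl//.
- by apply: emeasurable_funM => //; exact/measurable_EFinP.
- by move=> x _; rewrite mule_ge0// lee_fin.
Qed.

Lemma ge0_integral_density (f : T -> \bar R) : measurable_fun setT f ->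
  (forall x, 0 <= f x) -> \int[n]_x f x = \int[m]_x (f x * (g x)%:E).
Proof.
move=> mf f0; pose f_ := nnsfun_approx measurableT mf.
have cf x : (f_ k x)%:E @[k --> \oo] --> f x by apply: cvg_nnsfun_approx.
have nf x (a b : nat) : (a <= b)%N -> (f_ a x)%:E <= (f_ b x)%:E.
  by move=> ab; rewrite lee_fin//; exact/lefP/nd_nnsfun_approx.
transitivity (limn (fun k => \int[n]_x (f_ k x)%:E)).
  rewrite -monotone_convergence//=.
  - by apply: eq_integral => x _; apply/esym/cvg_lim => //; exact: cf.
  - by move=> k; exact/measurable_EFinP/measurable_funTS.
  - by move=> k x _; rewrite lee_fin.
  - by move=> x _ a b; exact: nf.
under eq_fun do rewrite density_nnsfun.
rewrite -monotone_convergence//=.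
- by apply: eq_integral => x _; apply/cvg_lim => //; apply: cvgeZr.
- by move=> k; apply: emeasurable_funM => //; exact/measurable_EFinP/measurable_funTS.
- by move=> k x _; rewrite mule_ge0// lee_fin.
- by move=> x _ a b ab; apply: lee_wpmul2r => //; exact: nf.
Qed.

End density.

(** * Exponential tail bounds from Laplace transforms *)

Section tails.
Context {R : realType}.
Notation mu := (@lebesgue_measure R).

Lemma measurable_expR_lin (p : R) : measurable_fun setT (fun t : R => expR (- (p * t))).
Proof.
by apply: measurableT_comp => //; apply: measurableT_comp => //; exact: mulrl_measurable.
Qed.

Lemma measurable_laplace_integrand (p : R) (g : R -> \bar R) : measurable_fun setT g ->
  measurable_fun setT (fun t : R => ((expR (- (p * t)))%:E * g t)%E).
Proof.
by move=> mg; apply: emeasurable_funM => //; apply/measurable_EFinP; exact: measurable_expR_lin.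
Qed.

Lemma measurable_heaviside (a : R) :
  measurable_fun setT (fun t : R => (\1_(`[a, +oo[%classic : set R) t)%:E : \bar R).
Proof. by apply/measurable_EFinP; apply: measurable_indic; exact: measurable_itv. Qed.

Lemma laplaceT_heaviside_shift (p a : R) : 0 < p ->
  laplaceT p (fun t => (\1_(`[a, +oo[%classic : set R) t)%:E) = (expR (- (p * a)) / p)%:E.
Proof.
move=> p0; rewrite EFinM -(laplaceT_heaviside p0) /laplaceT.
rewrite -(@ge0_integral_shift _ _ (- a)); last 2 first.
- exact: measurable_laplace_integrand (measurable_heaviside a).
- by move=> x; rewrite mule_ge0// lee_fin expR_ge0.
rewrite -ge0_integralZl//=; last exact: measurable_laplace_integrand (measurable_heaviside 0).
apply: eq_integral => x _.
have -> : ((expR (- (p * (x - - a))))%:E = (expR (- (p * a)))%:E * (expR (- (p * x)))%:E)%E.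
  by rewrite -EFinM -expRD; congr (expR _)%:E; ring.
rewrite -muleA; do 2 congr (_ * _)%E.
rewrite !indicE; congr ((nat_of_bool _)%:R)%:E; apply/idP/idP;
  by rewrite !inE/= !in_itv/= !andbT opprK lerDr.
Qed.

Variables (f : R -> R) (H : R -> R -> R).
Hypothesis hH : inverse_subordinator f H.

Let H01 s t : 0 <= s -> 0 <= H s t <= 1. Proof. by case: hH => h _; exact: h. Qed.

Lemma measurable_subord_cdf s : 0 <= s -> measurable_fun setT (H s).
Proof.
move=> s0; apply: nondecreasing_measurable => // x y xy.
by case: hH => _ [_ [h _]]; exact: h.
Qed.

Let mH s : 0 <= s -> measurable_fun setT (fun t => (H s t)%:E).
Proof. by move=> s0; apply/measurable_EFinP; exact: measurable_subord_cdf. Qed.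

Let LH p s : 0 < p -> 0 <= s -> laplaceT p (fun t => (H s t)%:E) = (expR (- (s * f p)) / p)%:E.
Proof. by case: hH => _ [_ [_ [_ [h _]]]]; exact: h. Qed.

Lemma laplaceT_le p (g1 g2 : R -> \bar R) : measurable_fun setT g1 -> measurable_fun setT g2 ->
  (forall t, (0 <= g1 t)%E) -> (forall t, (g1 t <= g2 t)%E) ->
  (laplaceT p g1 <= laplaceT p g2)%E.
Proof.
move=> m1 m2 g10 g12; apply: ge0_le_integral => //.
- by move=> t _; rewrite mule_ge0// lee_fin expR_ge0.
- exact: measurable_laplace_integrand.
- exact: measurable_laplace_integrand.
- by move=> t _; apply: lee_wpmul2l; rewrite ?lee_fin ?expR_ge0.
Qed.

(** An exponential Markov inequality: [H s] is at least [H s t] on [[t, +oo[], and Laplace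
    transforms are compared. It will bound the quantile sets. *)
Lemma subord_cdf_upper p s t : 0 < p -> 0 <= s -> H s t <= expR (p * t - s * f p).
Proof.
move=> p0 s0; have /andP[h0 h1] := H01 t s0.
have : (laplaceT p (fun r => (H s t)%:E * (\1_(`[t, +oo[%classic : set R) r)%:E) <=
   laplaceT p (fun r => (H s r)%:E))%E.
  apply: laplaceT_le.
  - by apply: measurable_funeM; exact: measurable_heaviside.
  - exact: mH.
  - by move=> r; rewrite mule_ge0// lee_fin.
  - move=> r; rewrite -EFinM lee_fin indicE; case: (boolP (r \in _)).
      rewrite inE/= in_itv/= andbT mulr1 => tr; case: hH => _ [_ [h _]]; exact: h.
    by move=> _; rewrite mulr0; case/andP: (H01 r s0).
rewrite LH//.
have -> : laplaceT p (fun r => (H s t)%:E * (\1_(`[t, +oo[%classic : set R) r)%:E)%E =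
    ((H s t)%:E * (expR (- (p * t)) / p)%:E)%E.
  rewrite -laplaceT_heaviside_shift// -ge0_integralZl//.
  - by apply: eq_integral => r _; rewrite muleCA.
  - exact: measurable_laplace_integrand (measurable_heaviside t).
rewrite -EFinM lee_fin mulrA ler_pM2r ?invr_gt0// => h.
by rewrite expRD -ler_pdivrMl ?expR_gt0// -expRN mulrC.
Qed.

(** [H s] is at most [H s t] before [t] and at most 1 afterwards. For [t > 0] the resulting
    inequality forces [H s t] towards 1 as [s] tends to 0, whence positive passage times. *)
Lemma subord_cdf_lower p s t : 0 < p -> 0 <= s -> 0 <= t ->
  expR (- (s * f p)) <= H s t + (1 - H s t) * expR (- (p * t)).
Proof.
move=> p0 s0 t0; have /andP[h0 h1] := H01 t s0.
have h1' : 0 <= 1 - H s t by rewrite subr_ge0.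
have : (laplaceT p (fun r => (H s r)%:E) <=
   laplaceT p (fun r => ((H s t)%:E * (\1_(`[0%R, +oo[%classic : set R) r)%:E +
      (1 - H s t)%:E * (\1_(`[t, +oo[%classic : set R) r)%:E)))%E.
  apply: laplaceT_le.
  - exact: mH.
  - by apply: emeasurable_funD; apply: measurable_funeM; exact: measurable_heaviside.
  - by move=> r; rewrite lee_fin; case/andP: (H01 r s0).
  - move=> r; rewrite -!EFinM -EFinD lee_fin !indicE.
    have /andP[r0 r1] := H01 r s0.
    have [rlt0|rge0] := ltP r 0.
      have [_ [-> //]] := hH.
      by rewrite addr_ge0// mulr_ge0.
    rewrite mem_set/= ?in_itv/= ?rge0// mulr1.
    have [rt|tr] := ltP r t.
      by rewrite memNset/= ?in_itv/= ?andbT -?ltNge// ?mulr0 ?addr0; [case: hH => _ [_ [h _]]; apply: h => //; exact: ltW|apply/negP; rewrite -ltNge].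
    by rewrite mem_set/= ?in_itv/= ?tr// mulr1 addrC subrK.
rewrite LH//.
have mz a : measurable_fun setT (fun r : R => ((expR (- (p * r)))%:E * (\1_(`[a, +oo[%classic : set R) r)%:E)%E).
  exact: measurable_laplace_integrand (measurable_heaviside a).
have z0 a (r : R) : (0 <= (expR (- (p * r)))%:E * (\1_(`[a, +oo[%classic : set R) r)%:E)%E.
  by rewrite mule_ge0// lee_fin ?expR_ge0.
have -> : laplaceT p (fun r => ((H s t)%:E * (\1_(`[0%R, +oo[%classic : set R) r)%:E +
      (1 - H s t)%:E * (\1_(`[t, +oo[%classic : set R) r)%:E))%E =
    ((H s t)%:E * (p^-1)%:E + (1 - H s t)%:E * (expR (- (p * t)) / p)%:E)%E.
  rewrite -laplaceT_heaviside_shift// -laplaceT_heaviside// -!ge0_integralZl//; [|exact: mz..].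
  rewrite -ge0_integralD//; last 4 first.
  - by move=> r _; rewrite mule_ge0.
  - by apply: measurable_funeM; exact: mz.
  - by move=> r _; rewrite mule_ge0.
  - by apply: measurable_funeM; exact: mz.
  - apply: eq_integral => r _; rewrite ge0_muleDr ?mule_ge0 ?lee_fin//.
    by rewrite muleCA (muleCA (1 - _)%:E).
rewrite -!EFinM -EFinD lee_fin [X in _ <= X](_ : _ =
  (H s t + (1 - H s t) * expR (- (p * t))) / p); last by field; rewrite gt_eqF.
by rewrite ler_pM2r ?invr_gt0.
Qed.

End tails.

(** * First passage times *)

Section density_measure.
Local Open Scope ereal_scope.
Context d (T : measurableType d) (R : realType).
Variables (m : {measure set T -> \bar R}) (g : {mfun T >-> R}).

(** The absolute value makes this a measure for every measurable [g], so the instance carries no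
    sign condition. *)
Definition density_measure (A : set T) : \bar R := \int[m]_(x in A) (`|g x|)%:E.

Let mg : measurable_fun setT (fun x => (`|g x|)%:E).
Proof. by apply/measurable_EFinP; exact: measurableT_comp. Qed.

Let density0 : density_measure set0 = 0.
Proof. by rewrite /density_measure integral_set0. Qed.

Let density_ge0 A : 0 <= density_measure A.
Proof. by apply: integral_ge0 => x _; rewrite lee_fin. Qed.

Let density_sigma_additive : semi_sigma_additive density_measure.
Proof.
move=> F mF tF mUF; apply: cvg_toP.
  apply: ereal_nondecreasing_is_cvgn => i j ij.
  by apply: lee_sum_nneg_natr => // k _ _; exact: density_ge0.
rewrite /density_measure ge0_integral_bigcup//.
exact: measurable_funTS.
Qed.

HB.instance Definition _ := isMeasure.Build _ _ _ density_measure
  density0 density_ge0 density_sigma_additive.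

Lemma integral_density_measure (f : T -> \bar R) : measurable_fun setT f ->
  (forall x, 0 <= f x) ->
  \int[density_measure]_x f x = \int[m]_x (f x * (`|g x|)%:E).
Proof. by move=> mf f0; apply: ge0_integral_density => //; exact: measurableT_comp. Qed.

End density_measure.

Section unif01.
Context {R : realType}.

Lemma lebesgue_measure_itv01 : (@lebesgue_measure R `]0%R, 1%R[%classic < +oo)%E.
Proof. by rewrite lebesgue_measure_itv/= lte01 ltry. Qed.

End unif01.

Definition unif01 {R : realType} : set (measurableTypeR R) -> \bar R :=
  @mfrestr _ (measurableTypeR R) R _ (@lebesgue_measure R) (measurable_itv `]0%R, 1%R[) lebesgue_measure_itv01.

HB.instance Definition _ (R : realType) := Measure.on (@unif01 R).
HB.instance Definition _ (R : realType) := FiniteMeasure.on (@unif01 R).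

Section unif01_theory.
Context {R : realType}.

(** Values outside []0, 1[], a null set for [unif01], are sent to 1/2 so that bounds on passage
    times hold for every [w]. *)
Definition clamp01 (w : R) : R := if (0 < w) && (w < 1) then w else 2^-1.

Lemma clamp01_bounds w : 0 < clamp01 w < 1.
Proof. by rewrite /clamp01; case: ifPn => // _; rewrite invr_gt0 ltr0n/= invf_lt1 ?ltr1n. Qed.

Lemma measurable_clamp01 : measurable_fun setT clamp01.
Proof.
apply: measurable_fun_ifT => //.
by apply: measurable_and; apply: measurable_fun_ltr.
Qed.

Lemma unif01T : @unif01 R setT = 1%E.
Proof. by rewrite /unif01 /mfrestr /mrestr setTI lebesgue_measure_itv/= lte01 sube0. Qed.

Lemma unif01_lt h : 0 <= h <= 1 -> unif01 [set w | clamp01 w < h] = h%:E.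
Proof.
move=> /andP[h0 h1]; rewrite /unif01 /mfrestr /mrestr.
have -> : [set w | clamp01 w < h] `&` `]0, 1[ = `]0, h[%classic.
  apply/seteqP; split => w /=; rewrite !in_itv/=.
    by case=> + w01; rewrite /clamp01 w01 => ->; case/andP: w01 => ->.
  move=> /andP[w0 wh]; have w01 : 0 < w < 1 by rewrite w0 (lt_le_trans wh).
  by split=> //; rewrite /clamp01 w01.
rewrite lebesgue_measure_itv/= lte_fin; case: ltgtP h0 => // [_|<-]; last by [].
by rewrite sube0.
Qed.

Lemma unif01_countable (A : set R) : countable A -> measurable [set w | A (clamp01 w)] ->
  unif01 [set w | A (clamp01 w)] = 0%E.
Proof.
move=> cA _; rewrite /unif01 /mfrestr /mrestr; apply: countable_lebesgue_measure0.
apply: sub_countable cA; apply: subset_card_le => w /= [].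
by move=> + w01; rewrite /clamp01; move: w01; rewrite in_itv/= => ->.
Qed.

End unif01_theory.

(** * Quantile coupling of the first passage times *)

Section quantile.
Context {R : realType}.
Notation mu := (@lebesgue_measure R).
Variables (f : R -> R) (H : R -> R -> R).
Hypothesis hH : inverse_subordinator f H.
Hypothesis f0 : forall p, 0 < p -> 0 < f p.

Let H01 s t : 0 <= s -> 0 <= H s t <= 1. Proof. by case: hH => h _; exact: h. Qed.
Let Hlt0 s t : 0 <= s -> t < 0 -> H s t = 0. Proof. by case: hH => _ [h _]; exact: h. Qed.
Let Hnd s t t' : 0 <= s -> t <= t' -> H s t <= H s t'.
Proof. by case: hH => _ [_ [h _]]; exact: h. Qed.
Let Hni s s' t : 0 <= s -> s <= s' -> H s' t <= H s t.
Proof. by case: hH => _ [_ [_ [h _]]]; exact: h. Qed.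
Let LH p s : 0 < p -> 0 <= s -> laplaceT p (fun t => (H s t)%:E) = (expR (- (s * f p)) / p)%:E.
Proof. by case: hH => _ [_ [_ [_ [h _]]]]; exact: h. Qed.
Let Hcont s eps : 0 < s -> 0 < eps -> exists2 d : R, 0 < d & forall t, H s (t + d) <= H s t + eps.
Proof. by case: hH => _ [_ [_ [_ [_ h]]]]; exact: h. Qed.

Lemma subord_cdf_continuous s : 0 < s -> continuous (H s).
Proof.
move=> s0 t; apply/cvgrPdist_le => /= eps eps0.
have [d d0 hd] := Hcont s0 eps0; near=> r.
have rd : `|t - r| < d by near: r; exists d.
move: rd; rewrite ltr_distl => /andP[h1 h2].
rewrite ler_distl; apply/andP; split.
  rewrite lerBlDr; apply: le_trans (Hnd (ltW s0) _) (hd t).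
  by rewrite ltW// -ltrBlDr.
by apply: le_trans (Hnd (ltW s0) _) (hd r); exact: ltW.
Unshelve. all: by end_near. Qed.

Definition quantile_set (t w : R) : set R := [set s | 0 <= s /\ clamp01 w < H s t].
(** For negative [t] the set is empty and the default [sup set0 = 0] is the right value. *)
Definition hitting (t w : R) : R := sup (quantile_set t w).

Lemma quantile_ubound t w : has_ubound (quantile_set t w).
Proof.
have /andP[c0 c1] := clamp01_bounds w.
(* The bound solves [clamp01 w = exp (t - s * f 1)] for [s]: the upper tail bound at [p = 1]. *)
exists ((t - ln (clamp01 w)) / f 1) => s /= [s0 cs].
rewrite ler_pdivlMr ?f0// lerBrDr -lerBrDl -lerBlDr opprK.
have := lt_le_trans cs (subord_cdf_upper hH t ltr01 s0).
rewrite mul1r -ltr_ln ?posrE ?expR_gt0// expRK => h; lra.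
Qed.

Lemma hitting_ge s t w : 0 <= s -> clamp01 w < H s t -> s <= hitting t w.
Proof. by move=> s0 cs; apply: (ub_le_sup (quantile_ubound t w)). Qed.

Lemma hitting_gt s t w : 0 <= s -> s < hitting t w -> clamp01 w < H s t.
Proof.
move=> s0 sh; have ne : quantile_set t w !=set0.
  apply/set0P/negP => /eqP e; move: sh; rewrite /hitting e sup0.
  by rewrite ltNge s0.
have [s' [s'0 cs'] ss'] := sup_gt ne sh.
by apply: lt_le_trans cs' _; apply: Hni => //; exact: ltW.
Qed.

Lemma hitting_ge0 t w : 0 <= hitting t w.
Proof.
have [e|/set0P[s hs]] := eqVneq (quantile_set t w) set0; first by rewrite /hitting e sup0.
by apply: le_trans (hs.1) _; apply: (ub_le_sup (quantile_ubound t w)).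
Qed.

Lemma hitting_gt0 t w : 0 < t -> 0 < hitting t w.
Proof.
move=> t0; have /andP[c0 c1] := clamp01_bounds w.
set c := clamp01 w in c0 c1 *.
have et : expR (- (1 * t)) < 1 by rewrite -[ltRHS]expR0 ltr_expR mul1r oppr_lt0.
have := f0 ltr01; set F := f 1 => F0.
(* [y] is the right-hand side of the lower tail bound when [H s t] equals [c]. *)
pose y := c + (1 - c) * expR (- (1 * t)).
have e0 := expR_gt0 (- (1 * t)).
have y0 : 0 < y by rewrite addr_gt0// mulr_gt0// subr_gt0.
have y1 : y < 1.
  have : (1 - c) * expR (- (1 * t)) < (1 - c) * 1 by rewrite ltr_pM2l// subr_gt0.
  rewrite /y; lra.
(* For this [s], [exp (- (s * F))] is the square root of [y], hence larger than [y], which excludes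
   [H s t <= c]. *)
pose s := - ln y / 2 / F.
have s0 : 0 < s by rewrite !divr_gt0// oppr_gt0 ln_lt0// y0.
apply: (lt_le_trans s0); apply: hitting_ge; first exact: ltW.
rewrite ltNge; apply/negP => hc.
have := subord_cdf_lower hH ltr01 (ltW s0) (ltW t0).
apply/negP; rewrite -ltNge.
apply: (@le_lt_trans _ _ y).
  rewrite /y -subr_ge0.
  have -> : c + (1 - c) * expR (- (1 * t)) - (H s t + (1 - H s t) * expR (- (1 * t))) =
    (c - H s t) * (1 - expR (- (1 * t))) by ring.
  by rewrite mulr_ge0// subr_ge0// ltW.
rewrite -[ltLHS]lnK ?posrE// ltr_expR /s divfK ?gt_eqF//.
have : ln y < 0 by rewrite ln_lt0// y0.
lra.
Qed.

(** At [t = 0] the vanishing of [H s] on negative times is carried over by continuity, available for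
    [s > 0]; hence the detour through half of a supposedly positive passage time. *)
Lemma hitting_le0 t w : t <= 0 -> hitting t w = 0.
Proof.
move=> t0; apply/eqP; rewrite eq_le hitting_ge0 andbT leNgt; apply/negP => h0.
have h2 : hitting t w / 2 < hitting t w by lra.
have s0 : 0 < hitting t w / 2 by rewrite divr_gt0.
have := hitting_gt (ltW s0) h2; have /andP[c0 c1] := clamp01_bounds w.
have [d d0 hd] := Hcont s0 c0.
apply/negP; rewrite -leNgt; have := hd (t - d); rewrite subrK => /le_trans; apply.
by rewrite Hlt0 ?add0r// ?ltW//; lra.
Qed.

Lemma measurable_hitting : measurable_fun setT (fun z : R * R => hitting z.1 z.2).
Proof.
apply: (measurability (@RGenOInfty.G R)); first exact: RGenOInfty.measurableE.
move=> _ [_ [a ->] <-]; rewrite setTI.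
have [a0|a0] := ltP a 0.
  rewrite (_ : _ @^-1` _ = setT)//; apply/seteqP; split => // z _ /=.
  by rewrite in_itv/= andbT (lt_le_trans a0)// hitting_ge0.
(* The supremum exceeds [a] exactly when some rational above [a] lies in the quantile set. *)
rewrite (_ : _ @^-1` _ = \bigcup_(q : rat) (if a < ratr q then [set z : R * R | clamp01 z.2 < H (ratr q) z.1] else set0)).
  apply: bigcupT_measurable_rat => q; case: ifPn => // aq.
  have q0 : 0 <= ratr q :> R by rewrite (le_trans a0)// ltW.
  rewrite -[X in measurable X]setTI.
  apply: (@measurable_fun_ltr _ _ _ setT (fun z : R * R => clamp01 z.2) (fun z : R * R => H (ratr q) z.1)) => //.
  - exact: (measurableT_comp measurable_clamp01 measurable_snd).
  - exact: (measurableT_comp (measurable_subord_cdf hH q0) measurable_fst).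
apply/seteqP; split => z /=; rewrite in_itv/= andbT.
  move=> az; have [q] := rat_in_itvoo az; rewrite in_itv/= => /andP[aq qz].
  by exists q => //; rewrite aq; apply: hitting_gt => //; rewrite (le_trans a0)// ltW.
move=> [q _]; case: ifPn => // aq /= cq; apply: (lt_le_trans aq).
by apply: hitting_ge => //; rewrite (le_trans a0)// ltW.
Qed.

(* Jumps of the quantile function in [t] only occur at flat levels of
   [s |-> H s t0], of which there are countably many. *)
Lemma hitting_cvg t0 w : (forall q : rat, clamp01 w != H (ratr q) t0) ->
  hitting t w @[t --> t0] --> hitting t0 w.
Proof.
move=> hw; apply/cvgrPdist_lt => /= eps eps0; set e := hitting t0 w.
have lower : \forall t \near t0, e - eps < hitting t w.
  have [e0|e0] := ltP (e - eps) 0.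
    by near=> t; rewrite (lt_le_trans e0)// hitting_ge0.
  have ee : e - eps < e by lra.
  have [q] := rat_in_itvoo ee; rewrite in_itv/= => /andP[q1 q2].
  have q0 : 0 < ratr q :> R by exact: le_lt_trans q1.
  have hq := hitting_gt (ltW q0) q2.
  near=> t; apply: (lt_le_trans q1); apply: hitting_ge; first exact: ltW.
  by near: t; move/cvgr_gt : (subord_cdf_continuous q0 (x := t0)); apply.
have upper : \forall t \near t0, hitting t w < e + eps.
  have ee : e < e + eps by lra.
  have [q] := rat_in_itvoo ee; rewrite in_itv/= => /andP[q1 q2].
  have q0 : 0 < ratr q :> R by apply: le_lt_trans q1; exact: hitting_ge0.
  have hq : H (ratr q) t0 < clamp01 w.
    rewrite lt_neqAle eq_sym hw/= leNgt; apply/negP => h.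
    by have := hitting_ge (ltW q0) h; rewrite leNgt q1.
  near=> t; apply: le_lt_trans q2; rewrite leNgt; apply/negP => /(hitting_gt (ltW q0)).
  apply/negP; rewrite -leNgt ltW//.
  by near: t; move/cvgr_lt : (subord_cdf_continuous q0 (x := t0)); apply.
near=> t; rewrite ltr_distlC; apply/andP; split; by near: t.
Unshelve. all: by end_near. Qed.

Lemma hitting_ae_cvg t0 : {ae (@unif01 R), forall w, hitting t w @[t --> t0] --> hitting t0 w}.
Proof.
pose A : set R := range (fun q : rat => H (ratr q) t0).
have cA : countable A by apply: sub_countable (card_image_le _ _) _; exact: countableP.
exists [set w | A (clamp01 w)].
have mA : measurable [set w | A (clamp01 w)].
  rewrite -[X in measurable X]setTI; apply: measurable_clamp01 => //.
  exact: countable_measurable.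
split => //.
- exact: unif01_countable.
- move=> w; apply: contra_notP => /= hw; apply: hitting_cvg => q.
  by apply/negP => /eqP e; apply: hw; exists q.
Qed.

End quantile.

(** * Law of the passage time at an exponential time *)

Section hitting_law.
Context {R : realType}.
Notation mu := (@lebesgue_measure R).
Variables (f : R -> R) (H : R -> R -> R).
Hypothesis hH : inverse_subordinator f H.
Hypothesis f0 : forall p, 0 < p -> 0 < f p.
Variable p : R.
Hypothesis p0 : 0 < p.

Local Open Scope ereal_scope.

(** Not normalised, to match Laplace integrals: the mass is [r^-1], which is where the factor
    [f p / p] of [hitting_law] comes from. *)
Definition exp_density (r t : R) : R := (expR (- (r * t)) * \1_(`[0%R, +oo[%classic : set R) t)%R.

Lemma exp_density_ge0 r t : (0 <= exp_density r t)%R.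
Proof. by rewrite mulr_ge0// expR_ge0. Qed.

Lemma measurable_exp_density r : measurable_fun setT (exp_density r).
Proof.
apply: measurable_funM; first exact: measurable_expR_lin.
by apply: measurable_indic; exact: measurable_itv.
Qed.

Lemma integral_exp_density r : (0 < r)%R -> \int[mu]_t (exp_density r t)%:E = (r^-1)%:E.
Proof. exact: expR_half_line_integral. Qed.

Let G (z : measurableTypeR R * measurableTypeR R) : R := exp_density p z.1.
Let mG : measurable_fun setT G.
Proof. exact: (measurableT_comp (measurable_exp_density p) measurable_fst). Qed.
Let Gm : {mfun (measurableTypeR R * measurableTypeR R)%type >-> R} := HB.pack G (isMeasurableFun.Build _ _ _ _ _ mG).

Let E (z : measurableTypeR R * measurableTypeR R) : R := hitting H z.1 z.2.
Let mE : measurable_fun setT E. Proof. exact: (measurable_hitting hH f0). Qed.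
Let E' (z : measurableTypeR R * measurableTypeR R) : measurableTypeR R := hitting H z.1 z.2.
Let mE' : measurable_fun setT E'. Proof. exact: mE. Qed.
(** [M1] is the image of this weighted product under the passage time and [M2] the expected
    exponential law. They are compared on half-lines, which generate the Borel sets and are stable
    under intersection. *)
Let M := density_measure (mu \x unif01) Gm.
Let M1 : {measure set (measurableTypeR R) -> \bar R} :=
  ltac:(unshelve refine (pushforward M E' : {measure set (measurableTypeR R) -> \bar R}); exact mE').

Let g2 (s : measurableTypeR R) : R := (f p / p * exp_density (f p) s)%R.
Let mg2 : measurable_fun setT g2.
Proof. by apply: measurable_funM => //; exact: measurable_exp_density. Qed.
Let g2m : {mfun measurableTypeR R >-> R} := HB.pack g2 (isMeasurableFun.Build _ _ _ _ _ mg2).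
Let M2 : {measure set (measurableTypeR R) -> \bar R} := density_measure mu g2m.

Let g20 s : (0 <= g2 s)%R.
Proof. by rewrite mulr_ge0 ?exp_density_ge0// divr_ge0// ltW// f0. Qed.

Let M1_int (phi : R -> \bar R) : measurable_fun setT phi -> (forall s, 0 <= phi s) ->
  \int[M1]_s phi s = \int[mu]_t \int[unif01]_w (phi (hitting H t w) * (exp_density p t)%:E).
Proof.
move=> mphi phi0.
rewrite (ge0_integral_pushforward mE')// preimage_setT integral_density_measure; last 2 first.
- exact: measurableT_comp mphi mE'.
- by move=> z /=.
pose F (z : measurableTypeR R * measurableTypeR R) := phi (E' z) * (exp_density p z.1)%:E.
transitivity (\int[mu \x unif01]_z F z).
  by apply: eq_integral => z _; rewrite /F /= ger0_norm ?exp_density_ge0.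
apply: (@fubini_tonelli1 _ _ _ _ _ mu unif01 F).
- apply: emeasurable_funM; first exact: (measurableT_comp mphi mE').
  exact/measurable_EFinP.
- by move=> z; rewrite mule_ge0// lee_fin exp_density_ge0.
Qed.

Let M2_int (phi : R -> \bar R) : measurable_fun setT phi -> (forall s, 0 <= phi s) ->
  \int[M2]_s phi s = \int[mu]_s (phi s * (g2 s)%:E).
Proof.
move=> mphi phi0; rewrite integral_density_measure//.
by apply: eq_integral => s _; rewrite /= ger0_norm.
Qed.

Let half_line (a : R) : set (measurableTypeR R) := `[a, +oo[%classic.

Let measure_half_line (m : {measure set (measurableTypeR R) -> \bar R}) a :
  m (half_line a) = \int[m]_s (\1_(half_line a) s)%:E.
Proof. by rewrite integral_indic ?setIT//; exact: measurable_itv. Qed.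

Let M2_half a : M2 (half_line a) = (expR (- (Num.max a 0%R * f p)) / p)%:E.
Proof.
rewrite measure_half_line M2_int//; last exact: measurable_heaviside.
transitivity (\int[mu]_s ((f p / p)%:E * ((expR (- (f p * s)))%:E * (\1_(`[Num.max a 0%R, +oo[%classic : set R) s)%:E))).
  apply: eq_integral => s _; rewrite -!EFinM; congr EFin.
  rewrite /g2 /exp_density mulrC -!mulrA; congr (_ * (_ * (_ * _)))%R.
  rewrite !indicE -natrM mulnb; congr ((nat_of_bool _)%:R)%R; apply/idP/idP.
    by rewrite /half_line => /andP[]; rewrite !inE/= !in_itv/= !andbT ge_max => -> ->.
  move=> /set_mem; rewrite /= in_itv/= andbT ge_max => /andP[h1 h2].
  by rewrite !mem_set//= /half_line/= in_itv/= andbT.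
rewrite ge0_integralZl//.
- rewrite -/(laplaceT (f p) _) laplaceT_heaviside_shift ?f0// -EFinM; congr EFin.
  by rewrite (mulrC (f p) (Num.max _ _)); field; rewrite !gt_eqF ?f0.
- exact: measurable_laplace_integrand (measurable_heaviside _).
- by rewrite lee_fin divr_ge0// ltW// f0.
Qed.

Let mA a t : measurable [set w | (a <= hitting H t w)%R].
Proof.
have := measurable_fun_pair2 t mE; rewrite /E/= => mEt.
have := mEt measurableT (`[a, +oo[%classic : set R) (measurable_itv _).
by rewrite setTI; congr measurable; apply/seteqP; split => w /=; rewrite in_itv/= andbT.
Qed.

Let unifE a t : \int[unif01]_w (\1_(half_line a) (hitting H t w))%:E =
  unif01 [set w | (a <= hitting H t w)%R].
Proof.
transitivity (\int[unif01]_w (\1_[set w | (a <= hitting H t w)%R] w)%:E).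
  apply: eq_integral => w _; rewrite !indicE; congr ((nat_of_bool _)%:R)%:E.
  by apply/idP/idP; rewrite !inE /half_line/= in_itv/= andbT.
rewrite integral_indic ?setIT//; exact: mA.
Qed.

Let inner a t : \int[unif01]_w ((\1_(half_line a) (hitting H t w))%:E * (exp_density p t)%:E) =
  unif01 [set w | (a <= hitting H t w)%R] * (exp_density p t)%:E.
Proof.
rewrite ge0_integralZr//; first by rewrite unifE.
- exact: (measurableT_comp (measurable_heaviside a) (measurable_fun_pair2 t mE)).
- by rewrite lee_fin exp_density_ge0.
Qed.

Let mset a t : measurable [set w | (clamp01 w < H a t)%R].
Proof.
rewrite -[X in measurable X]setTI.
by apply: measurable_fun_ltr => //; exact: measurable_clamp01.
Qed.

(** For [0 <= a' < a], the event that the passage time is at least [a] lies between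
    [clamp01 w < H a t] and [clamp01 w < H a' t]; the two bounds meet as [a'] increases to [a]. *)
Let M1_half a : M1 (half_line a) = (expR (- (Num.max a 0%R * f p)) / p)%:E.
Proof.
rewrite measure_half_line M1_int//; last exact: measurable_heaviside.
under eq_integral do rewrite inner.
have H01 s t : (0 <= s)%R -> (0 <= H s t <= 1)%R by case: hH => h _; exact: h.
have mle t a' : (0 <= a')%R -> unif01 [set w | (clamp01 w < H a' t)%R] = (H a' t)%:E.
  by move=> a'0; rewrite unif01_lt// H01.
have [a0|a0] := leP a 0%R.
  rewrite mul0r oppr0 expR0 mul1r -integral_exp_density//.
  apply: eq_integral => t _; rewrite (_ : [set _ | _] = setT) ?unif01T ?mul1e//.
  by apply/seteqP; split => // w _ /=; rewrite (le_trans a0)// (hitting_ge0 hH f0).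
have mI : measurable_fun setT (fun t => unif01 [set w | (a <= hitting H t w)%R] * (exp_density p t)%:E).
  apply: emeasurable_funM; last by apply/measurable_EFinP; exact: measurable_exp_density.
  under eq_fun do rewrite -unifE.
  apply: (@measurable_fun_fubini_tonelli_F _ _ (measurableTypeR R) (measurableTypeR R) _ unif01
    (fun z => (\1_(half_line a) (E z))%:E)) => //.
  exact: (measurableT_comp (measurable_heaviside a) mE).
have I0 t : 0 <= unif01 [set w | (a <= hitting H t w)%R] * (exp_density p t)%:E.
  by rewrite mule_ge0// lee_fin exp_density_ge0.
have lt0 t s : (0 <= s)%R -> (t < 0)%R -> H s t = 0%R by case: hH => _ [h _]; exact: h.
have LH s : (0 <= s)%R -> laplaceT p (fun t => (H s t)%:E) = (expR (- (s * f p)) / p)%:E.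
  by case: hH => _ [_ [_ [_ [h _]]]]; exact: h.
have mLH s : (0 <= s)%R -> measurable_fun setT (fun t => (expR (- (p * t)))%:E * (H s t)%:E).
  move=> s0; apply: measurable_laplace_integrand; apply/measurable_EFinP.
  exact: (measurable_subord_cdf hH s0).
have upper a' : (0 <= a' < a)%R ->
    \int[mu]_t (unif01 [set w | (a <= hitting H t w)%R] * (exp_density p t)%:E) <=
    (expR (- (a' * f p)) / p)%:E.
  move=> /andP[a'0 a'a]; rewrite -LH// /laplaceT; apply: ge0_le_integral => //.
    exact: mLH.
  move=> t _; rewrite muleC; apply: lee_pmul => //.
  - by rewrite lee_fin exp_density_ge0.
  - rewrite lee_fin /exp_density ler_piMr ?expR_ge0// indicE lern1; exact: leq_b1.
  - rewrite -mle//; apply: le_measure; rewrite ?inE; [exact: mA|exact: mset|].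
    by move=> w /= aw; exact: (hitting_gt hH a'0 (lt_le_trans a'a aw)).
have lower : (expR (- (a * f p)) / p)%:E <=
   \int[mu]_t (unif01 [set w | (a <= hitting H t w)%R] * (exp_density p t)%:E).
  rewrite -(LH a (ltW a0)) /laplaceT; apply: ge0_le_integral => //.
  - by move=> t _; rewrite mule_ge0// lee_fin ?expR_ge0//; case/andP: (H01 a t (ltW a0)).
  - exact: mLH (ltW a0).
  move=> t _; have [t0|t0] := ltP t 0%R; first by rewrite lt0 ?mule0// ltW.
  rewrite muleC; apply: lee_pmul => //.
  - by rewrite lee_fin; case/andP: (H01 a t (ltW a0)).
  - rewrite -(mle t a (ltW a0)); apply: le_measure; rewrite ?inE; [exact: mset|exact: mA|].
    by move=> w /= aw; exact: (hitting_ge hH f0 (ltW a0) aw).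
  - by rewrite /exp_density indicE mem_set ?mulr1//= in_itv/= t0.
apply/eqP; rewrite eq_le lower andbT.
have a01 : ((0:R) <= 0 < a)%R by apply/andP.
have xfin := le_lt_trans (upper 0%R a01) (ltry _).
have xf : \int[mu]_t (unif01 [set w | (a <= hitting H t w)%R] * (exp_density p t)%:E) \is a fin_num.
  by rewrite ge0_fin_numE//; apply: integral_ge0.
rewrite -(fineK xf) in upper *; set x := fine _ in upper *.
rewrite lee_fin leNgt; apply/negP => hx.
have x0 : (0 < x)%R by apply: le_lt_trans hx; rewrite divr_ge0 ?expR_ge0// ltW.
have px0 : (0 < x * p)%R by rewrite mulr_gt0.
(* [b] is the level at which [exp (- (b * f p)) / p] equals the integral [x]. If the claim failed,
   [b] would be below [a], and any [a'] strictly between them would contradict the upper bound. *)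
pose b := (- ln (x * p) / f p)%R.
have fp0 := f0 p0.
have ba : (b < a)%R.
  rewrite /b ltr_pdivrMr// ltrNl -ltr_expR lnK ?posrE//.
  by rewrite -ltr_pdivrMr.
pose a' := Num.max 0%R ((a + b) / 2)%R.
have a'a : (0 <= a' < a)%R.
  by rewrite /a' le_max lexx/= gt_max a0/=; lra.
have := upper a' a'a; rewrite lee_fin; apply/negP; rewrite -ltNge ltr_pdivrMr//.
rewrite -[ltRHS]lnK ?posrE// ltr_expR ltrNl.
have : (b < a')%R by rewrite /a' lt_max; apply/orP; right; lra.
by rewrite /b ltr_pdivrMr.
Qed.

Let M12 (A : set (measurableTypeR R)) : measurable A -> M1 A = M2 A.
Proof.
move=> mA'; refine (@measure_unique _ R (measurableTypeR R) (@RGenCInfty.G R)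
  (fun k => half_line (- k%:R)) _ _ _ _ M1 M2 _ _ A mA').
- exact: RGenCInfty.measurableE.
- move=> _ _ [a ->] [b ->]; exists (Num.max a b).
  by apply/seteqP; split => x /=; rewrite !in_itv/= !andbT ge_max; [case=> -> ->|case/andP].
- by move=> k; exists (- k%:R)%R.
- apply/seteqP; split => // x _; exists (Num.bound `|x|) => //.
  rewrite /half_line /= in_itv/= andbT lerNl -normrN.
  exact: le_trans (ler_norm _) (ltW (archi_boundP (normr_ge0 _))).
- by move=> _ [a ->]; rewrite -/(half_line a) M1_half M2_half.
- by move=> k; rewrite M1_half ltry.
Qed.

(* The hitting process at an independent exponential time of rate [p] is
   exponential of rate [f p]. *)
Lemma hitting_law (phi : R -> \bar R) : measurable_fun setT phi -> (forall s, 0 <= phi s) ->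
  \int[mu]_t \int[unif01]_w (phi (hitting H t w) * (exp_density p t)%:E) =
  \int[mu]_s (phi s * (f p / p * exp_density (f p) s)%:E).
Proof.
move=> mphi phi0; rewrite -M1_int// -M2_int//.
by apply: eq_measure_integral => A mA' _; exact: M12.
Qed.

End hitting_law.

(** * Iterated integrals over R^n *)

Section sigma_finite_product.
Context d1 d2 (T1 : measurableType d1) (T2 : measurableType d2) (R : realType).
Variables (m1 : {sigma_finite_measure set T1 -> \bar R})
  (m2 : {sigma_finite_measure set T2 -> \bar R}).

(* The library only exposes [m1 \x m2] as a sigma-finite measure when both
   factors are subprobabilities. *)
Definition sf_product : set (T1 * T2) -> \bar R := (m1 \x m2)%E.

HB.instance Definition _ := Measure.on sf_product.

Let sf_product_sigma_finite : sigma_finite setT sf_product.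
Proof.
have /sigma_finiteP[F [TF ndF Foo]] := sigma_finiteT m1.
have /sigma_finiteP[G [TG ndG Goo]] := sigma_finiteT m2.
exists (fun k => F k `*` G k) => [|k].
  apply/seteqP; split => // -[x y] _.
  have [i _ Fx] : (\bigcup_k F k) x by rewrite -TF.
  have [j _ Gy] : (\bigcup_k G k) y by rewrite -TG.
  exists (maxn i j) => //; split => /=.
    by move: x Fx; exact/subsetPset/ndF/leq_maxl.
  by move: y Gy; exact/subsetPset/ndG/leq_maxr.
have [mF Foo'] := Foo k; have [mG Goo'] := Goo k.
split; first exact: measurableX.
by rewrite /sf_product product_measure1E// lte_mul_pinfty// ge0_fin_numE.
Qed.

HB.instance Definition _ :=
  Measure_isSigmaFinite.Build _ _ _ sf_product sf_product_sigma_finite.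

End sigma_finite_product.

Section vector_measurability.
Context {R : realType}.

Definition measurable_coords d (T : measurableType d) n (V : T -> 'rV[R]_n) :=
  forall i, measurable_fun setT (fun t => V t ord0 i).

(* Borel measurability of a function on R^n, jointly with a parameter in [P],
   tested on coordinatewise measurable maps. *)
Definition borel_rV dP (P : measurableType dP) n (F : P -> 'rV[R]_n -> \bar R) :=
  forall d (T : measurableType d) (tau : T -> P) (V : T -> 'rV[R]_n),
    measurable_fun setT tau -> measurable_coords V ->
    measurable_fun setT (fun t => F (tau t) (V t)).

Lemma measurable_coords_row d (T : measurableType d) n (u : T -> R) (V : T -> 'rV[R]_n) :
  measurable_fun setT u -> measurable_coords V ->
  measurable_coords (fun t => row_mx (const_mx (u t) : 'rV_1) (V t)).
Proof.
move=> mu mV i; rewrite -(splitK i); case: fintype.splitP => j ij /=.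
  by under eq_fun do rewrite row_mxEl mxE.
by under eq_fun do rewrite row_mxEr; exact: mV.
Qed.

(** The outermost coordinate joins the parameter before the induction hypothesis is applied, which
    is why [P] varies in the induction; the sign of [F] is handled by splitting the inner integral
    into positive and negative parts. *)
Lemma measurable_iint n : forall dP (P : measurableType dP) (F : P -> 'rV[R]_n -> \bar R),
  borel_rV F -> measurable_fun setT (fun t => iint (F t)).
Proof.
elim: n => [|n IH] dP P F bF /=.
  by apply: (bF _ _ id (fun _ => 0)) => // i; exact: measurable_cst.
pose G (z : P * measurableTypeR R) :=
  iint (fun v : 'rV_n => F z.1 (row_mx (const_mx z.2 : 'rV_1) v)).
have mG : measurable_fun setT G.
  apply: IH => d T tau V mtau mV.
  apply: (bF _ _ (fun t => (tau t).1)); first exact: (measurableT_comp measurable_fst mtau).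
  apply: (measurable_coords_row (u := fun t => (tau t).2)) => //.
  exact: (measurableT_comp measurable_snd mtau).
rewrite (_ : (fun t => _) = (fun t => \int[lebesgue_measure]_s (G^\+%E (t, s))
    - \int[lebesgue_measure]_s (G^\-%E (t, s)))%E); last first.
  by apply/funext => t; rewrite integralE; congr (_ - _)%E; apply: eq_integral => s _;
    rewrite ?funeposE ?funenegE.
apply: emeasurable_funB.
  by apply: (@measurable_fun_fubini_tonelli_F _ _ P (measurableTypeR R) R lebesgue_measure G^\+%E) => //; exact: measurable_funepos.
by apply: (@measurable_fun_fubini_tonelli_F _ _ P (measurableTypeR R) R lebesgue_measure G^\-%E) => //; exact: measurable_funeneg.
Qed.

(* [iint] is the integral of [F \o V] on a genuine sigma-finite measure space:
   [V] is the identity of R^n with the product Lebesgue measure. *)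
Lemma iint_representation n : exists d (Om : measurableType d)
    (m : {sigma_finite_measure set Om -> \bar R}) (V : Om -> 'rV[R]_n),
  [/\ measurable_coords V,
    (forall F, borel_rV (fun _ : unit => F) -> (forall x, 0 <= F x)%E ->
       iint F = \int[m]_w F (V w))%E &
    (forall F, borel_rV (fun _ : unit => F) -> m.-integrable setT (F \o V) ->
       iint F = \int[m]_w F (V w))%E].
Proof.
elim: n => [|n [d [Om [m [V [mV ge0_iint int_iint]]]]]].
  exists _, unit, (dirac tt : {sigma_finite_measure set unit -> \bar R}), (fun _ => 0).
  split => /=.
  - by move=> i; exact: measurable_cst.
  - by move=> F _ F0; rewrite integral_dirac ?diracT ?mul1e.
  - by move=> F _ iF; rewrite integral_dirac ?diracT ?mul1e.
pose mu := (lebesgue_measure : {sigma_finite_measure set (measurableTypeR R) -> \bar R}).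
pose W (z : measurableTypeR R * Om) := row_mx (const_mx z.1 : 'rV_1) (V z.2).
have mW : measurable_coords W.
  apply: (measurable_coords_row (u := fst)) => [|i]; first exact: measurable_fst.
  exact: (measurableT_comp (mV i) measurable_snd).
have bsec F s : borel_rV (fun _ : unit => F) ->
    borel_rV (fun _ : unit => (fun v : 'rV[R]_n => F (row_mx (const_mx s : 'rV_1) v))).
  move=> bF d' T tau V' mtau mV'; apply: (bF _ _ tau) => //.
  by apply: measurable_coords_row.
exists _, (measurableTypeR R * Om)%type, (sf_product mu m), W.
split => // F bF hF.
  have mFW : measurable_fun setT (F \o W) by apply: (bF _ _ (fun _ => tt)).
  rewrite /sf_product (@fubini_tonelli1 _ _ _ _ _ mu m (F \o W))//=.
  by apply: eq_integral => s _; rewrite ge0_iint//; exact: bsec.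
rewrite -(@integral12_prod_meas1 _ _ _ _ _ mu m (F \o W))//=.
apply: ae_eq_integral => //.
- apply: (measurable_iint (P := measurableTypeR R)) => d' T tau V' mtau mV'.
  by apply: (bF _ _ (fun _ => tt)) => //; exact: measurable_coords_row.
- exact: (@measurable_fubini_F _ _ _ _ _ mu m (F \o W) hF).
- have := @ae_integrable1 _ _ _ _ _ mu m (F \o W) hF.
  apply: filterS => s iFs _.
  by rewrite int_iint//; exact: bsec.
Qed.

End vector_measurability.

(** * Continuity and differentiation under the integral *)

Section parametric_integrals.
Context {R : realType} {V : normedModType R}.

(** Brings limits at a point to the sequential form used by dominated convergence. *)
Lemma cvg_seq_at (f : V -> R) (a : V) (l : R) :
  (forall u : nat -> V, u k @[k --> \oo] --> a -> f (u k) @[k --> \oo] --> l) ->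
  f x @[x --> a] --> l.
Proof.
move=> hf; apply/cvgrPdist_lt => /= eps eps0; apply: contrapT => nf.
have /choice[u hu] : forall k, exists x, `|a - x| < k.+1%:R^-1 /\ eps <= `|l - f x|.
  move=> k; apply: contrapT => /forallNP h; apply: nf.
  near=> x; have /not_andP[] := h x.
    by case; near: x; apply/nbhs_normP; exists k.+1%:R^-1 => //=; rewrite invr_gt0.
  by move=> ?; rewrite ltNge; apply/negP.
have ua : u k @[k --> \oo] --> a.
  apply/cvgrPdist_lt => /= d d0; near=> k; apply: lt_trans (hu k).1 _.
  near: k; exact: near_infty_natSinv_lt (PosNum d0).
have /cvgrPdist_lt/(_ _ eps0)/= [N _ /(_ N (leqnn N))/=] := hf u ua.
by rewrite ltNge (hu N).2.
Unshelve. all: by end_near. Qed.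

(** Restricting to a line turns directional derivatives into scalar ones, to which differentiation
    under the integral in one variable applies. *)
Lemma is_derive_line (f : V -> R) (a v : V) (l : R) :
  is_derive (0 : R) 1 (fun e => f (e *: v + a)) l -> is_derive a v f l.
Proof.
move=> [df dl].
have E : (fun h : R => h^-1 *: (((fun e => f (e *: v + a)) \o shift 0) (h *: 1) - f (0 *: v + a)))
   = (fun h => h^-1 *: ((f \o shift a) (h *: v) - f a)).
  by apply/funext => h /=; rewrite addr0 [h%:A]mulr1 scale0r add0r.
move: df dl; rewrite /derivable /derive E => df dl.
by split.
Qed.

Lemma is_derive_on_line (f : V -> R) (a v : V) (e l : R) :
  is_derive (e *: v + a) v f l -> is_derive e 1 (fun e => f (e *: v + a)) l.
Proof.
move=> [df dl].
have E : (fun h => h^-1 *: ((f \o shift (e *: v + a)) (h *: v) - f (e *: v + a))) =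
   (fun h : R => h^-1 *: (((fun e => f (e *: v + a)) \o shift e) (h *: 1) - f (e *: v + a))).
  apply/funext => h /=; congr (_ *: (f _ - _)).
  by rewrite [h%:A]mulr1 scalerDl addrA.
move: df dl; rewrite /derivable /derive E => df dl.
by split.
Qed.

Context d (T : measurableType d) (m : {measure set T -> \bar R}) (D : set T).
Hypothesis mD : measurable D.

Lemma cvg_parametric_integral (f : V -> T -> R) (g : T -> R) (a : V) (r : R) : 0 < r ->
  (forall x, `|a - x| < r -> measurable_fun D (f x)) ->
  (forall t, D t -> f x t @[x --> a] --> f a t) ->
  m.-integrable D (EFin \o g) ->
  (forall x t, `|a - x| < r -> D t -> `|f x t| <= g t) ->
  \int[m]_(t in D) f x t @[x --> a] --> \int[m]_(t in D) f a t.
Proof.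
move=> r0 mf cf ig fg; apply: cvg_seq_at => u ua.
have [N _ hN] : \forall k \near \oo, `|a - u k| < r by move/cvgrPdist_lt : ua; exact.
rewrite -(cvg_shiftn N).
have aa : `|a - a| < r by rewrite subrr normr0.
have ifa : m.-integrable D (EFin \o f a).
  apply: le_integrable ig => //; first by apply/measurable_EFinP; exact: mf.
  by move=> t Dt; rewrite lee_fin (le_trans (fg _ _ aa Dt)) ?ler_norm.
apply: fine_cvg; rewrite fineK ?integral_fune_fin_num//.
apply: (@dominated_cvg _ _ _ m D mD (fun k t => (f (u (k + N)%N) t)%:E) _ (EFin \o g)) => //.
- by move=> k; apply/measurable_EFinP/mf/hN => /=; rewrite leq_addl.
- move=> t Dt; apply: cvg_EFin; first exact: nearW.
  apply: (@cvg_comp _ _ _ (fun k => u (k + N)%N) (f ^~ t) _ (nbhs a)); last exact: cf.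
  by rewrite (cvg_shiftn N).
- by move=> k t Dt; rewrite lee_fin fg// hN//= leq_addl.
Qed.

Lemma is_derive_parametric_integral (f df : V -> T -> R) (g : T -> R) (a v : V) (r : R) :
  0 < r ->
  (forall e, `|e| < r -> m.-integrable D (EFin \o f (e *: v + a))) ->
  (forall e t, `|e| < r -> D t -> is_derive (e *: v + a) v (f ^~ t) (df (e *: v + a) t)) ->
  (forall t, 0 <= g t) -> m.-integrable D (EFin \o g) ->
  (forall e t, `|e| < r -> D t -> `|df (e *: v + a) t| <= g t) ->
  is_derive a v (fun x => \int[m]_(t in D) f x t) (\int[m]_(t in D) df a t).
Proof.
move=> r0 intf derf g0 ig fg; apply: is_derive_line.
pose F e t := f (e *: v + a) t.
have I0 : `](- r), r[%classic (0 : R) by rewrite /= in_itv/= oppr_lt0 r0.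
have II e : `](- r), r[%classic e -> `|e| < r.
  by rewrite /= in_itv/= ltr_norml.
have dF e t : `](- r), r[%classic e -> D t -> is_derive e 1 (F ^~ t) (df (e *: v + a) t).
  by move=> /II er Dt; exact: (@is_derive_on_line (f ^~ t) a v e _ (derf e t er Dt)).
have dF' e t : `](- r), r[%classic e -> D t -> partial1of2 F e t = df (e *: v + a) t.
  by move=> Ie Dt; rewrite /partial1of2 derive1E; have [_ ->] := dF e t Ie Dt.
have F1 x : `](- r), r[%classic x -> m.-integrable D (EFin \o F x) by move=> /II; exact: intf.
have F2 x t : `](- r), r[%classic x -> D t -> derivable (F ^~ t) x 1.
  by move=> Ix Dt; have [] := dF x t Ix Dt.
have F3 x t : `](- r), r[%classic x -> D t -> `|partial1of2 F x t| <= g t.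
  by move=> Ix Dt; rewrite dF'//; apply: fg => //; exact: II.
split; first exact: (derivable_under_integral mD I0 F1 F2 g0 ig F3).
rewrite -derive1E (differentiation_under_integral mD I0 F1 F2 g0 ig F3).
apply: eq_Rintegral => t; rewrite inE => Dt.
by rewrite dF'// scale0r add0r.
Qed.

End parametric_integrals.

Section continuous_borel.
Context {R : realType}.

(** The open set where [f > a] is the union of the countably many rational boxes it contains, and
    membership of [V t] in a box is a finite conjunction of coordinate conditions. *)
Lemma measurable_continuous_coords d (T : measurableType d) n (V : T -> 'rV[R]_n) (f : 'rV[R]_n -> R) :
  continuous f -> measurable_coords V -> measurable_fun setT (f \o V).
Proof.
move=> cf mV; apply: (measurability _ (RGenOInfty.measurableE R)).
move=> _ [_ [a ->] <-]; rewrite setTI.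
pose box (c : 'rV[rat]_n * rat) : set 'rV[R]_n :=
  [set y | forall i, `|y ord0 i - ratr (c.1 ord0 i)| < ratr c.2].
pose A (c : 'rV[rat]_n * rat) : set T :=
  if `[< forall y, box c y -> a < f y >] then [set t | box c (V t)] else set0.
rewrite (_ : _ @^-1` _ = \bigcup_c A c).
  apply: countable_bigcupT_measurable; first exact: countableP.
  move=> c; rewrite /A; case: ifP => // _.
  rewrite (_ : [set t | _] = \bigcap_(i in [set: 'I_n])
      [set t | `|V t ord0 i - ratr (c.1 ord0 i)| < ratr c.2]); last first.
    by apply/seteqP; split => t /= h i; [move=> _|]; exact: h.
  apply: fin_bigcap_measurable => [|i _]; first exact: finite_finset.
  rewrite -[X in measurable X]setTI; apply: measurable_fun_ltr => //.
  by apply: measurableT_comp => //; apply: measurable_funB.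
apply/seteqP; split => t /=; last first.
  case=> c _; rewrite /A; case: asboolP => // h hc.
  by rewrite in_itv/= andbT; exact: h.
rewrite in_itv/= andbT => afV.
have : \forall y \near V t, a < f y by exact: (cvgr_gt (f (V t)) (cf (V t)) a afV).
move=> /nbhs_ballP[e /= e0 he].
(* A box of half-width below [e / 2] that contains [V t] lies in the ball of radius [e] around
   it. *)
have [q /itvP qe] := rat_in_itvoo (divr_gt0 e0 (ltr0n _ 2)).
have q0 : 0 < ratr q :> R by rewrite qe.
have /choice[p hp] : forall i, exists p : rat, `|V t ord0 i - ratr p| < ratr q.
  move=> i; have [|p /itvP hp] := @rat_in_itvoo R (V t ord0 i - ratr q) (V t ord0 i + ratr q).
    by rewrite ltrBlDr -addrA ltrDl addr_gt0.
  by exists p; rewrite distrC ltr_distl !hp.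
exists (\row_i p i, q) => //; rewrite /A; case: asboolP => [_ i /=|]; first by rewrite mxE.
case=> y hy; apply: he; split => // i j; rewrite ord1 /ball/=.
have := hy j; have := hp j; rewrite /= mxE => h1 h2.
rewrite -(subrKA (ratr (p j))); apply: le_lt_trans (ler_normD _ _) _.
have qe' : ratr q < e / 2 by rewrite qe.
by rewrite [e]splitr ltrD// ?(lt_trans h1)// distrC (lt_trans h2).
Qed.

End continuous_borel.

(** * Heat kernels and heat potentials *)

Section gauss_class.
Context {R : realType} {n : nat}.
Implicit Types (y v : 'rV[R]_n) (rho : R) (F G : R -> 'rV[R]_n -> R).

Definition sqn y : R := \sum_(i < n) y ord0 i ^+ 2.
Definition dotp y v : R := \sum_(i < n) y ord0 i * v ord0 i.

Lemma sqn_ge0 y : 0 <= sqn y.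
Proof. by apply: sumr_ge0 => i _; exact: sqr_ge0. Qed.

Lemma sqr_enorm y : enorm y ^+ 2 = sqn y.
Proof. by rewrite sqr_sqrtr// sqn_ge0. Qed.

Lemma enorm_ge0 y : 0 <= enorm y. Proof. exact: sqrtr_ge0. Qed.

Lemma coord_le_enorm y i : `|y ord0 i| <= enorm y.
Proof.
rewrite -sqrtr_sqr ler_wsqrtr// /sqn (bigD1 i)//= lerDl.
by apply: sumr_ge0 => j _; exact: sqr_ge0.
Qed.

Lemma norm_le_enorm y : `|y| <= enorm y.
Proof.
rewrite [leLHS]mx_normrE; apply: bigmax_le; first exact: enorm_ge0.
by move=> [i j] _ /=; rewrite (ord1 i) coord_le_enorm.
Qed.

Lemma coord_le_norm y i : `|y ord0 i| <= `|y|.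
Proof. by rewrite [leRHS]mx_normrE; apply: (le_bigmax _ (fun i => `|y i.1 i.2|) (ord0, i)). Qed.

Lemma dotp_le y v : `|dotp y v| <= (\sum_(i < n) `|v ord0 i|) * enorm y.
Proof.
rewrite /dotp (le_trans (ler_norm_sum _ _ _))// mulr_suml; apply: ler_sum => i _.
by rewrite normrM mulrC ler_wpM2l// coord_le_enorm.
Qed.

Lemma sqn_line e v y : sqn (e *: v + y) = sqn y + e * (2 * dotp y v) + e ^+ 2 * sqn v.
Proof.
rewrite /sqn /dotp !mulr_sumr -!big_split/=; apply: eq_bigr => i _.
by rewrite !mxE; ring.
Qed.

Lemma dotp_line e v y b : dotp (e *: v + y) b = e * dotp v b + dotp y b.
Proof.
rewrite /dotp mulr_sumr -big_split/=; apply: eq_bigr => i _.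
by rewrite !mxE; ring.
Qed.

Lemma is_derive_gauss_exp rho y v :
  is_derive y v (fun y => expR (- (rho ^+ 2 * sqn y / 4)))
    (- (1 / 2) * (rho ^+ 2 * (dotp y v * expR (- (rho ^+ 2 * sqn y / 4))))).
Proof.
apply: is_derive_line.
under eq_fun do rewrite sqn_line.
have h1 : is_derive (0:R) 1 (fun e => sqn y + e * (2 * dotp y v) + e ^+ 2 * sqn v) (2 * dotp y v).
  apply: is_derive_eq; rewrite ?scaler0 ?scaler1 ?addr0 ?add0r /GRing.scale/=.
  by ring.
apply: (is_derive_eq (is_derive1_expR (is_derive1N (is_derive1M
  (is_derive1Ml (rho ^+ 2) h1) (is_derive_cst (4^-1 : R) (0:R) 1))))).
rewrite mul0r expr0n/= mul0r !addr0 mulr0 addr0.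
by field.
Qed.

Lemma is_derive_dotp y v a : is_derive y v (dotp ^~ a) (dotp v a).
Proof.
apply: is_derive_line; under eq_fun do rewrite dotp_line.
by apply: is_derive_eq; rewrite ?scaler0 ?addr0 ?add0r /GRing.scale/= mulr1.
Qed.

(* The span of the functions [rho ^ m * \prod_i (y . a_i) * exp (- rho^2 |y|^2 / 4)],
   which contains the heat kernel at time [rho ^- 2] and is stable under
   directional derivatives in [y]. *)
Inductive gauss_class : (R -> 'rV[R]_n -> R) -> Prop :=
| gauss_exp : gauss_class (fun rho y => expR (- (rho ^+ 2 * sqn y / 4)))
| gaussD F G : gauss_class F -> gauss_class G -> gauss_class (fun rho y => F rho y + G rho y)
| gaussZ c F : gauss_class F -> gauss_class (fun rho y => c * F rho y)
| gauss_rho F : gauss_class F -> gauss_class (fun rho y => rho * F rho y)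
| gauss_dotp v F : gauss_class F -> gauss_class (fun rho y => dotp y v * F rho y).

Lemma gauss_rhoX k F : gauss_class F -> gauss_class (fun rho y => rho ^+ k * F rho y).
Proof.
move=> hF; elim: k => [|k IH].
  rewrite (_ : (fun _ => _) = F)//.
  by apply/funext => rho; apply/funext => y; rewrite expr0 mul1r.
rewrite (_ : (fun _ => _) = (fun rho y => rho * (rho ^+ k * F rho y))); first exact: gauss_rho.
by apply/funext => rho; apply/funext => y; rewrite exprS mulrA.
Qed.

Lemma gauss_derive F v : gauss_class F ->
  exists2 G, gauss_class G & forall rho y, is_derive y v (F rho) (G rho y).
Proof.
elim => {F} [|F1 F2 _ [G1 cG1 hG1] _ [G2 cG2 hG2]|c F _ [G cG hG]|F _ [G cG hG]|a F cF [G cG hG]].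
- exists (fun rho y => - (1 / 2) * (rho ^+ 2 * (dotp y v * expR (- (rho ^+ 2 * sqn y / 4))))).
    by apply: gaussZ; apply: gauss_rhoX; apply: gauss_dotp; exact: gauss_exp.
  by move=> rho y; exact: is_derive_gauss_exp.
- exists (fun rho y => G1 rho y + G2 rho y); first exact: gaussD.
  by move=> rho y; apply: is_deriveD.
- exists (fun rho y => c * G rho y); first exact: gaussZ.
  by move=> rho y; apply: is_deriveZ.
- exists (fun rho y => rho * G rho y); first exact: gauss_rho.
  by move=> rho y; apply: is_deriveZ.
- exists (fun rho y => dotp v a * F rho y + dotp y a * G rho y).
    by apply: gaussD; [exact: gaussZ|exact: gauss_dotp].
  move=> rho y; apply: (is_derive_eq (is_deriveM (is_derive_dotp y v a) (hG rho y))).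
  by rewrite /GRing.scale/=; ring.
Qed.

Lemma gauss_measurable F : gauss_class F -> forall d (T : measurableType d) (r : T -> R) (Y : T -> 'rV[R]_n),
  measurable_fun setT r -> measurable_coords Y -> measurable_fun setT (fun t => F (r t) (Y t)).
Proof.
move=> cF d T r Y mr mY; elim: cF => {F} [|F1 F2 _ IH1 _ IH2|c F _ IH|F _ IH|a F cF IH].
- apply: measurableT_comp => //; apply: measurableT_comp => //.
  apply: measurable_funM => //; apply: measurable_funM; first exact: measurable_funX.
  by apply: measurable_sum => i; exact: measurable_funX.
- exact: measurable_funD.
- exact: measurable_funM.
- exact: measurable_funM.
- by apply: measurable_funM => //; apply: measurable_sum => i; exact: measurable_funM.
Qed.

Lemma gauss_cvg F : gauss_class F -> forall (T : Type) (A : set_system T) (r : T -> R) (Y : T -> 'rV[R]_n) r0 Y0,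
  Filter A -> r t @[t --> A] --> r0 -> Y t @[t --> A] --> Y0 ->
  F (r t) (Y t) @[t --> A] --> F r0 Y0.
Proof.
move=> cF T A r Y r0 Y0 FA cr cY.
have cc i : Y t ord0 i @[t --> A] --> Y0 ord0 i.
  exact: (cvg_comp Y (fun M : 'rV[R]_n => M ord0 i) cY (@coord_continuous _ _ _ ord0 i Y0)).
elim: cF => {F} [|F1 F2 _ IH1 _ IH2|c F _ IH|F _ IH|a F cF IH].
- have h : - (r t ^+ 2 * sqn (Y t) / 4) @[t --> A] --> - (r0 ^+ 2 * sqn Y0 / 4).
    apply: (@cvgN _ R^o); apply: cvgM; last exact: cvg_cst.
    apply: cvgM; first exact: (cvgM cr cr).
    by apply: cvg_big => [|i _]; [exact: add_continuous|exact: (cvgM (cc i) (cc i))].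
  exact: (cvg_comp _ _ h (@continuous_expR R _)).
- exact: cvgD.
- by apply: cvgM => //; exact: cvg_cst.
- exact: cvgM.
- apply: cvgM => //; apply: cvg_big => [|i _]; first exact: add_continuous.
  by apply: cvgM => //; exact: cvg_cst.
Qed.

(** One exponent for both polynomial factors keeps the induction closed: sums add exponents, and a
    factor [rho] or [dotp y v] raises them by one. *)
Lemma gauss_bound F : gauss_class F -> exists (C : R) (k : nat), 0 <= C /\
  forall rho y, 0 <= rho ->
    `|F rho y| <= C * (1 + rho) ^+ k * (1 + enorm y) ^+ k * expR (- (rho ^+ 2 * sqn y / 4)).
Proof.
have one_le (a : R) : 0 <= a -> 1 <= 1 + a by rewrite lerDl.
elim => {F} [|F1 F2 _ [C1 [k1 [C10 h1]]] _ [C2 [k2 [C20 h2]]]|c F _ [C [k [C0 h]]]|F _ [C [k [C0 h]]]|a F cF [C [k [C0 h]]]].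
- exists 1, 0%N; split => // rho y _.
  by rewrite !expr0 !mul1r ger0_norm// expR_ge0.
- exists (C1 + C2), (k1 + k2)%N; split; first exact: addr_ge0.
  move=> rho y r0; rewrite (le_trans (ler_normD _ _))// !mulrDl; apply: lerD.
    apply: le_trans (h1 rho y r0) _; rewrite ler_wpM2r ?expR_ge0//.
    rewrite ler_pM ?mulr_ge0 ?exprn_ge0 ?addr_ge0 ?enorm_ge0//.
      by rewrite ler_wpM2l// ler_weXn2l ?leq_addr// one_le.
    by rewrite ler_weXn2l ?leq_addr// one_le// enorm_ge0.
  apply: le_trans (h2 rho y r0) _; rewrite ler_wpM2r ?expR_ge0//.
  rewrite ler_pM ?mulr_ge0 ?exprn_ge0 ?addr_ge0 ?enorm_ge0//.
    by rewrite ler_wpM2l// ler_weXn2l ?leq_addl// one_le.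
  by rewrite ler_weXn2l ?leq_addl// one_le// enorm_ge0.
- exists (`|c| * C), k; split; first exact: mulr_ge0.
  by move=> rho y r0; rewrite normrM -!mulrA ler_wpM2l// !mulrA h.
- exists C, k.+1; split => // rho y r0; rewrite normrM ger0_norm//.
  apply: le_trans (ler_wpM2l r0 (h rho y r0)) _.
  have p1 : 0 <= (1 + rho) ^+ k by rewrite exprn_ge0 ?addr_ge0.
  have p2 : 0 <= (1 + enorm y) ^+ k by rewrite exprn_ge0 ?addr_ge0 ?enorm_ge0.
  rewrite !mulrA ler_wpM2r ?expR_ge0// ler_pM ?mulr_ge0//.
    rewrite [rho * C]mulrC -mulrA ler_wpM2l// exprS ler_wpM2r//.
    by rewrite lerDr.
  by rewrite ler_weXn2l// one_le// enorm_ge0.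
- exists ((\sum_(i < n) `|a ord0 i|) * C), k.+1.
  split; first by rewrite mulr_ge0// sumr_ge0.
  move=> rho y r0; rewrite normrM.
  apply: le_trans (ler_pM _ _ (dotp_le y a) (h rho y r0)) _ => //.
  have p1 : 0 <= (1 + rho) ^+ k by rewrite exprn_ge0 ?addr_ge0.
  have p2 : 0 <= (1 + enorm y) ^+ k by rewrite exprn_ge0 ?addr_ge0 ?enorm_ge0.
  rewrite !mulrA ler_wpM2r ?expR_ge0// -!mulrA ler_wpM2l ?sumr_ge0//.
  rewrite mulrCA ler_wpM2l// mulrCA ler_pM ?mulr_ge0 ?enorm_ge0//.
    by rewrite ler_weXn2l// one_le.
  by rewrite exprS ler_wpM2r// lerDr.
Qed.

End gauss_class.

Section heat_kernel.
Context {R : realType} {n : nat}.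
Implicit Types (y z v : 'rV[R]_n) (rho : R) (F G : R -> 'rV[R]_n -> R).

Lemma poly_gauss_bounded (b : R) k : 0 < b ->
  exists2 C : R, 0 <= C & forall x, 0 <= x -> (1 + x) ^+ k * expR (- (b * x ^+ 2)) <= C.
Proof.
(* [exp (b x^2)] is the power [k + 1] of [exp (c x^2) >= 1 + c x^2], and [1 + x] is at most a
   constant times [1 + c x^2]; the successor allows [k = 0]. *)
move=> b0; pose c := b / k.+1%:R; have c0 : 0 < c by rewrite divr_gt0.
exists ((2 * (1 + c^-1)) ^+ k) => [|x x0].
  by rewrite exprn_ge0// mulr_ge0// addr_ge0// invr_ge0 ltW.
rewrite expRN ler_pdivrMr ?expR_gt0//.
have h1 : 1 + x <= 2 * (1 + c^-1) * (1 + c * x ^+ 2).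
  have : c^-1 * (c * x ^+ 2) = x ^+ 2 by rewrite mulrA mulVf ?gt_eqF// mul1r.
  have : 0 <= c^-1 by rewrite invr_ge0 ltW.
  have : 0 <= c * x ^+ 2 by rewrite mulr_ge0 ?sqr_ge0// ltW.
  by move: (c^-1) (c * x ^+ 2) => p q q0 p0 pq; nra.
have x10 : 0 <= 1 + x by rewrite addr_ge0.
apply: le_trans (lerXn2r k _ _ h1) _; rewrite ?nnegrE//.
  exact: le_trans x10 h1.
rewrite exprMn ler_wpM2l ?exprn_ge0 ?mulr_ge0 ?addr_ge0 ?invr_ge0 ?(ltW c0)//.
have cx : 0 <= c * x ^+ 2 by rewrite mulr_ge0 ?sqr_ge0// ltW.
apply: (@le_trans _ _ (expR (c * x ^+ 2) ^+ k.+1)).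
  rewrite [_ ^+ k.+1]exprS -[leLHS]mul1r ler_pM ?exprn_ge0 ?addr_ge0//.
    by rewrite (le_trans _ (expR_ge1Dx _))// lerDl.
  by apply: lerXn2r; rewrite ?nnegrE ?addr_ge0 ?expR_ge0 ?expR_ge1Dx.
rewrite -expRM_natl (_ : k.+1%:R * (c * x ^+ 2) = b * x ^+ 2)// /c.
by rewrite !mulrA [_ * b]mulrC mulfK ?pnatr_eq0.
Qed.

(** Coordinatewise [y^2 >= z^2 / 2 - (y - z)^2]; the norm is the sup norm, so each of the [n]
    coordinates loses at most 1. *)
Lemma sqn_near y z : `|y - z| <= 1 -> sqn z / 2 - n%:R <= sqn y.
Proof.
move=> yz; rewrite lerBlDr /sqn mulr_suml.
have -> : n%:R = \sum_(i < n) (1:R) by rewrite sumr_const card_ord.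
rewrite -big_split/=; apply: ler_sum => i _.
have := le_trans (coord_le_norm (y - z) i) yz; rewrite !mxE ler_norml => /andP[h1 h2].
have := sqr_ge0 (2 * y ord0 i - z ord0 i).
have : (y ord0 i - z ord0 i) ^+ 2 <= 1 by nra.
by lra.
Qed.

Let c1 : R := (Num.sqrt (4 * pi))^-1.
Let c10 : 0 < c1. Proof. by rewrite invr_gt0 sqrtr_gt0 mulr_gt0 ?pi_gt0. Qed.

(* The heat kernel at time [rho ^- 2]. *)
Definition heat rho y : R := (c1 * rho) ^+ n * expR (- (rho ^+ 2 * sqn y / 4)).

Lemma heat_ge0 rho y : 0 <= rho -> 0 <= heat rho y.
Proof. by move=> r0; rewrite mulr_ge0 ?expR_ge0// exprn_ge0// mulr_ge0// ltW. Qed.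

Lemma heat_class : gauss_class heat.
Proof.
have -> : heat = fun rho y => c1 ^+ n * (rho ^+ n * expR (- (rho ^+ 2 * sqn y / 4))).
  by apply/funext => rho; apply/funext => y; rewrite /heat exprMn mulrA.
by apply: gaussZ; apply: gauss_rhoX; exact: gauss_exp.
Qed.

(** Away from the origin the Gaussian factor beats every power of [rho], so one bound serves all
    heat times; it lets the subordinated kernel be differentiated off 0 without a lower bound on the
    passage time. *)
Lemma gauss_away F (r r' : R) : gauss_class F -> 0 < r ->
  exists B : R, forall rho y, 0 <= rho -> r <= enorm y <= r' -> `|F rho y| <= B.
Proof.
move=> /gauss_bound[C [k [C0 hC]]] r0.
have [C' C'0 hC'] := @poly_gauss_bounded (r ^+ 2 / 4) k (divr_gt0 (exprn_gt0 2 r0) (ltr0n _ 4)).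
exists (C * C' * (1 + r') ^+ k) => rho y rho0 /andP[ry yr'].
apply: le_trans (hC rho y rho0) _.
rewrite -!mulrA ler_wpM2l// mulrCA mulrC ler_pM ?mulr_ge0 ?exprn_ge0 ?expR_ge0 ?addr_ge0 ?enorm_ge0//.
  apply: le_trans (hC' rho rho0); rewrite ler_wpM2l ?exprn_ge0 ?addr_ge0// ler_expR lerN2.
  have rq : r ^+ 2 <= sqn y by rewrite -sqr_enorm lerXn2r ?nnegrE ?enorm_ge0// ltW.
  by have := ler_wpM2l (sqr_ge0 rho) rq; lra.
by rewrite lerXn2r ?nnegrE ?addr_ge0 ?enorm_ge0 ?lerD2l// (le_trans (enorm_ge0 y)).
Qed.

Lemma gauss_local F (r r' : R) : gauss_class F -> 0 < r ->
  exists2 C : R, 0 <= C & forall rho y z, r <= rho <= r' -> `|y - z| <= 1 ->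
    `|F rho y| <= C * heat (r / 2) z.
Proof.
move=> /gauss_bound[C [k [C0 hC]]] r0.
have [C' C'0 hC'] := @poly_gauss_bounded (r ^+ 2 / 8) k (divr_gt0 (exprn_gt0 2 r0) (ltr0n _ 8)).
have q0 : 0 < (c1 * (r / 2)) ^+ n by rewrite exprn_gt0// mulr_gt0// divr_gt0.
exists (C * (1 + `|r'|) ^+ k * C' * expR (r ^+ 2 * n%:R / 8) / (c1 * (r / 2)) ^+ n).
  by rewrite !mulr_ge0 ?exprn_ge0 ?addr_ge0 ?expR_ge0// invr_ge0 ltW.
move=> rho y z /andP[rrho rhor'] yz; have rho0 : 0 <= rho by rewrite (le_trans (ltW r0)).
apply: le_trans (hC rho y rho0) _.
(* Half of the Gaussian exponent absorbs the polynomial in [enorm y]; the other half moves from [y]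
   to [z] by [sqn_near], which halves it again and produces [heat (r / 2)]. *)
have e2 : expR (- (rho ^+ 2 * sqn y / 4)) <=
   expR (- (r ^+ 2 / 8 * enorm y ^+ 2)) * (expR (r ^+ 2 * n%:R / 8) * expR (- ((r / 2) ^+ 2 * sqn z / 4))).
  rewrite -!expRD ler_expR sqr_enorm.
  have : r ^+ 2 * sqn y <= rho ^+ 2 * sqn y.
    by rewrite ler_wpM2r ?sqn_ge0// lerXn2r ?nnegrE// ltW.
  have := ler_wpM2l (sqr_ge0 r) (sqn_near yz).
  by move: (rho ^+ 2 * sqn y) => p; lra.
rewrite /heat mulrA mulfVK ?gt_eqF//.
set X := expR (_ / 8) in e2 *; set Y := expR (- ((r / 2) ^+ 2 * _ / 4)) in e2 *.
rewrite [leRHS](_ : _ = C * ((1 + `|r'|) ^+ k * (C' * (X * Y)))); last by ring.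
rewrite -2!mulrA ler_wpM2l//.
have e0 := enorm_ge0 y.
rewrite ler_pM ?mulr_ge0 ?exprn_ge0 ?expR_ge0 ?addr_ge0//.
  by rewrite lerXn2r ?nnegrE ?addr_ge0// lerD2l (le_trans rhor')// ler_norm.
apply: le_trans (ler_wpM2l _ e2) _; first by rewrite exprn_ge0 ?addr_ge0 ?enorm_ge0.
by rewrite [leLHS]mulrA ler_wpM2r ?mulr_ge0 ?expR_ge0// hC'.
Qed.

Definition heat1 v rho y : R := - (1 / 2) * (rho ^+ 2 * (dotp y v * heat rho y)).
Definition heat2 u v rho y : R :=
  (1 / 4 * rho ^+ 4 * dotp y u * dotp y v - 1 / 2 * rho ^+ 2 * dotp u v) * heat rho y.

Lemma heat1_class v : gauss_class (heat1 v).
Proof. by apply: gaussZ; apply: gauss_rhoX; apply: gauss_dotp; exact: heat_class. Qed.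

Lemma heat2_class u v : gauss_class (heat2 u v).
Proof.
have -> : heat2 u v = fun rho y => 1 / 4 * (rho ^+ 4 * (dotp y u * (dotp y v * heat rho y)))
     + - (1 / 2) * dotp u v * (rho ^+ 2 * heat rho y).
  by apply/funext => rho; apply/funext => y; rewrite /heat2; ring.
apply: gaussD; apply: gaussZ; apply: gauss_rhoX; last exact: heat_class.
by do 2 apply: gauss_dotp; exact: heat_class.
Qed.

Lemma is_derive_heat rho y v : is_derive y v (heat rho) (heat1 v rho y).
Proof.
apply: (is_derive_eq (is_deriveZ ((c1 * rho) ^+ n) (is_derive_gauss_exp rho y v))).
by rewrite /heat1 /heat /GRing.scale/=; ring.
Qed.

Lemma is_derive_heat1 rho y u v : is_derive y u (heat1 v rho) (heat2 u v rho y).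
Proof.
apply: (is_derive_eq (is_deriveZ (- (1 / 2) : R)
  (is_deriveZ (rho ^+ 2) (is_deriveM (is_derive_dotp y u v) (is_derive_heat rho y u))))).
by rewrite /heat2 /heat1 /GRing.scale/=; field.
Qed.

Lemma heat_poly_le k : exists2 C : R, 0 <= C & forall rho y, 0 <= rho ->
  (1 + rho * enorm y) ^+ k * heat rho y <= C * heat (rho / 2) y.
Proof.
(* Passing from [rho] to [rho / 2] lowers the Gaussian coefficient from 1/4 to 1/16; the difference
   3/16 absorbs the polynomial, and [2 ^+ n] adjusts the normalisation. *)
have [C C0 hC] := @poly_gauss_bounded (3 / 16) k (divr_gt0 (ltr0n _ 3) (ltr0n _ 16)).
exists (C * 2 ^+ n) => [|rho y rho0]; first by rewrite mulr_ge0 ?exprn_ge0.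
have -> : C * 2 ^+ n * heat (rho / 2) y = (c1 * rho) ^+ n * (C * expR (- ((rho / 2) ^+ 2 * sqn y / 4))).
  rewrite /heat (_ : (c1 * rho) ^+ n = 2 ^+ n * (c1 * (rho / 2)) ^+ n); first by ring.
  by rewrite -exprMn; congr (_ ^+ n); field.
rewrite /heat mulrCA ler_wpM2l ?exprn_ge0 ?mulr_ge0// ?(ltW c10)//.
have -> : expR (- (rho ^+ 2 * sqn y / 4)) =
    expR (- (3 / 16 * (rho * enorm y) ^+ 2)) * expR (- ((rho / 2) ^+ 2 * sqn y / 4)).
  by rewrite -expRD exprMn sqr_enorm; congr expR; field.
by rewrite mulrA ler_wpM2r ?expR_ge0// hC// mulr_ge0 ?enorm_ge0.
Qed.

Lemma heat1_le v : exists2 C : R, 0 <= C & forall rho y, 0 <= rho ->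
  `|heat1 v rho y| <= C * rho * heat (rho / 2) y.
Proof.
have [C C0 hC] := heat_poly_le 1; pose a := \sum_(i < n) `|v ord0 i|.
have a0 : 0 <= a by rewrite sumr_ge0.
exists (a * C) => [|rho y rho0]; first exact: mulr_ge0.
have h0 := heat_ge0 y rho0; have e0 := enorm_ge0 y.
rewrite /heat1 (normrM (- (1 / 2))) (normrM (rho ^+ 2)) (normrM (dotp y v)) (ger0_norm h0) normrN (ger0_norm (sqr_ge0 rho)) (@ger0_norm _ (1 / 2)) ?divr_ge0//.
apply: (@le_trans _ _ (rho * (a * ((1 + rho * enorm y) * heat rho y)))); last first.
  rewrite [leRHS](_ : _ = rho * (a * (C * heat (rho / 2) y))); last by ring.
  by rewrite !ler_wpM2l// -[1 + _]expr1 hC.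
have d := dotp_le y v; rewrite -/a in d.
move: (heat rho y) h0 => h h0.
have : `|dotp y v| * h <= a * enorm y * h by rewrite ler_wpM2r.
have r20 : 0 <= rho ^+ 2 by rewrite sqr_ge0.
move=> /(ler_wpM2l r20).
have : 0 <= rho * a * h by rewrite !mulr_ge0.
have : 0 <= rho * a * (rho * enorm y * h) by rewrite !mulr_ge0.
by lra.
Qed.

Lemma powR_enorm_le rho y gamma : 0 < rho -> 0 <= gamma <= 1 ->
  enorm y `^ gamma <= rho `^ (- gamma) * (1 + rho * enorm y).
Proof.
move=> rho0 /andP[g0 g1]; have e0 := enorm_ge0 y.
have re0 : 0 <= rho * enorm y by rewrite mulr_ge0// ltW.
rewrite -[in leLHS](mulKf (lt0r_neq0 rho0) (enorm y)) powRM ?invr_ge0 ?(ltW rho0)//.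
rewrite -powR_inv1 ?(ltW rho0)// -powRrM mulN1r ler_wpM2l ?powR_ge0//.
have [x1|x1] := leP 1 (rho * enorm y).
  by rewrite (le_trans (ler_powR x1 g1))// powRr1// lerDr.
rewrite (@le_trans _ _ 1) ?lerDl//.
rewrite (_ : 1 = 1 `^ gamma); last by rewrite powR1.
apply: (ge0_ler_powR g0); rewrite ?nnegrE//.
exact: ltW.
Qed.

(** Each derivative costs a factor [rho] and the weight gains [rho] to the power [- gamma]; at heat
    time [s] this is [s] to the power [gamma / 2 - 1]. The exponent 3 below is 2 from [heat2] plus 1
    from the weight. *)
Lemma heat2_le u v : exists2 C : R, 0 <= C & forall rho y gamma, 0 < rho -> 0 <= gamma <= 1 ->
  `|heat2 u v rho y| * enorm y `^ gamma <= C * (rho ^+ 2 * rho `^ (- gamma)) * heat (rho / 2) y.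
Proof.
have [C C0 hC] := heat_poly_le 3.
pose a := \sum_(i < n) `|u ord0 i|; pose b := \sum_(i < n) `|v ord0 i|.
have a0 : 0 <= a by rewrite sumr_ge0.
have b0 : 0 <= b by rewrite sumr_ge0.
have duv := normr_ge0 (dotp u v).
exists ((a * b + `|dotp u v|) * C) => [|rho y gamma rho0 g01].
  by rewrite mulr_ge0 ?addr_ge0 ?mulr_ge0.
have h0 := heat_ge0 y (ltW rho0); have e0 := enorm_ge0 y.
have re0 : 0 <= rho * enorm y by rewrite mulr_ge0// ltW.
have p1 := powR_enorm_le y rho0 g01.
have p2 : `|heat2 u v rho y| <= (a * b + `|dotp u v|) * rho ^+ 2 * ((1 + rho * enorm y) ^+ 2 * heat rho y).
  rewrite /heat2 normrM (ger0_norm h0) [leRHS]mulrA ler_wpM2r//.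
  apply: le_trans (ler_normB _ _) _; rewrite (normrM _ (dotp y v)) (normrM _ (dotp y u)) (normrM _ (dotp u v)).
  have rho0' := ltW rho0.
  have r40 : 0 <= rho ^+ 4 by rewrite exprn_ge0// ltW.
  have r20 : 0 <= rho ^+ 2 by rewrite exprn_ge0// ltW.
  have -> : `|1 / 4 * rho ^+ 4| = 1 / 4 * rho ^+ 4 by rewrite ger0_norm// mulr_ge0.
  have -> : `|1 / 2 * rho ^+ 2| = 1 / 2 * rho ^+ 2 by rewrite ger0_norm// mulr_ge0.
  have d1 := dotp_le y u; have d2 := dotp_le y v; rewrite -/a -/b in d1 d2.
  have d12 := ler_pM (normr_ge0 _) (normr_ge0 _) d1 d2.
  have := ler_wpM2l r40 d12.
  have : 0 <= a * b * rho ^+ 2 * (rho * enorm y) by rewrite !mulr_ge0.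
  have : 0 <= a * b * rho ^+ 2 by rewrite !mulr_ge0.
  have : 0 <= `|dotp u v| * rho ^+ 2 by rewrite !mulr_ge0.
  have : 0 <= `|dotp u v| * rho ^+ 2 * (rho * enorm y) by rewrite !mulr_ge0.
  have : 0 <= `|dotp u v| * rho ^+ 2 * (rho * enorm y) ^+ 2 by rewrite !mulr_ge0 ?exprn_ge0.
  have : 0 <= a * b * rho ^+ 2 * (rho * enorm y) ^+ 2 by rewrite !mulr_ge0 ?exprn_ge0.
  by lra.
apply: le_trans (ler_pM _ _ p2 p1) _; rewrite ?powR_ge0//.
rewrite [leLHS](_ : _ = (a * b + `|dotp u v|) * (rho ^+ 2 * rho `^ (- gamma)) * ((1 + rho * enorm y) ^+ 3 * heat rho y)); last by ring.
rewrite [leRHS](_ : _ = (a * b + `|dotp u v|) * (rho ^+ 2 * rho `^ (- gamma)) * (C * heat (rho / 2) y)); last by ring.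
have r20 : 0 <= rho ^+ 2 * rho `^ (- gamma) by rewrite mulr_ge0 ?powR_ge0 ?sqr_ge0.
apply: ler_wpM2l; first by apply: mulr_ge0 => //; rewrite addr_ge0 ?mulr_ge0.
by apply: hC; exact: ltW.
Qed.

(* Heat kernels are indexed by [rho = 1 / sqrt s] instead of the time [s], so
   that [gauss_class] only involves natural powers. *)
Definition rho_of (s : R) : R := (Num.sqrt s)^-1.

Lemma rho_of_gt0 s : 0 < s -> 0 < rho_of s.
Proof. by move=> s0; rewrite invr_gt0 sqrtr_gt0. Qed.

Lemma rho_of_sqr s : 0 < s -> rho_of s ^+ 2 = s^-1.
Proof. by move=> s0; rewrite exprVn sqr_sqrtr// ltW. Qed.

Definition heatL rho y : R := \sum_(i < n) heat2 (evec R i) (evec R i) rho y.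

Lemma heatLE rho y : heatL rho y = (1 / 4 * rho ^+ 4 * sqn y - 1 / 2 * rho ^+ 2 * n%:R) * heat rho y.
Proof.
have de (z : 'rV[R]_n) i : dotp z (evec R i) = z ord0 i.
  rewrite /dotp (bigD1 i)//= big1 ?addr0 => [|j ji]; first by rewrite !mxE !eqxx mulr1.
  by rewrite !mxE eqxx/= (negbTE ji) mulr0.
rewrite /heatL /heat2 -mulr_suml; congr (_ * _).
rewrite sumrB; congr (_ - _).
  by rewrite /sqn mulr_sumr; apply: eq_bigr => i _; rewrite !de expr2 -mulrA.
rewrite -mulr_sumr; congr (_ * _).
by under eq_bigr do rewrite de !mxE !eqxx; rewrite sumr_const card_ord.
Qed.

Lemma is_derive_heat_time (s : R) y : 0 < s ->
  is_derive s 1 (fun s => heat (rho_of s) y) (heatL (rho_of s) y).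
Proof.
move=> s0; have r0 := rho_of_gt0 s0.
have dr : is_derive s 1 rho_of (- (1 / 2) * rho_of s ^+ 3).
  have ds : is_derive s 1 Num.sqrt (2 * Num.sqrt s)^-1 by exact: is_derive1_sqrt.
  have sq0 : Num.sqrt s != 0 by rewrite gt_eqF// sqrtr_gt0.
  apply: (is_derive_eq (is_deriveV sq0 ds)).
  by rewrite /rho_of /GRing.scale/=; field.
have dq : is_derive s 1 (fun s => - (rho_of s ^+ 2 * sqn y / 4)) (1 / 4 * rho_of s ^+ 4 * sqn y).
  apply: (is_derive_eq (is_derive1N (is_derive1M (is_derive1M (is_derive1X 2 dr)
    (is_derive_cst (sqn y) s 1)) (is_derive_cst (4^-1 : R) s 1)))).
  by rewrite /cst/=; field.
apply: (is_derive_eq (is_derive1M (is_derive1X n (is_derive1Ml c1 dr)) (is_derive1_expR dq))).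
rewrite heatLE /heat; set X := c1 * rho_of s; set e := expR _.
(* The truncated predecessor is harmless at [n = 0], where both sides vanish. *)
have E : n%:R * X ^+ n.-1 * X = n%:R * X ^+ n.
  by rewrite -mulrA -exprSr; case: (n) => [|k] //; rewrite !mul0r.
have EE : n%:R * X ^+ n.-1 * (c1 * (- (1 / 2) * rho_of s ^+ 3)) * e =
    - (1 / 2) * rho_of s ^+ 2 * (n%:R * X ^+ n) * e.
  by rewrite -E /X; move: (_ ^+ n.-1) (n%:R : R) => a b; field.
rewrite [X in X + _]EE; move: (X ^+ n) (n%:R : R) => a b.
by rewrite -[LHS]/(_ : R); field.
Qed.

End heat_kernel.

(** * Total mass of the heat kernel *)

Section heat_mass.
Context {R : realType}.
Notation mu := (@lebesgue_measure R).

Lemma gauss_mass1 (rho x : R) : 0 < rho ->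
  (\int[mu]_s ((Num.sqrt (4 * pi))^-1 * rho * expR (- (rho ^+ 2 * (x - s) ^+ 2 / 4)))%:E = 1)%E.
Proof.
move=> r0; have s2 : 0 < Num.sqrt 2 :> R by rewrite sqrtr_gt0.
have sig : Num.sqrt 2 / rho != 0 :> R by rewrite gt_eqF// divr_gt0.
(* The variance [2 / rho ^+ 2] is twice the heat time. *)
rewrite -(integral_normal_pdf x (Num.sqrt 2 / rho)); apply: eq_integral => s _; congr EFin.
rewrite normal_pdfE// /normal_peak /normal_fun.
have E : (Num.sqrt 2 / rho) ^+ 2 = 2 / rho ^+ 2 by rewrite expr_div_n sqr_sqrtr.
rewrite E; congr (_ * expR _).
  have -> : 2 / rho ^+ 2 * pi *+ 2 = (4 * pi) * (rho^-1) ^+ 2.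
    by rewrite -mulr_natr; field; rewrite gt_eqF.
  rewrite [in RHS]sqrtrM ?mulr_ge0 ?pi_ge0// sqrtr_sqr ger0_norm ?invr_ge0 ?ltW//.
  by rewrite invfM invrK.
by rewrite -mulr_natr; field; rewrite gt_eqF.
Qed.

(** The constant [c] serves the induction: it collects the Gaussian factors of the outer
    coordinates. *)
Lemma iint_heat n (c rho : R) (x : 'rV[R]_n) : 0 <= c -> 0 < rho ->
  iint (fun y => (c * heat rho (x - y))%:E) = c%:E.
Proof.
move=> c0 r0; elim: n c c0 x => [|n IH] c c0 x /=.
  by rewrite /heat /sqn big_ord0 expr0 mulr0 mul0r oppr0 expR0 !mulr1.
pose x' : 'rV[R]_n := \row_i x ord0 (lift ord0 i).
pose q (s : R) := (Num.sqrt (4 * pi))^-1 * rho * expR (- (rho ^+ 2 * (x ord0 ord0 - s) ^+ 2 / 4)).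
have q0 s : 0 <= q s by rewrite !mulr_ge0 ?expR_ge0 ?invr_ge0 ?sqrtr_ge0// ltW.
have E s (v : 'rV[R]_n) : c * heat rho (x - row_mx (const_mx s : 'rV_1) v) = c * q s * heat rho (x' - v).
  have sE : sqn (x - row_mx (const_mx s : 'rV_1) v) = (x ord0 ord0 - s) ^+ 2 + sqn (x' - v).
    rewrite /sqn big_ord_recl; congr (_ + _).
      rewrite !mxE; case: fintype.splitP => // k _; by rewrite mxE.
    apply: eq_bigr => i _; rewrite !mxE; case: fintype.splitP => [k|k /= ik].
      by rewrite ord1.
    by rewrite (_ : k = i)//; apply: val_inj; case: ik.
  rewrite /heat sE [_ ^+ n.+1]exprS /q.
  have -> : - (rho ^+ 2 * ((x ord0 ord0 - s) ^+ 2 + sqn (x' - v)) / 4) =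
    - (rho ^+ 2 * (x ord0 ord0 - s) ^+ 2 / 4) - rho ^+ 2 * sqn (x' - v) / 4 by ring.
  rewrite expRD; move: (expR _) (expR _) (_ ^+ n) => a b e.
  by ring.
transitivity (\int[mu]_s (c%:E * (q s)%:E))%E.
  apply: eq_integral => s _; rewrite -EFinM -(IH (c * q s) _ x'); last exact: mulr_ge0.
  by congr iint; apply/funext => v; rewrite E.
rewrite ge0_integralZl//.
- by rewrite gauss_mass1// mule1.
- apply/measurable_EFinP/measurable_funM => //; apply: measurableT_comp => //.
  apply: measurableT_comp => //; apply: measurable_funM => //.
  apply: measurable_funM => //; apply: measurable_funX.
  exact: measurable_funB.
- by move=> s _; rewrite lee_fin q0.
Qed.

End heat_mass.

(** * Gaussian potentials of bounded continuous data *)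

Section gauss_potential.
Context {R : realType} {n : nat} d (Om : measurableType d).
Variables (m : {measure set Om -> \bar R}) (V : Om -> 'rV[R]_n).
Hypothesis mV : measurable_coords V.
Hypothesis ge0_iint : forall F, borel_rV (fun _ : unit => F) -> (forall x, 0 <= F x)%E ->
  (iint F = \int[m]_w F (V w))%E.
Implicit Types (F G : R -> 'rV[R]_n -> R) (x z u v : 'rV[R]_n) (rho s : R).

Lemma measurable_coords_sub d' (T : measurableType d') (Y : T -> 'rV[R]_n) x :
  measurable_coords Y -> measurable_coords (fun t => x - Y t).
Proof.
by move=> mY i; under eq_fun do rewrite !mxE; apply: measurable_funB.
Qed.

Lemma measurable_gauss F rho x : gauss_class F -> measurable_fun setT (fun w => F rho (x - V w)).
Proof. by move=> cF; apply: gauss_measurable => //; exact: measurable_coords_sub. Qed.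

Lemma integral_heat rho x : 0 < rho -> (\int[m]_w (heat rho (x - V w))%:E = 1)%E.
Proof.
move=> r0; rewrite -(@iint_heat _ n 1 rho x)//.
rewrite -[LHS](ge0_iint (F := fun y => (heat rho (x - y))%:E)).
- by congr iint; apply/funext => y; rewrite mul1r.
- move=> d' T tau Y _ mY; apply/measurable_EFinP.
  by apply: gauss_measurable => //; [exact: heat_class|exact: measurable_coords_sub].
- by move=> y; rewrite lee_fin heat_ge0// ltW.
Qed.

Lemma integrable_heat rho x : 0 < rho -> m.-integrable setT (fun w => (heat rho (x - V w))%:E).
Proof.
move=> r0; apply/integrableP; split.
  by apply/measurable_EFinP; apply: measurable_gauss; exact: heat_class.
under eq_integral do rewrite gee0_abs ?lee_fin ?heat_ge0 ?(ltW r0)//.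
by rewrite integral_heat// ltry.
Qed.

Variables (w0 : 'rV[R]_n -> R) (M : R).
Hypothesis cw0 : continuous w0.
Hypothesis w0M : forall x, `|w0 x| <= M.

Let M0 : 0 <= M. Proof. exact: le_trans (normr_ge0 _) (w0M 0). Qed.

Definition gpot F rho x : R := \int[m]_w (F rho (x - V w) * w0 (V w)).

Lemma measurable_gpot F rho x : gauss_class F ->
  measurable_fun setT (fun w => F rho (x - V w) * w0 (V w)).
Proof.
move=> cF; apply: measurable_funM; first exact: measurable_gauss.
exact: measurable_continuous_coords.
Qed.

(* A Gaussian of twice the width, centred at [z], dominates all the integrands
   with [x] within distance 1 of [z], as differentiation under the integral
   requires. *)
Lemma gpot_dom F (r r' : R) : gauss_class F -> 0 < r ->
  exists2 C : R, 0 <= C & forall rho x z w, r <= rho <= r' -> `|x - z| <= 1 ->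
    `|F rho (x - V w) * w0 (V w)| <= C * heat (r / 2) (z - V w).
Proof.
move=> cF r0; have [C C0 hC] := gauss_local r' cF r0.
exists (C * M) => [|rho x z w rr xz]; first exact: mulr_ge0.
rewrite normrM mulrAC ler_pM// hC//.
by rewrite opprB addrA subrK.
Qed.

Lemma integrable_dom (C rho : R) z : 0 < rho ->
  m.-integrable setT (EFin \o (fun w => C * heat rho (z - V w))).
Proof.
move=> r0; apply: (eq_integrable _ (fun w => (C%:E * (heat rho (z - V w))%:E)%E)) => //.
by apply: integrableZl => //; exact: integrable_heat.
Qed.

Lemma integrable_gpot F rho x : gauss_class F -> 0 < rho ->
  m.-integrable setT (EFin \o (fun w => F rho (x - V w) * w0 (V w))).
Proof.
move=> cF r0; have [C C0 hC] := gpot_dom rho cF r0.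
have r20 : 0 < rho / 2 by rewrite divr_gt0.
apply: (le_integrable measurableT _ _ (integrable_dom C x r20)) => //.
  by apply/measurable_EFinP; exact: measurable_gpot.
move=> w _; rewrite lee_fin; apply: le_trans (ler_norm _).
by apply: hC; rewrite ?lexx// subrr normr0.
Qed.

Lemma is_derive_shift (f : 'rV[R]_n -> R) x v z (l : R) :
  is_derive (x - z) v f l -> is_derive x v (fun y => f (y - z)) l.
Proof.
move=> h; apply: is_derive_line.
have -> : (fun e : R => f (e *: v + x - z)) = (fun e => f (e *: v + (x - z))).
  by apply/funext => e; rewrite addrA.
by apply: is_derive_on_line; rewrite scale0r add0r.
Qed.

Lemma is_derive_gpot F G rho x v : gauss_class F -> gauss_class G -> 0 < rho ->
  (forall y, is_derive y v (F rho) (G rho y)) ->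
  is_derive x v (gpot F rho) (gpot G rho x).
Proof.
move=> cF cG r0 hFG; have [C C0 hC] := gpot_dom rho cG r0.
have r20 : 0 < rho / 2 by rewrite divr_gt0.
(* The radius [(1 + |v|)^-1] keeps [e v + x] within distance 1 of [x], as [gpot_dom] asks. *)
apply: (@is_derive_parametric_integral _ _ _ _ m setT measurableT
  (fun x w => F rho (x - V w) * w0 (V w)) (fun x w => G rho (x - V w) * w0 (V w))
  (fun w => C * heat (rho / 2) (x - V w)) x v (1 + `|v|)^-1).
- by rewrite invr_gt0 ltr_wpDr.
- by move=> e _; exact: integrable_gpot.
- move=> e w _ _; under eq_fun do rewrite mulrC.
  rewrite [X in is_derive _ _ _ X]mulrC; apply: is_deriveZ.
  exact: is_derive_shift.
- by move=> w; rewrite mulr_ge0// heat_ge0// ltW.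
- exact: integrable_dom.
- move=> e w he _; apply: hC; first by rewrite lexx.
  rewrite addrK normrZ.
  apply: le_trans (ler_wpM2r (normr_ge0 v) (ltW he)) _.
  by rewrite mulrC ler_pdivrMr ?ltr_wpDr// mul1r lerDr.
Qed.

Lemma continuous_gpot F rho : gauss_class F -> 0 < rho -> continuous (gpot F rho).
Proof.
move=> cF r0 x; have [C C0 hC] := gpot_dom rho cF r0.
have r20 : 0 < rho / 2 by rewrite divr_gt0.
apply: (@cvg_parametric_integral _ _ _ _ m setT measurableT
  (fun x w => F rho (x - V w) * w0 (V w)) (fun w => C * heat (rho / 2) (x - V w)) x 1) => //.
- by move=> y _; exact: measurable_gpot.
- move=> w _; have h : F rho (y - V w) @[y --> x] --> F rho (x - V w).
    have h1 : continuous (fun y : 'rV[R]_n => y - V w).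
      by move=> y; apply: continuousB => //; exact: cst_continuous.
    exact: (@gauss_cvg _ _ F cF _ (nbhs x) (fun _ => rho) (fun y => y - V w) rho _ _ (cvg_cst rho) (h1 x)).
  exact: (cvgM h (cvg_cst _)).
- exact: integrable_dom.
- by move=> y w xy _; apply: hC; rewrite ?lexx// distrC ltW.
Qed.

Let rho_of_near s t : 0 < s -> `|s - t| < s / 2 -> rho_of (2 * s) <= rho_of t <= rho_of (s / 2).
Proof.
move=> s0; rewrite ltr_distl => /andP[h1 h2].
rewrite /rho_of !lef_pV2 ?posrE ?sqrtr_gt0 ?ler_wsqrtr//; lra.
Qed.

Lemma continuous_gpot_time F s x : gauss_class F -> 0 < s ->
  gpot F (rho_of t) x @[t --> s] --> gpot F (rho_of s) x.
Proof.
move=> cF s0; have s20 : 0 < 2 * s by rewrite mulr_gt0.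
have [C C0 hC] := gpot_dom (rho_of (s / 2)) cF (rho_of_gt0 s20).
have r20 : 0 < rho_of (2 * s) / 2 by rewrite divr_gt0// rho_of_gt0.
apply: (@cvg_parametric_integral _ R^o _ _ m setT measurableT
  (fun t w => F (rho_of t) (x - V w) * w0 (V w)) (fun w => C * heat (rho_of (2 * s) / 2) (x - V w)) s (s / 2)).
- by rewrite divr_gt0.
- by move=> y _; exact: measurable_gpot.
- move=> w _; have h : F (rho_of t) (x - V w) @[t --> s] --> F (rho_of s) (x - V w).
    have h1 : rho_of t @[t --> s] --> rho_of s.
      by apply: cvgV; [rewrite gt_eqF// sqrtr_gt0|exact: sqrt_continuous].
    exact: (@gauss_cvg _ _ F cF _ (nbhs s) rho_of (fun _ => x - V w) _ _ _ h1 (cvg_cst _)).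
  exact: (cvgM h (cvg_cst _)).
- exact: integrable_dom.
- by move=> t w st _; apply: hC; [exact: rho_of_near|rewrite subrr normr0].
Qed.

Lemma is_derive_gpot_time F G s x : gauss_class F -> gauss_class G -> 0 < s ->
  (forall (t : R) y, 0 < t -> is_derive t 1 (fun t => F (rho_of t) y) (G (rho_of t) y)) ->
  is_derive s 1 (fun t => gpot F (rho_of t) x) (gpot G (rho_of s) x).
Proof.
move=> cF cG s0 hFG; have s20 : 0 < 2 * s by rewrite mulr_gt0.
have [C C0 hC] := gpot_dom (rho_of (s / 2)) cG (rho_of_gt0 s20).
have r20 : 0 < rho_of (2 * s) / 2 by rewrite divr_gt0// rho_of_gt0.
have near_s e : `|e| < s / 2 -> `|s - (e *: (1 : R^o) + s)| < s / 2 /\ 0 < e *: (1 : R^o) + s.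
  rewrite [e *: _]mulr1 (addrC e) opprD addNKr normrN => he; split => //.
  by move: he; rewrite ltr_norml => /andP[]; lra.
apply: (@is_derive_parametric_integral _ R^o _ _ m setT measurableT
  (fun t w => F (rho_of t) (x - V w) * w0 (V w)) (fun t w => G (rho_of t) (x - V w) * w0 (V w))
  (fun w => C * heat (rho_of (2 * s) / 2) (x - V w)) s 1 (s / 2)).
- by rewrite divr_gt0.
- by move=> e /near_s[_ h]; apply: integrable_gpot => //; exact: rho_of_gt0.
- move=> e w /near_s[_ h] _; under eq_fun do rewrite mulrC.
  rewrite [X in is_derive _ _ _ X]mulrC; apply: is_deriveZ.
  exact: hFG.
- by move=> w; rewrite mulr_ge0// heat_ge0// ltW.
- exact: integrable_dom.
- by move=> e w /near_s[h _] _; apply: hC; [exact: rho_of_near|rewrite subrr normr0].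
Qed.

Lemma gpot_le F rho x (C : R) : gauss_class F -> 0 < rho -> 0 <= C ->
  (forall y, `|F rho y| <= C * heat (rho / 2) y) -> `|gpot F rho x| <= C * M.
Proof.
move=> cF r0 C0 hF; have r20 : 0 < rho / 2 by rewrite divr_gt0.
apply: le_trans (le_normr_Rintegral _ _) _ => //; first exact: integrable_gpot.
have -> : C * M = \int[m]_w (C * M * heat (rho / 2) (x - V w)).
  by rewrite RintegralZl// ?/Rintegral ?integral_heat ?mulr1//; exact: integrable_heat.
apply: le_Rintegral => //.
- by apply: (integrable_abse (integrable_gpot x cF r0)).
- exact: integrable_dom.
- by move=> w _; rewrite normrM mulrAC ler_pM.
Qed.

End gauss_potential.

Lemma continuous_dist_lt {R : realType} {W : normedModType R} (f : W -> R) :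
  (forall x eps, 0 < eps -> \forall y \near x, `|f x - f y| < eps) -> continuous f.
Proof. by move=> hf x; apply/cvgrPdist_lt => /= eps; exact: hf. Qed.

(** * Estimates for Hoelder data *)

Section holder_potential.
Context {R : realType} {n : nat} d (Om : measurableType d).
Variables (m : {measure set Om -> \bar R}) (V : Om -> 'rV[R]_n).
Hypothesis mV : measurable_coords V.
Hypothesis ge0_iint : forall F, borel_rV (fun _ : unit => F) -> (forall x, 0 <= F x)%E ->
  (iint F = \int[m]_w F (V w))%E.
Implicit Types (F G : R -> 'rV[R]_n -> R) (x y z u v : 'rV[R]_n) (rho s : R).

(** The mean value inequality with a moving bound: both [f - g] and [- f - g] are nonincreasing. *)
Lemma is_derive_dist_le (f g df dg : R -> R) (a b : R) : a <= b ->
  (forall t, a <= t <= b -> is_derive t 1 f (df t)) ->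
  (forall t, a <= t <= b -> is_derive t 1 g (dg t)) ->
  (forall t, a < t < b -> `|df t| <= dg t) -> `|f b - f a| <= g b - g a.
Proof.
move=> ab hf hg hfg.
have key (h dh : R -> R) : (forall t, a <= t <= b -> is_derive t 1 h (dh t)) ->
    (forall t, a < t < b -> dh t <= 0) -> h b <= h a.
  move=> hh dh0; apply: (@ler0_derive1_le_cc _ h a b) => //.
  - by move=> t; rewrite in_itv/= => /andP[ta tb]; case: (hh t) => //; rewrite !ltW.
  - move=> t; rewrite in_itv/= => tab; have /andP[ta tb] := tab.
    by case: (hh t) => [|dht dhtE]; rewrite ?derive1E ?dhtE ?dh0// !ltW.
  - by apply: derivable_within_continuous => t; rewrite in_itv/= => /hh[].
  - by rewrite in_itv/= lexx ab.
  - by rewrite in_itv/= lexx ab.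
have h1 : f b - g b <= f a - g a.
  apply: (key (fun t => f t - g t) (fun t => df t - dg t)) => t tab.
    by apply: is_derive1D; [exact: hf|apply: is_derive1N; exact: hg].
  by rewrite subr_le0 (le_trans (ler_norm _))// hfg.
have h2 : - f b - g b <= - f a - g a.
  apply: (key (fun t => - f t - g t) (fun t => - df t - dg t)) => t tab.
    by apply: is_derive1D; apply: is_derive1N; [exact: hf|exact: hg].
  by rewrite subr_le0 (le_trans (ler_norm _))// normrN hfg.
by rewrite ler_norml; apply/andP; split; lra.
Qed.

Lemma gauss_sum (I : Type) (r : seq I) (G : I -> R -> 'rV[R]_n -> R) :
  (forall i, gauss_class (G i)) -> gauss_class (fun rho y => \sum_(i <- r) G i rho y).
Proof.
move=> cG; elim: r => [|i r IH].
  have -> : (fun rho y => \sum_(i <- [::]) G i rho y) =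
      fun rho y => 0 * expR (- (rho ^+ 2 * @sqn R n y / 4)).
    by apply/funext => rho; apply/funext => y; rewrite big_nil mul0r.
  by apply: gaussZ; exact: gauss_exp.
under eq_fun do under eq_fun do rewrite big_cons.
exact: gaussD.
Qed.

Lemma heatL_class : gauss_class (@heatL R n).
Proof. by apply: gauss_sum => i; exact: heat2_class. Qed.

Let cst1_cont : continuous (fun _ : 'rV[R]_n => 1 : R). Proof. exact: cst_continuous. Qed.
Let cst1_le (x : 'rV[R]_n) : `|1 : R| <= 1. Proof. by rewrite normr1. Qed.

Lemma gpot_cst1_derive F G rho (c : R) v : gauss_class F -> gauss_class G -> 0 < rho ->
  (forall y, is_derive y v (F rho) (G rho y)) ->
  (forall x, \int[m]_w F rho (x - V w) = c) -> forall x, \int[m]_w G rho (x - V w) = 0.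
Proof.
move=> cF cG r0 hFG hF x.
have e1 H y : gpot m V (fun _ => 1) H rho y = \int[m]_w H rho (y - V w).
  by apply: eq_Rintegral => w _; rewrite mulr1.
have [_] := is_derive_gpot mV ge0_iint cst1_cont cst1_le x cF cG r0 hFG.
rewrite e1 => <-.
have -> : gpot m V (fun _ => 1) F rho = cst c by apply/funext => y; rewrite e1 hF.
exact: derive_cst.
Qed.

Lemma Rintegral_heat rho x : 0 < rho -> \int[m]_w heat rho (x - V w) = 1.
Proof. by move=> r0; rewrite /Rintegral (integral_heat ge0_iint x r0). Qed.

(* Differentiating the constant total mass of the heat kernel: its derivatives
   have mean zero, which lets one subtract [w0 x] in [gpot_holder]. *)
Lemma Rintegral_heat2 u v rho x : 0 < rho -> \int[m]_w heat2 u v rho (x - V w) = 0.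
Proof.
move=> r0; apply: (gpot_cst1_derive (heat1_class v) (heat2_class u v) r0) => [y|].
  exact: is_derive_heat1.
apply: (gpot_cst1_derive heat_class (heat1_class v) r0) => [y|z].
  exact: is_derive_heat.
exact: Rintegral_heat.
Qed.

Variables (w0 : 'rV[R]_n -> R) (M L gamma : R).
Hypothesis g01 : 0 < gamma <= 1.
Hypothesis w0M : forall x, `|w0 x| <= M.
Hypothesis w0L : forall x y, `|w0 x - w0 y| <= L * enorm (x - y) `^ gamma.

Let g0 : 0 < gamma. Proof. by case/andP: g01. Qed.

Lemma holder_continuous : continuous w0.
Proof.
apply: (@continuous_dist_lt R 'rV[R]_n) => x eps eps0.
(* [c] makes [|L| + 1] times its power [gamma] equal to [eps]; the added 1 covers [L = 0]. *)
pose c := (eps / (`|L| + 1)) `^ gamma^-1.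
have q0 : 0 < eps / (`|L| + 1) by rewrite divr_gt0// ltr_wpDl.
have c0 : 0 < c by rewrite powR_gt0.
have ce : enorm (x - y) @[y --> x] --> (0:R).
  rewrite -[X in _ --> X](_ : enorm (x - x) = 0); last first.
    by rewrite subrr /enorm big1 ?sqrtr0// => i _; rewrite mxE expr0n.
  have csub : continuous (fun y : 'rV[R]_n => x - y).
    by move=> y; apply: continuousB => //; exact: cst_continuous.
  have csq : continuous (@sqn R n).
    apply: (@continuous_big R^o 'I_n +%R 0 xpredT) => [|i _ y]; first exact: add_continuous.
    have h := @coord_continuous R _ _ ord0 i y.
    exact: (cvgM h h).
  apply: (cvg_comp (fun y => x - y) (@enorm R n)); first exact: csub.
  apply: (cvg_comp (@sqn R n) Num.sqrt); first exact: csq.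
  exact: sqrt_continuous.
near=> y.
have : `|0 - enorm (x - y)| < c by near: y; move/cvgrPdist_lt : ce; exact.
rewrite sub0r normrN ger0_norm ?enorm_ge0// => ec.
apply: le_lt_trans (w0L x y) _.
apply: (@le_lt_trans _ _ (`|L| * (eps / (`|L| + 1)))).
  apply: le_trans (ler_wpM2r (powR_ge0 _ _) (ler_norm L)) _.
  apply: ler_wpM2l => //.
  have -> : eps / (`|L| + 1) = c `^ gamma.
    by rewrite /c -powRrM mulVf ?gt_eqF// powRr1// ltW.
  by apply: ge0_ler_powR; rewrite ?nnegrE ?enorm_ge0// ltW.
by rewrite mulrA ltr_pdivrMr ?ltr_wpDl// mulrC ltr_pM2l// ltrDl.
Unshelve. all: by end_near. Qed.

Let cw0 := holder_continuous.
Notation P := (gpot m V w0).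

(** Subtracting the constant [w0 x] under the integral exposes the Hoelder difference. The mass
    [c = 1] gives the rate of approach to the initial value, and [c = 0] the decay of second
    derivatives. *)
Lemma gpot_holder F rho x (c B : R) : gauss_class F -> 0 < rho ->
  (forall y, \int[m]_w F rho (y - V w) = c) ->
  0 <= B -> (forall y, `|F rho y| * enorm y `^ gamma <= B * heat (rho / 2) y) ->
  `|P F rho x - c * w0 x| <= `|L| * B.
Proof.
move=> cF r0 Fc B0 hF; have r20 : 0 < rho / 2 by rewrite divr_gt0.
have iF : m.-integrable setT (EFin \o (fun w => F rho (x - V w))).
  have := integrable_gpot mV ge0_iint cst1_cont cst1_le x cF r0.
  by apply: eq_integrable => // w _ /=; rewrite mulr1.
have iFc : m.-integrable setT (EFin \o (fun w => F rho (x - V w) * w0 x)).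
  apply: (eq_integrable _ (fun w => ((w0 x)%:E * (F rho (x - V w))%:E)%E)) => //.
    by move=> w _; rewrite /= mulrC EFinM.
  exact: integrableZl.
have iFw := integrable_gpot mV ge0_iint cw0 w0M x cF r0.
have iB := integrableB measurableT iFw iFc.
have -> : P F rho x - c * w0 x = \int[m]_w (F rho (x - V w) * w0 (V w) - F rho (x - V w) * w0 x).
  by rewrite RintegralB// RintegralZr// Fc.
apply: le_trans (le_normr_Rintegral _ _) _ => //.
have -> : `|L| * B = \int[m]_w (`|L| * B * heat (rho / 2) (x - V w)).
  rewrite RintegralZl// ?Rintegral_heat ?mulr1//.
  exact: (integrable_heat mV ge0_iint).
apply: le_Rintegral => //.
- exact: integrable_abse iB.
- exact: integrable_dom.
move=> w _; rewrite -mulrBr normrM -mulrA.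
apply: (@le_trans _ _ (`|L| * (`|F rho (x - V w)| * enorm (x - V w) `^ gamma))); last first.
  by rewrite ler_wpM2l.
rewrite mulrCA ler_wpM2l// distrC (le_trans (w0L _ _))//.
by rewrite ler_wpM2r ?powR_ge0 ?ler_norm.
Qed.

Lemma rho_ofE s : 0 < s -> rho_of s = s `^ (- 2^-1).
Proof. by move=> s0; rewrite powRN powR12_sqrt// ltW. Qed.

Lemma rho_of_powR s : 0 < s -> rho_of s `^ (- gamma) = s `^ (gamma / 2).
Proof. by move=> s0; rewrite rho_ofE// -powRrM mulrNN mulrC. Qed.

Lemma heat_potential_bounded : exists K : R, forall s x, 0 < s -> `|P heat (rho_of s) x| <= K.
Proof.
have [C C0 hC] := @heat_poly_le R n 0.
exists (C * M) => s x s0; apply: (gpot_le mV ge0_iint cw0 w0M) => //.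
- exact: heat_class.
- exact: rho_of_gt0.
move=> y; have r0 := ltW (rho_of_gt0 s0).
by rewrite ger0_norm ?heat_ge0// -[leLHS]mul1r -(expr0 (1 + rho_of s * enorm y)) hC.
Qed.

Lemma heat_potential_initial : exists K : R, forall s x, 0 < s ->
  `|P heat (rho_of s) x - w0 x| <= K * s `^ (gamma / 2).
Proof.
have [C C0 hC] := @heat_poly_le R n 1.
exists (`|L| * C) => s x s0; have r0 := rho_of_gt0 s0.
rewrite -(mul1r (w0 x)) -rho_of_powR// -mulrA.
apply: (gpot_holder x heat_class r0) => [y||y].
- exact: Rintegral_heat.
- by rewrite mulr_ge0 ?powR_ge0.
have g01' : 0 <= gamma <= 1 by case/andP: g01 => /ltW -> ->.
rewrite ger0_norm ?heat_ge0 ?(ltW r0)//.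
apply: le_trans (ler_wpM2l (heat_ge0 y (ltW r0)) (powR_enorm_le y r0 g01')) _.
rewrite mulrCA [leRHS](_ : _ = rho_of s `^ (- gamma) * (C * heat (rho_of s / 2) y)); last by ring.
by rewrite ler_wpM2l ?powR_ge0// mulrC -[1 + _]expr1 hC ?(ltW r0).
Qed.

(** The power -1/2 is already integrable at 0, so the sup bound on [w0] serves here; for second
    derivatives it would only give the power -1, whence the use of [gpot_holder]. *)
Lemma heat_potential1_le v : exists2 K : R, 0 <= K & forall s x, 0 < s ->
  `|P (heat1 v) (rho_of s) x| <= K * s `^ (- 2^-1).
Proof.
have [C C0 hC] := heat1_le v.
have M0 : 0 <= M by exact: le_trans (normr_ge0 _) (w0M 0).
exists (C * M) => [|s x s0]; first exact: mulr_ge0.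
have r0 := rho_of_gt0 s0; rewrite -rho_ofE// mulrAC.
apply: (gpot_le mV ge0_iint cw0 w0M) => //.
- exact: heat1_class.
- by rewrite mulr_ge0// ltW.
by move=> y; apply: hC; exact: ltW.
Qed.

Lemma heat_potential2_le u v : exists2 K : R, 0 <= K & forall s x, 0 < s ->
  `|P (heat2 u v) (rho_of s) x| <= K * s `^ (gamma / 2 - 1).
Proof.
have [C C0 hC] := heat2_le u v.
exists (`|L| * C) => [|s x s0]; first exact: mulr_ge0.
have r0 := rho_of_gt0 s0.
have -> : s `^ (gamma / 2 - 1) = rho_of s ^+ 2 * rho_of s `^ (- gamma).
  rewrite rho_of_powR// rho_of_sqr// powRD; last by rewrite (gt_eqF s0) implybT.
  by rewrite powRN powRr1 ?(ltW s0)// mulrC.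
rewrite -mulrA -[X in `|X|]subr0 -(mul0r (w0 x)).
apply: (gpot_holder x (heat2_class u v) r0) => [y||y].
- exact: Rintegral_heat2.
- by rewrite !mulr_ge0 ?powR_ge0 ?(ltW r0).
by apply: hC => //; case/andP: g01 => /ltW -> ->.
Qed.

Lemma gpot_heatL s x : 0 < s ->
  P heatL (rho_of s) x = \sum_(i < n) P (heat2 (evec R i) (evec R i)) (rho_of s) x.
Proof.
move=> s0; have r0 := rho_of_gt0 s0.
rewrite /gpot /heatL; elim: (index_enum _) => [|i r IH].
  rewrite big_nil; transitivity (\int[m]_(w in setT) (0 : R)).
    by apply: eq_Rintegral => w _; rewrite big_nil mul0r.
  by rewrite Rintegral_cst// mul0r.
rewrite big_cons -IH -RintegralD//.
- by apply: eq_Rintegral => w _; rewrite big_cons mulrDl.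
- exact: (integrable_gpot mV ge0_iint cw0 w0M x (heat2_class _ _) r0).
apply: (integrable_gpot mV ge0_iint cw0 w0M x (F := fun rho y => \sum_(j <- r) heat2 (evec R j) (evec R j) rho y)) => //.
by apply: gauss_sum => j; exact: heat2_class.
Qed.

Lemma heat_potentialL_le : exists2 K : R, 0 <= K & forall s x, 0 < s ->
  `|P heatL (rho_of s) x| <= K * s `^ (gamma / 2 - 1).
Proof.
have /choice[K hK] : forall i : 'I_n, exists K : R, 0 <= K /\ forall s x, 0 < s ->
    `|P (heat2 (evec R i) (evec R i)) (rho_of s) x| <= K * s `^ (gamma / 2 - 1).
  by move=> i; have [K K0 hK] := heat_potential2_le (evec R i) (evec R i); exists K.
exists (\sum_(i < n) K i) => [|s x s0]; first by apply: sumr_ge0 => i _; case: (hK i).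
rewrite gpot_heatL// (le_trans (ler_norm_sum _ _ _))// mulr_suml.
by apply: ler_sum => i _; exact: (hK i).2.
Qed.

Lemma is_derive_heat_potential_time s x : 0 < s ->
  is_derive s 1 (fun t => P heat (rho_of t) x) (P heatL (rho_of s) x).
Proof.
move=> s0; apply: (is_derive_gpot_time mV ge0_iint cw0 w0M x heat_class heatL_class s0).
by move=> t y; exact: is_derive_heat_time.
Qed.

Lemma heat_potential_modulus : exists2 K : R, 0 <= K & forall a b x, 0 < a -> a <= b ->
  `|P heat (rho_of b) x - P heat (rho_of a) x| <= K * (b `^ (gamma / 2) - a `^ (gamma / 2)).
Proof.
have [K K0 hK] := heat_potentialL_le.
(* The factor [2 / gamma] comes from integrating the power [gamma / 2 - 1] that bounds the time
   derivative. *)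
exists (K * (2 / gamma)) => [|a b x a0 ab]; first by rewrite mulr_ge0// divr_ge0// ltW.
rewrite mulrBr.
apply: (@is_derive_dist_le (fun t => P heat (rho_of t) x) (fun t => K * (2 / gamma) * t `^ (gamma / 2))
  (fun t => P heatL (rho_of t) x) (fun t => K * t `^ (gamma / 2 - 1))) => //.
- by move=> t /andP[at_ _]; apply: is_derive_heat_potential_time; exact: lt_le_trans at_.
- move=> t /andP[at_ _]; have t0 : 0 < t by exact: lt_le_trans at_.
  apply: (is_derive_eq (is_derive1Ml (K * (2 / gamma)) (is_derive1_powR (gamma / 2) t0))).
  by field; rewrite gt_eqF.
- by move=> t /andP[at_ _]; apply: hK; exact: lt_trans at_.
Qed.

End holder_potential.

(** * The resolvent equation *)

Section half_line_integrals.
Context {R : realType}.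
Notation mu := (@lebesgue_measure R).

Lemma is_derive1_cvg (G : R -> R) (s l : R) : is_derive s 1 G l -> G t @[t --> s] --> G s.
Proof.
by case=> dG _; apply: differentiable_continuous; exact/derivable1_diffP.
Qed.

Definition pos_line : set R := `]0, +oo[%classic.

(** A compact exhaustion; starting at 2 keeps the first interval nondegenerate, as the fundamental
    theorem of calculus requires. *)
Let ival (k : nat) : set R := `[k.+2%:R^-1, k.+2%:R]%classic.

Let ival_gt0 k s : ival k s -> 0 < s.
Proof. by rewrite /ival/= in_itv/= => /andP[h _]; apply: lt_le_trans h; rewrite invr_gt0. Qed.

Let ival_nd : nondecreasing_seq ival.
Proof.
move=> i j ij; apply/subsetPset => s; rewrite /ival/= !in_itv/= => /andP[h1 h2].
apply/andP; split; [apply: le_trans h1|apply: le_trans h2 _]; last by rewrite ler_nat.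
by rewrite lef_pV2 ?posrE// ler_nat.
Qed.

Let ival_near s : 0 < s -> \forall k \near \oo, ival k s.
Proof.
move=> s0; near=> k; rewrite /ival/= in_itv/=; apply/andP; split.
  rewrite -[s]invrK lef_pV2 ?posrE ?invr_gt0//; apply: ltW.
  apply: (@lt_le_trans _ _ k%:R); last by rewrite ler_nat !leqW.
  near: k; exact: nbhs_infty_gtr.
apply: (@le_trans _ _ k%:R); last by rewrite ler_nat !leqW.
by apply: ltW; near: k; exact: nbhs_infty_gtr.
Unshelve. all: by end_near. Qed.

Let ival_cover : \bigcup_k ival k = pos_line.
Proof.
apply/seteqP; split => [s [k _ /ival_gt0 h]|s]; first by rewrite /pos_line/= in_itv/= h.
rewrite /pos_line/= in_itv/= andbT => /ival_near[k _ hk].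
by exists k => //; apply: hk => /=.
Qed.

Lemma measurable_pos_line_continuous (f : R -> R) :
  (forall s : R, 0 < s -> f t @[t --> s] --> f s) -> measurable_fun pos_line f.
Proof.
move=> cf; apply: open_continuous_measurable_fun; first exact: interval_open.
by move=> s; rewrite inE /pos_line/= in_itv/= andbT; exact: cf.
Qed.

Let integral_ival (g G : R -> R) k : (forall s : R, 0 < s -> is_derive s 1 G (g s)) ->
  (forall s : R, 0 < s -> g t @[t --> s] --> g s) ->
  (\int[mu]_(s in ival k) (g s)%:E = (G k.+2%:R)%:E - (G k.+2%:R^-1)%:E)%E.
Proof.
move=> dG cg.
have cG (s : R) : 0 < s -> G t @[t --> s] --> G s.
  by move=> s0; exact: is_derive1_cvg (dG s s0).
have k0 : 0 < k.+2%:R^-1 :> R by rewrite invr_gt0.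
have k1 : k.+2%:R^-1 < k.+2%:R :> R.
  by apply: (@lt_trans _ _ 1); rewrite ?ltr1n// invf_lt1// ltr1n.
apply: continuous_FTC2 => //.
- apply: continuous_in_subspaceT => s; rewrite inE => /ival_gt0; exact: cg.
- split.
  + move=> s; rewrite in_itv/= => /andP[h _]; case: (dG s) => //; exact: lt_trans h.
  + by apply: cvg_at_right_filter; exact: cG.
  + by apply: cvg_at_left_filter; apply: cG; exact: lt_trans k1.
- move=> s; rewrite in_itv/= => /andP[h _]; rewrite derive1E.
  by case: (dG s) => //; exact: lt_trans h.
Qed.

(** Integrability without evaluating an integral: on each compact interval the integral of [f] is at
    most an increment of the antiderivative of [g], and these are bounded by [B]. *)
Lemma integrable_pos_line (f g G : R -> R) (B : R) :
  measurable_fun pos_line f -> (forall s : R, 0 < s -> 0 <= f s <= g s) ->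
  (forall s : R, 0 < s -> is_derive s 1 G (g s)) ->
  (forall s : R, 0 < s -> g t @[t --> s] --> g s) ->
  (forall a b, 0 < a -> 0 < b -> G b - G a <= B) ->
  mu.-integrable pos_line (EFin \o f).
Proof.
move=> mf fg dG cg GB; apply/integrableP; split; first exact/measurable_EFinP.
have f0 s : 0 < s -> (0 <= (f s)%:E)%E by move=> s0; rewrite lee_fin; case/andP: (fg s s0).
have ivalD k : ival k `<=` pos_line by rewrite -ival_cover; exact: bigcup_sup.
rewrite (_ : integral _ _ _ = \int[mu]_(s in pos_line) (EFin \o f) s)%E; last first.
  apply: eq_integral => s; rewrite inE /pos_line/= in_itv/= andbT => s0.
  by rewrite ger0_norm//; have := f0 s s0; rewrite lee_fin.
apply: (@le_lt_trans _ _ B%:E); last exact: ltry.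
have h : ((\int[mu]_(s in ival k) (f s)%:E) @[k --> \oo] --> \int[mu]_(s in \bigcup_k ival k) (f s)%:E)%E.
  apply: ge0_nondecreasing_set_cvg_integral => //.
  - move=> k; exact: measurable_itv.
  - move=> k; apply/measurable_EFinP; apply: measurable_funS (ivalD k) mf.
    exact: measurable_itv.
  - by move=> k s /ival_gt0; exact: f0.
rewrite ival_cover in h.
rewrite -(cvg_lim (@ereal_hausdorff R) h); apply: lime_le; first by apply/cvg_ex; eexists; exact: h.
apply: nearW => k; apply: (@le_trans _ _ (\int[mu]_(s in ival k) (g s)%:E)%E).
  apply: ge0_le_integral => //.
  - exact: measurable_itv.
  - by move=> s /ival_gt0; exact: f0.
  - apply/measurable_EFinP; apply: measurable_funS (ivalD k) mf; exact: measurable_itv.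
  - apply/measurable_EFinP; apply: measurable_funS (ivalD k) _; first exact: measurable_itv.
    exact: measurable_pos_line_continuous.
  - by move=> s /ival_gt0 s0; rewrite lee_fin; case/andP: (fg s s0).
by rewrite (integral_ival _ dG cg) -EFinB lee_fin GB.
Qed.

Lemma pos_line_FTC2 (g G : R -> R) (l0 l1 : R) :
  mu.-integrable pos_line (EFin \o g) ->
  (forall s : R, 0 < s -> is_derive s 1 G (g s)) ->
  (forall s : R, 0 < s -> g t @[t --> s] --> g s) ->
  G s @[s --> 0^'+] --> l0 -> G s @[s --> +oo] --> l1 ->
  \int[mu]_(s in pos_line) g s = l1 - l0.
Proof.
move=> ig dG cg G0 G1.
have h1 : (\int[mu]_(s in ival k) (g s)%:E)%E @[k --> \oo] --> (l1 - l0)%:E.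
  under eq_fun do rewrite (integral_ival _ dG cg) -EFinB.
  apply: cvg_EFin; first exact: nearW.
  apply: (@cvgB _ R^o).
    have /cvgryPgt h : k.+2%:R @[k --> \oo] --> (+oo : set_system R).
      by apply/cvgryPgt => A; near=> k; apply: (@lt_le_trans _ _ k%:R);
        [near: k; exact: nbhs_infty_gtr|rewrite ler_nat !leqW].
    by apply: (cvg_comp _ _ _ G1); apply/cvgryPgt.
  apply: (cvg_comp _ _ _ G0) => A [e /= e0 hA].
  near=> k; apply: hA; rewrite /= ?invr_gt0//.
  rewrite sub0r normrN ger0_norm ?invr_ge0//.
  apply: (@le_lt_trans _ _ k.+1%:R^-1); first by rewrite lef_pV2 ?posrE// ler_nat.
  near: k; exact: (near_infty_natSinv_lt (PosNum e0)).
have h2 : (\int[mu]_(s in ival k) (g s)%:E)%E @[k --> \oo] --> (\int[mu]_(s in pos_line) (g s)%:E)%E.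
  have E k : (\int[mu]_(s in ival k) (g s)%:E = \int[mu]_(s in pos_line) (((EFin \o g) \_ (ival k)) s))%E.
    rewrite -integral_mkcondr; congr (integral _ _ _); apply/esym/setIidr.
    by rewrite -ival_cover; exact: bigcup_sup.
  under eq_fun do rewrite E.
  apply: (@dominated_cvg _ _ _ mu pos_line _ (fun k => (EFin \o g) \_ (ival k)) _ (fun s => `|(g s)%:E|%E)) => //.
  - exact: measurable_itv.
  - move=> k; apply/(measurable_restrict _ _ _).1; [exact: measurable_itv|exact: measurable_itv|].
    apply: measurable_funS (measurable_int _ ig); first exact: measurable_itv.
    exact: subIsetl.
  - move=> s; rewrite /pos_line/= in_itv/= andbT => s0.
    apply: cvg_near_cst; near=> k; rewrite patchE ifT// inE.
    by near: k; exact: ival_near.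
  - exact: integrable_abse ig.
  - move=> k s _; rewrite patchE; case: ifP => // _.
    by rewrite abse0.
have := cvg_unique (@ereal_hausdorff R) h1 h2.
by rewrite /Rintegral => <-.
Unshelve. all: by end_near. Qed.

(* The singularity at 0 is dominated by the derivative of
   [s^(a+1) exp (- lam s) / (a+1)], up to a smooth integrable term. *)
Lemma integrable_exp_powR (lam a : R) : 0 < lam -> -1 < a <= 0 ->
  mu.-integrable pos_line (EFin \o (fun s => expR (- (lam * s)) * s `^ a)).
Proof.
move=> lam0 /andP[a1 a0]; pose b := a + 1.
have b0 : 0 < b by rewrite /b -ltrBlDr sub0r.
have li0 : 0 <= lam^-1 by rewrite invr_ge0 ltW.
have sb (s : R) : 0 < s -> s `^ b <= 1 + s.
  move=> s0; have [s1|s1] := leP 1 s.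
    apply: (@le_trans _ _ (s `^ 1)); first by rewrite ler_powR// /b; lra.
    by rewrite powRr1 ?lerDr// ltW.
  apply: (@le_trans _ _ (1 `^ b)); last by rewrite powR1 lerDl ltW.
  by apply: ge0_ler_powR; rewrite ?nnegrE ?(ltW b0) ?(ltW s0) ?(ltW s1).
have de (s : R) : is_derive s 1 (fun s => expR (- (lam * s))) (expR (- (lam * s)) * - lam).
  apply: (is_derive_eq (is_derive1_expR (is_derive1N (is_derive1Ml lam (is_derive_id s 1))))).
  by rewrite mulr1.
have dp (c s : R) : 0 < s -> is_derive s 1 (fun t => t `^ c) (c * s `^ (c - 1)) by move=> s0; exact: is_derive1_powR.
have cp (c s : R) : 0 < s -> t `^ c @[t --> s] --> s `^ c.
  by move=> s0; exact: is_derive1_cvg (dp c s s0).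
have ce (s : R) : expR (- (lam * t)) @[t --> s] --> expR (- (lam * s)).
  exact: is_derive1_cvg (de s).
have c1 (s : R) : 1 + t @[t --> s] --> 1 + s by apply: (@cvgD _ R^o); [exact: cvg_cst|exact: cvg_id].
pose g s := expR (- (lam * s)) * s `^ a + lam / b * (expR (- (lam * s)) * (1 + s - s `^ b)).
pose G s := b^-1 * (expR (- (lam * s)) * s `^ b) - b^-1 * (expR (- (lam * s)) * (1 + s + lam^-1)).
apply: (@integrable_pos_line _ g G (b^-1 * (1 + lam^-1) + b^-1 * (1 + lam^-1 + lam^-1))).
- by apply: measurable_pos_line_continuous => s s0; exact: cvgM (ce s) (cp a s s0).
- move=> s s0; rewrite mulr_ge0 ?expR_ge0 ?powR_ge0//= lerDl.
  by rewrite !mulr_ge0 ?expR_ge0 ?invr_ge0 ?(ltW lam0) ?(ltW b0)// subr_ge0 sb.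
- move=> s s0.
  have d1 : is_derive s 1 (fun s : R => 1 + s + lam^-1) 1.
    by apply: is_derive_eq; rewrite ?add0r ?addr0.
  apply: (is_derive_eq (is_derive1D (is_derive1Ml b^-1 (is_derive1M (de s) (dp b s s0)))
     (is_derive1N (is_derive1Ml b^-1 (is_derive1M (de s) d1))))).
  have -> : b - 1 = a by rewrite /b addrK.
  by rewrite /g; field; rewrite !gt_eqF.
- move=> s s0; apply: (@cvgD _ R^o); first exact: cvgM (ce s) (cp a s s0).
  apply: cvgM; first exact: cvg_cst.
  by apply: cvgM (ce s) _; apply: (@cvgB _ R^o); [exact: c1|exact: cp].
have exp_le s c : 0 < s -> 0 <= c -> expR (- (lam * s)) * (1 + s + c) <= 1 + lam^-1 + c.
  move=> s0 c0; rewrite expRN mulrC ler_pdivrMr ?expR_gt0//.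
  have ls : 0 <= lam * s by rewrite mulr_ge0 ?ltW.
  apply: (@le_trans _ _ ((1 + lam^-1 + c) * (1 + lam * s))); last first.
    by rewrite ler_wpM2l ?expR_ge1Dx// !addr_ge0.
  have e : lam^-1 * (lam * s) = s by rewrite mulrA mulVf ?mul1r ?gt_eqF.
  have : 0 <= c * (lam * s) by rewrite mulr_ge0.
  by move: (lam * s) (lam^-1) e ls li0 => p q; nra.
move=> x y x0 y0; rewrite /G.
have bi0 : 0 <= b^-1 by rewrite invr_ge0 ltW.
have hA : b^-1 * (expR (- (lam * y)) * y `^ b) <= b^-1 * (1 + lam^-1).
  rewrite ler_wpM2l//; have := exp_le y 0 y0 (lexx 0); rewrite !addr0; apply: le_trans.
  by rewrite ler_wpM2l ?expR_ge0// sb.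
have hB : b^-1 * (expR (- (lam * x)) * (1 + x + lam^-1)) <= b^-1 * (1 + lam^-1 + lam^-1).
  by rewrite ler_wpM2l// exp_le.
have hA0 : 0 <= b^-1 * (expR (- (lam * x)) * x `^ b) by rewrite !mulr_ge0 ?expR_ge0 ?powR_ge0.
have hB0 : 0 <= b^-1 * (expR (- (lam * y)) * (1 + y + lam^-1)).
  by rewrite !mulr_ge0 ?expR_ge0// !addr_ge0// ltW.
by lra.
Qed.

End half_line_integrals.

(** * Resolvent of the heat semigroup on Hoelder data *)

Section heat_resolvent.
Context {R : realType} {n : nat} d (Om : measurableType d).
Notation mu := (@lebesgue_measure R).
Variables (m : {measure set Om -> \bar R}) (V : Om -> 'rV[R]_n).
Hypothesis mV : measurable_coords V.
Hypothesis ge0_iint : forall F, borel_rV (fun _ : unit => F) -> (forall x, 0 <= F x)%E ->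
  (iint F = \int[m]_w F (V w))%E.
Variables (w0 : 'rV[R]_n -> R) (M L gamma : R).
Hypothesis g01 : 0 < gamma <= 1.
Hypothesis w0M : forall x, `|w0 x| <= M.
Hypothesis w0L : forall x y, `|w0 x - w0 y| <= L * enorm (x - y) `^ gamma.
Variable lam : R.
Hypothesis lam0 : 0 < lam.
Implicit Types (F G : R -> 'rV[R]_n -> R) (x y u v : 'rV[R]_n).

Notation P := (gpot m V w0).
Let cw0 : continuous w0 := holder_continuous g01 w0L.

Definition lap F x : R :=
  \int[mu]_(s in pos_line) (expR (- (lam * s)) * P F (rho_of s) x).

(** The bound is uniform in [x], so it dominates the integrands for all [x] at once; [a > -1] is
    integrability at [s = 0]. *)
Let decay F := exists K a : R, [/\ 0 <= K, -1 < a <= 0 &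
  forall s x, 0 < s -> `|P F (rho_of s) x| <= K * s `^ a].

Let decay0 : decay heat.
Proof.
have [K hK] := heat_potential_bounded mV ge0_iint g01 w0M w0L.
exists `|K|, 0; split => // [|s x s0]; first by rewrite lexx ltrN10.
by rewrite powRr0 mulr1 (le_trans (hK s x s0))// ler_norm.
Qed.

Let decay1 v : decay (heat1 v).
Proof.
have [K K0 hK] := heat_potential1_le mV ge0_iint g01 w0M w0L v.
by exists K, (- 2^-1); split => //; apply/andP; split; lra.
Qed.

Let decay2 u v : decay (heat2 u v).
Proof.
have [K K0 hK] := heat_potential2_le mV ge0_iint g01 w0M w0L u v.
by exists K, (gamma / 2 - 1); split => //; case/andP: g01 => h1 h2; apply/andP; split; lra.
Qed.

Let pos_lineP (s : R) : pos_line s -> 0 < s.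
Proof. by rewrite /pos_line/= in_itv/= andbT. Qed.

Let mpos : measurable (pos_line : set R). Proof. exact: measurable_itv. Qed.

Let cexp (s : R) : expR (- (lam * t)) @[t --> s] --> expR (- (lam * s)).
Proof.
have h : is_derive s 1 (fun s => expR (- (lam * s))) (expR (- (lam * s)) * - (lam * 1)).
  exact: (is_derive1_expR (is_derive1N (is_derive1Ml lam (is_derive_id s 1)))).
exact: is_derive1_cvg h.
Qed.

Let lap_cvg_time F x (s : R) : gauss_class F -> 0 < s ->
  expR (- (lam * t)) * P F (rho_of t) x @[t --> s] --> expR (- (lam * s)) * P F (rho_of s) x.
Proof.
by move=> cF s0; apply: cvgM; [exact: cexp|exact: (continuous_gpot_time mV ge0_iint cw0 w0M)].
Qed.

Let measurable_lap F x : gauss_class F ->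
  measurable_fun pos_line (fun s => expR (- (lam * s)) * P F (rho_of s) x).
Proof. by move=> cF; apply: measurable_pos_line_continuous => s; exact: lap_cvg_time. Qed.

Let integrable_bound (K a : R) : -1 < a <= 0 ->
  mu.-integrable pos_line (EFin \o (fun s => K * (expR (- (lam * s)) * s `^ a))).
Proof.
move=> a01; have h := @integrableZl _ _ _ mu _ mpos K _ (integrable_exp_powR lam0 a01).
exact: h.
Qed.

Let lap_le F (K a : R) s x : (forall s x, 0 < s -> `|P F (rho_of s) x| <= K * s `^ a) -> 0 < s ->
  `|expR (- (lam * s)) * P F (rho_of s) x| <= K * (expR (- (lam * s)) * s `^ a).
Proof.
move=> hK s0; rewrite normrM (ger0_norm (expR_ge0 _)) mulrCA.
by rewrite ler_wpM2l ?expR_ge0// hK.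
Qed.

Let integrable_lap F x : gauss_class F -> decay F ->
  mu.-integrable pos_line (EFin \o (fun s => expR (- (lam * s)) * P F (rho_of s) x)).
Proof.
move=> cF [K [a [K0 a01 hK]]].
have h := @le_integrable _ _ _ mu _ mpos
  (EFin \o (fun s => expR (- (lam * s)) * P F (rho_of s) x)) _ _ _ (integrable_bound K a01).
apply: h; first by apply/measurable_EFinP; exact: measurable_lap.
move=> s /pos_lineP s0; rewrite lee_fin; apply: le_trans (ler_norm _).
exact: (lap_le x hK s0).
Qed.

Let is_derive_lap F G x v : gauss_class F -> gauss_class G -> decay F -> decay G ->
  (forall rho y, is_derive y v (F rho) (G rho y)) -> is_derive x v (lap F) (lap G x).
Proof.
move=> cF cG dF [K [a [K0 a01 hK]]] hFG.
apply: (@is_derive_parametric_integral _ _ _ _ mu pos_line mpos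
  (fun x s => expR (- (lam * s)) * P F (rho_of s) x) (fun x s => expR (- (lam * s)) * P G (rho_of s) x)
  (fun s => K * (expR (- (lam * s)) * s `^ a)) x v 1) => //.
- by move=> e _; exact: integrable_lap.
- move=> e s _ /pos_lineP s0; apply: is_deriveZ.
  by apply: (is_derive_gpot mV ge0_iint cw0 w0M) => //; exact: rho_of_gt0.
- by move=> s; rewrite !mulr_ge0 ?expR_ge0 ?powR_ge0.
- exact: integrable_bound.
- by move=> e s _ /pos_lineP s0; exact: lap_le.
Qed.

Let continuous_lap F : gauss_class F -> decay F -> continuous (lap F).
Proof.
move=> cF [K [a [K0 a01 hK]]] x.
apply: (@cvg_parametric_integral _ _ _ _ mu pos_line mpos
  (fun x s => expR (- (lam * s)) * P F (rho_of s) x)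
  (fun s => K * (expR (- (lam * s)) * s `^ a)) x 1) => //.
- by move=> y _; exact: measurable_lap.
- move=> s /pos_lineP s0; have h := continuous_gpot mV ge0_iint cw0 w0M cF (rho_of_gt0 s0).
  exact: (cvgM (cvg_cst _) (h x)).
- exact: integrable_bound.
- by move=> y s _ /pos_lineP s0; exact: lap_le.
Qed.

Let lap1 v : 'D_v (lap heat) = lap (heat1 v).
Proof.
apply/funext => x.
have [_ ->] := is_derive_lap x heat_class (heat1_class v) decay0 (decay1 v)
  (fun rho y => is_derive_heat rho y v).
by [].
Qed.

Let lap2 u v : 'D_u (lap (heat1 v)) = lap (heat2 u v).
Proof.
apply/funext => x.
have [_ ->] := is_derive_lap x (heat1_class v) (heat2_class u v) (decay1 v) (decay2 u v)
  (fun rho y => is_derive_heat1 rho y u v).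
by [].
Qed.

Lemma Ck_resolvent : Ck_on (Some 2%N) setT (lap heat).
Proof.
have d1 v : dirD [:: v] (lap heat) = lap (heat1 v) by exact: lap1.
have d2 v u : dirD [:: v; u] (lap heat) = lap (heat2 v u).
  by rewrite -lap2 -d1.
move=> [|v [|u [|? ?]]] // _ x _.
- split; first exact: (continuous_lap heat_class decay0).
  by move=> _ v; case: (is_derive_lap x heat_class (heat1_class v) decay0 (decay1 v)
    (fun rho y => is_derive_heat rho y v)).
- rewrite d1; split; first exact: (continuous_lap (heat1_class v) (decay1 v)).
  by move=> _ u; case: (is_derive_lap x (heat1_class v) (heat2_class u v) (decay1 v) (decay2 u v)
    (fun rho y => is_derive_heat1 rho y u v)).
- rewrite d2; split => //.
  exact: (continuous_lap (heat2_class v u) (decay2 v u)).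
Qed.

Let lapL x : lap heatL x = laplacian (lap heat) x.
Proof.
have d2 v : dirD [:: v; v] (lap heat) = lap (heat2 v v) by rewrite -lap2 -lap1.
rewrite /laplacian; under [RHS]eq_bigr do rewrite d2.
transitivity (\int[mu]_(s in pos_line) (\sum_(i < n) expR (- (lam * s)) * P (heat2 (evec R i) (evec R i)) (rho_of s) x)).
  apply: eq_Rintegral => s; rewrite inE => /pos_lineP s0.
  by rewrite (gpot_heatL mV ge0_iint g01 w0M w0L)// mulr_sumr.
rewrite /lap; elim: (index_enum _) => [|i r IH].
  rewrite big_nil; transitivity (\int[mu]_(s in pos_line) (0 : R)).
    by apply: eq_Rintegral => w _; rewrite big_nil.
  by rewrite Rintegral_cst// mul0r.
rewrite big_cons -IH -RintegralD//.
- by apply: eq_Rintegral => s _; rewrite big_cons.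
- by apply: integrable_lap; [exact: heat2_class|exact: decay2].
rewrite (_ : _ \o _ = fun s => (\sum_(j <- r) (expR (- (lam * s)) * P (heat2 (evec R j) (evec R j)) (rho_of s) x)%:E)%E).
  apply: integrable_sum => // j _.
  by apply: integrable_lap; [exact: heat2_class|exact: decay2].
by apply/funext => s /=; rewrite sumEFin.
Qed.

Lemma resolvent_equation x : lam * lap heat x - w0 x = laplacian (lap heat) x.
Proof.
rewrite -lapL; have [KL KL0 hKL] := heat_potentialL_le mV ge0_iint g01 w0M w0L.
have aL : -1 < gamma / 2 - 1 <= 0 by case/andP: g01 => h1 h2; apply/andP; split; lra.
have dL : decay heatL by exists KL, (gamma / 2 - 1); split.
have iL := integrable_lap x heatL_class dL.
have iH := integrable_lap x heat_class decay0.
pose G s := expR (- (lam * s)) * P heat (rho_of s) x.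
pose g s := expR (- (lam * s)) * P heatL (rho_of s) x - lam * (expR (- (lam * s)) * P heat (rho_of s) x).
have iLH : mu.-integrable pos_line (EFin \o (fun s => lam * (expR (- (lam * s)) * P heat (rho_of s) x))).
  have h := @integrableZl _ _ _ mu _ mpos lam _ iH.
  exact: h.
have hint : \int[mu]_(s in pos_line) g s = lap heatL x - lam * lap heat x.
  by rewrite /g RintegralB// RintegralZl.
suff : \int[mu]_(s in pos_line) g s = 0 - w0 x by rewrite hint; lra.
apply: (@pos_line_FTC2 _ g G).
- have h := @integrableB _ _ _ mu _ mpos _ _ iL iLH.
  exact: h.
- move=> s s0.
  have h := is_derive1M (is_derive1_expR (is_derive1N (is_derive1Ml lam (is_derive_id s 1))))
    (is_derive_heat_potential_time mV ge0_iint g01 w0M w0L x s0).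
  by apply: (is_derive_eq h); rewrite /g; ring.
- move=> s s0; have h1 := @lap_cvg_time heatL x s heatL_class s0.
  have h2 := cvgM (cvg_cst lam) (@lap_cvg_time heat x s heat_class s0).
  apply: (@cvgB _ R^o _ _ _ (fun t => expR (- (lam * t)) * P heatL (rho_of t) x)
    (fun t => lam * (expR (- (lam * t)) * P heat (rho_of t) x))); [exact: h1|exact: h2].
- have e1 : expR (- (lam * t)) @[t --> (0:R)^'+] --> (1:R).
    have -> : 1 = expR (- (lam * 0)) by rewrite mulr0 oppr0 expR0.
    exact: (cvg_at_right_filter (@cexp 0)).
  have e2 : P heat (rho_of t) x @[t --> (0:R)^'+] --> w0 x.
    have [K hK] := heat_potential_initial mV ge0_iint g01 w0M w0L.
    have g20 : 0 < gamma / 2 by case/andP: g01 => h _; rewrite divr_gt0.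
    have h0 : `|K| * t `^ (gamma / 2) @[t --> (0:R)^'+] --> (0:R).
      have h := cvgM (cvg_cst `|K|) (powR_cvg0 g20).
      by rewrite mulr0 in h; exact: h.
    apply/cvgrPdist_lt => /= eps eps0; near=> t.
    have t0 : 0 < t by [].
    rewrite distrC; apply: le_lt_trans (hK t x t0) _.
    apply: le_lt_trans (ler_wpM2r (powR_ge0 _ _) (ler_norm K)) _.
    by near: t; exact: (cvgr_lt (0:R) h0).
  have h := cvgM e1 e2; rewrite mul1r in h; exact: h.
have [K hK] := heat_potential_bounded mV ge0_iint g01 w0M w0L.
have K0 : 0 <= K by exact: le_trans (normr_ge0 _) (hK 1 x ltr01).
apply/cvgrPdist_lt => /= eps eps0; near=> t.
have t0 : 0 < t by [].
rewrite sub0r normrN /G normrM (ger0_norm (expR_ge0 _)).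
have lt0 : 0 < lam * t by rewrite mulr_gt0.
apply: (@le_lt_trans _ _ ((lam * t)^-1 * K)).
  apply: ler_pM => //; rewrite ?expR_ge0//; last exact: hK.
  rewrite expRN lef_pV2 ?posrE ?expR_gt0//.
  by apply: le_trans (expR_ge1Dx _); rewrite lerDr.
rewrite mulrC ltr_pdivrMr// -ltr_pdivrMl// mulrC -ltr_pdivrMl//.
by near: t; apply: nbhs_pinfty_gt; rewrite num_real.
Unshelve. all: by end_near. Qed.

End heat_resolvent.

(** * The subordinated kernel *)

Lemma Rintegral_unif01_cst {R : realType} (c : R) : \int[@unif01 R]_w c = c.
Proof.
by rewrite Rintegral_cst//; have h := @unif01T R; rewrite [X in fine X]h mulr1.
Qed.

Lemma near_neq0 {R : realType} {W : normedModType R} (x : W) :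
  x != 0 -> \forall y \near x, y != 0.
Proof.
move=> x0; have x20 : 0 < `|x| by rewrite normr_gt0.
apply/nbhs_normP; exists `|x| => //= y; rewrite /=.
by apply: contraTneq => ->; rewrite subr0 ltxx.
Qed.

Section subordinated_kernel.
Context {R : realType} {n : nat}.
Local Notation U := (measurableTypeR R).
Local Notation nu := (@unif01 R).
Variable E : R -> R -> R.
Hypothesis E_ge0 : forall t w, 0 <= E t w.
Hypothesis mE : measurable_fun setT (fun z : U * U => E z.1 z.2).
Implicit Types (F G : R -> 'rV[R]_n -> R) (x y v : 'rV[R]_n) (t : R).

Definition subord F t x : R := \int[nu]_w F (rho_of (E t w)) x.

Let rho_ge0 s : 0 <= rho_of s :> R. Proof. by rewrite invr_ge0 sqrtr_ge0. Qed.

Lemma measurable_rho_of : measurable_fun setT (@rho_of R).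
Proof.
apply: measurable_funTS; rewrite /rho_of.
(* The cutoff reflects that [Num.sqrt] vanishes on negative numbers and that [0^-1 = 0]. *)
have -> : (fun s : R => (Num.sqrt s)^-1) = (fun s => s `^ (- 2^-1) * (if 0 <= s then 1 else 0)).
  apply/funext => s; case: leP => s0; first by rewrite mulr1 powRN powR12_sqrt.
  by rewrite mulr0 ltr0_sqrtr// invr0.
apply: measurable_funM; first exact: measurable_powR.
apply: measurable_fun_if => //; exact: measurable_fun_ler.
Qed.

Let mrho d (T : measurableType d) (tau w : T -> R) : measurable_fun setT tau -> measurable_fun setT w ->
  measurable_fun setT (fun z => rho_of (E (tau z) (w z))).
Proof.
move=> mtau mw; apply: (measurableT_comp measurable_rho_of).
by apply: (measurableT_comp (f := fun z : U * U => E z.1 z.2) (g := fun z => (tau z, w z))) => //; exact: measurable_fun_pair.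
Qed.

Let mrho_w t : measurable_fun setT (fun w => rho_of (E t w)).
Proof. exact: (@mrho _ U (fun _ => t) id). Qed.

Lemma measurable_subord d (T : measurableType d) (tau : T -> R) (Y : T -> 'rV[R]_n) :
  measurable_fun setT tau -> measurable_coords Y ->
  measurable_fun setT (fun z => subord heat (tau z) (Y z)).
Proof.
move=> mtau mY; apply: (measurableT_comp (fine_measurable measurableT)).
apply: (@measurable_fun_fubini_tonelli_F _ _ T U R nu
  (fun z => (heat (rho_of (E (tau z.1) z.2)) (Y z.1))%:E)).
- apply/measurable_EFinP.
  apply: (gauss_measurable heat_class (r := fun z : T * U => rho_of (E (tau z.1) z.2)) (Y := fun z => Y z.1)).
    apply: (@mrho _ _ (fun z : T * U => tau z.1) snd) => //.
    exact: (measurableT_comp mtau measurable_fst).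
  by move=> i; exact: (measurableT_comp (mY i) measurable_fst).
- by move=> z; rewrite lee_fin heat_ge0.
Qed.

(** Neighbourhoods are for the sup norm while [gauss_away] needs a Euclidean annulus; [n] is a crude
    comparison factor between the norms. *)
Let enorm_near x y : `|x - y| < `|x| / 2 -> `|x| / 2 <= enorm y <= n%:R * (2 * `|x|).
Proof.
move=> xy; have x0 : 0 <= `|x| by [].
have h1 : `|x| <= `|x - y| + `|y| by rewrite -{1}(subrK y x) ler_normD.
have h2 : `|y| <= `|x - y| + `|x| by rewrite -{1}(subrK x y) distrC ler_normD.
apply/andP; split; first by apply: le_trans (norm_le_enorm y); lra.
apply: (@le_trans _ _ (n%:R * `|y|)); last by rewrite ler_wpM2l//; lra.
rewrite -[leRHS]ger0_norm ?mulr_ge0// -sqrtr_sqr ler_wsqrtr// exprMn.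
apply: (@le_trans _ _ (\sum_(i < n) `|y| ^+ 2)).
  apply: ler_sum => i _; rewrite -real_normK ?num_real//.
  by rewrite lerXn2r ?nnegrE// coord_le_norm.
rewrite sumr_const card_ord -[leLHS]mulr_natl ler_wpM2r ?sqr_ge0//.
by rewrite -natrX ler_nat; case: (n) => // j; rewrite expnS leq_pmulr// expn_gt0.
Qed.

Lemma gauss_near F x : gauss_class F -> x != 0 ->
  exists2 B : R, 0 <= B & forall rho y, 0 <= rho -> `|x - y| < `|x| / 2 -> `|F rho y| <= B.
Proof.
move=> cF x0; have x20 : 0 < `|x| / 2 by rewrite divr_gt0// normr_gt0.
have [B hB] := gauss_away (n%:R * (2 * `|x|)) cF x20.
exists `|B| => // rho y rho0 xy.
by apply: le_trans (hB rho y rho0 (enorm_near xy)) (ler_norm B).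
Qed.

Lemma unif01_integrable (f : R -> R) (B : R) : measurable_fun setT f -> (forall w, `|f w| <= B) ->
  nu.-integrable setT (EFin \o f).
Proof.
move=> mf fB; apply: measurable_bounded_integrable => //.
  by apply: (@le_lt_trans _ _ 1%E); [rewrite -(@unif01T R)|exact: ltry].
rewrite /bounded_near; exists B; split; first by rewrite num_real.
by move=> M BM w _ /=; exact: le_trans (fB w) (ltW BM).
Qed.

Let mF F t y : gauss_class F -> measurable_fun setT (fun w => F (rho_of (E t w)) y).
Proof.
move=> cF; apply: (gauss_measurable cF (r := fun w : U => rho_of (E t w)) (Y := fun _ => y)).
  exact: mrho_w.
by move=> i; exact: measurable_cst.
Qed.

Lemma is_derive_subord F G t x v : gauss_class F -> gauss_class G -> x != 0 ->
  (forall rho y, is_derive y v (F rho) (G rho y)) ->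
  is_derive x v (subord F t) (subord G t x).
Proof.
move=> cF cG x0 hFG; have x20 : 0 < `|x| / 2 by rewrite divr_gt0// normr_gt0.
have [B1 B10 hB1] := gauss_near cF x0; have [B B0 hB] := gauss_near cG x0.
have near e : `|e| < `|x| / 2 / (1 + `|v|) -> `|x - (e *: v + x)| < `|x| / 2.
  rewrite ltr_pdivlMr ?ltr_wpDr// => he.
  rewrite opprD addrCA subrr addr0 normrN normrZ; apply: le_lt_trans he.
  by rewrite ler_wpM2l// lerDr.
apply: (@is_derive_parametric_integral _ _ _ _ nu setT measurableT
  (fun y w => F (rho_of (E t w)) y) (fun y w => G (rho_of (E t w)) y)
  (fun _ => B) x v (`|x| / 2 / (1 + `|v|))) => //.
- by rewrite divr_gt0// ltr_wpDr.
- move=> e /near he; apply: (@unif01_integrable _ B1); last by move=> w; exact: hB1.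
  exact: mF.
- by apply: (@unif01_integrable _ B) => // w; rewrite ger0_norm.
- by move=> e w /near he _; exact: hB.
Qed.

Lemma continuous_subord F t x : gauss_class F -> x != 0 -> subord F t y @[y --> x] --> subord F t x.
Proof.
move=> cF x0; have x20 : 0 < `|x| / 2 by rewrite divr_gt0// normr_gt0.
have [B B0 hB] := gauss_near cF x0.
apply: (@cvg_parametric_integral _ _ _ _ nu setT measurableT
  (fun y w => F (rho_of (E t w)) y) (fun _ => B) x (`|x| / 2)) => //.
- by move=> y _; exact: mF.
- move=> w _.
  exact: (@gauss_cvg _ _ F cF _ (nbhs x) (fun _ => rho_of (E t w)) id _ _ _ (cvg_cst _) cvg_id).
- by apply: (@unif01_integrable _ B) => // w; rewrite ger0_norm.
- by move=> y w xy _; exact: hB.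
Qed.

(** Stability of [gauss_class] under derivatives carries over to means. The induction gives equality
    off 0 only, an open set, hence the replacement by a function equal nearby. *)
Lemma dirD_subord t vs : exists2 G, gauss_class G &
  forall x, x != 0 -> dirD vs (subord heat t) x = subord G t x.
Proof.
elim: vs => [|v vs [G cG hG]]; first by exists heat => //; exact: heat_class.
have [G' cG' hG'] := gauss_derive v cG.
exists G' => // x x0 /=.
rewrite (near_eq_derive v (g := subord G t)).
  by have [_ ->] := is_derive_subord t cG cG' x0 hG'.
by apply: filterS (@near_neq0 _ 'rV[R]_n x x0) => y; exact: hG.
Qed.

Lemma Ck_subord t : Ck_on None [set x | x != 0] (subord heat t).
Proof.
move=> vs _ x /= x0; have [G cG hG] := dirD_subord t vs.
have nearG : \near x, subord G t x = dirD vs (subord heat t) x.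
  by apply: filterS (@near_neq0 _ 'rV[R]_n x x0) => y y0; rewrite hG.
split.
  have c := @continuous_subord G t x cG x0.
  by rewrite hG//; exact: (cvg_trans (near_eq_cvg nearG) c).
move=> _ v; apply: (near_eq_derivable nearG).
have [G' cG' hG'] := gauss_derive v cG.
by case: (is_derive_subord t cG cG' x0 hG').
Qed.

Lemma integrable_subord x (T : R) : x != 0 -> 0 < T ->
  lebesgue_measure.-integrable `]0, T] (fun t => (subord heat t x)%:E).
Proof.
move=> x0 T0; have [B B0 hB] := gauss_near heat_class x0.
apply: measurable_bounded_integrable => //.
- have h := @lebesgue_measure_itv R `]0%R, T].
  by rewrite [X in (X < _)%E]h /= lte_fin T0 -EFinB ltry.
- apply: measurable_funTS; apply: (@measurable_subord _ U id (fun _ => x)) => // i.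
rewrite /bounded_near; exists B; split; first by rewrite num_real.
move=> M BM t _ /=; apply: le_trans (ltW BM).
have xx : `|x - x| < `|x| / 2 by rewrite subrr normr0 divr_gt0// normr_gt0.
have mf : measurable_fun setT (fun w => heat (rho_of (E t w)) x).
  exact: (mF t x heat_class).
have ih : nu.-integrable setT (EFin \o (fun w => heat (rho_of (E t w)) x)).
  by apply: (unif01_integrable (B := B)) => // w; exact: hB.
apply: le_trans (le_normr_Rintegral _ ih) _ => //.
rewrite -[leRHS]Rintegral_unif01_cst.
apply: le_Rintegral => //.
- exact: integrable_abse ih.
- by apply: (unif01_integrable (B := B)) => // w; rewrite ger0_norm.
- by move=> w _; exact: hB.
Qed.

Lemma subord_ge0 t x : 0 <= subord heat t x.
Proof. by apply: Rintegral_ge0 => w _; exact: heat_ge0. Qed.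

End subordinated_kernel.

(** * Convolution with the subordinated kernel *)

Section subordinated_convolution.
Context {R : realType} {n : nat} d (Om : measurableType d).
Local Notation U := (measurableTypeR R).
Local Notation nu := (@unif01 R).
Variables (m : {sigma_finite_measure set Om -> \bar R}) (V : Om -> 'rV[R]_n).
Hypothesis mV : measurable_coords V.
Hypothesis ge0_iint : forall F, borel_rV (fun _ : unit => F) -> (forall x, 0 <= F x)%E ->
  (iint F = \int[m]_w F (V w))%E.
Hypothesis int_iint : forall F, borel_rV (fun _ : unit => F) -> m.-integrable setT (F \o V) ->
  (iint F = \int[m]_w F (V w))%E.
Variable E : R -> R -> R.
Hypothesis E_gt0 : forall t w, 0 < t -> 0 < E t w.
Hypothesis mE : measurable_fun setT (fun z : U * U => E z.1 z.2).

Let rho_ge0 s : 0 <= rho_of s :> R. Proof. by rewrite invr_ge0 sqrtr_ge0. Qed.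

Section fixed_time.
Variables (t : R) (x : 'rV[R]_n).
Hypothesis t0 : 0 < t.

Let h (z : Om * U) : R := heat (rho_of (E t z.2)) (x - V z.1).

Let mh : measurable_fun setT h.
Proof.
apply: (gauss_measurable heat_class (r := fun z : Om * U => rho_of (E t z.2)) (Y := fun z => x - V z.1)).
  apply: (measurableT_comp measurable_rho_of).
  apply: (measurableT_comp (f := fun z : U * U => E z.1 z.2) (g := fun z : Om * U => (t, z.2))) => //.
  by apply: measurable_fun_pair => //; exact: measurable_snd.
apply: measurable_coords_sub => i; exact: (measurableT_comp (mV i) measurable_fst).
Qed.

Let h_ge0 z : 0 <= h z. Proof. exact: heat_ge0. Qed.

Let ih : (m \x nu)%E.-integrable setT (fun z => (h z)%:E).
Proof.
(* The space integral is innermost: there the heat kernel has mass 1 for every [w]. *)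
apply/(@integrable21ltyP _ _ _ _ _ m nu (fun z => (h z)%:E)); first exact/measurable_EFinP.
apply: (@le_lt_trans _ _ (\int[nu]_w 1)%E); last first.
  have e := @unif01T R.
  by rewrite integral_cst// mul1e [X in (X < _)%E]e ltry.
apply: ge0_le_integral => //.
- by move=> w _; apply: integral_ge0.
- apply: (@measurable_fun_fubini_tonelli_G _ _ Om U R m (fun z => `|(h z)%:E|%E)) => //.
  by apply: measurableT_comp => //; exact/measurable_EFinP.
move=> w _; under eq_integral do rewrite gee0_abs ?lee_fin//.
by rewrite [leLHS](integral_heat ge0_iint x (rho_of_gt0 (E_gt0 w t0))).
Qed.

Variables (g : 'rV[R]_n -> R) (M : R).
Hypothesis cg : continuous g.
Hypothesis gM : forall y, `|g y| <= M.

Let f (z : Om * U) : \bar R := (h z * g (V z.1))%:E.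

Let mf : measurable_fun setT f.
Proof.
apply/measurable_EFinP; apply: measurable_funM => //.
exact: (measurableT_comp (measurable_continuous_coords cg mV) measurable_fst).
Qed.

Let if_ : (m \x nu)%E.-integrable setT f.
Proof.
have i2 := @integrableZl _ _ _ (m \x nu)%E _ measurableT M _ ih.
apply: (le_integrable measurableT mf _ i2) => z _ /=.
rewrite lee_fin !normrM mulrC ler_wpM2r//.
by apply: le_trans (gM _) (ler_norm M).
Qed.

(** Where [x - V w] vanishes the integral may be infinite, and [fine] then returns 0; an inequality
    is all that survives there. *)
Let subord_le w : ((subord E heat t (x - V w))%:E <= \int[nu]_w' (h (w, w'))%:E)%E.
Proof.
rewrite /subord /Rintegral -/(h (w, _)).
have : (0 <= \int[nu]_w' (h (w, w'))%:E)%E by apply: integral_ge0 => w' _; rewrite lee_fin.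
rewrite /h /=; by case: (integral _ _ _) => [r| |] //=; rewrite leey.
Qed.

Let mZ : measurable_fun setT (fun w => subord E heat t (x - V w)).
Proof.
apply: (measurable_subord mE (tau := fun _ => t) (Y := fun w => x - V w)) => //.
exact: measurable_coords_sub.
Qed.

Lemma integrable_subord_conv :
  m.-integrable setT (EFin \o (fun w => subord E heat t (x - V w) * g (V w))).
Proof.
have iF := @integrable_fubini_F _ _ _ _ _ m nu _ ih.
have iF2 := @integrableZl _ _ _ m _ measurableT `|M| _ iF.
apply: (le_integrable measurableT _ _ iF2).
  apply/measurable_EFinP; apply: measurable_funM => //.
  exact: measurable_continuous_coords.
move=> w _; apply: (@le_trans _ _ (`|M|%:E * \int[nu]_w' (h (w, w'))%:E)%E); last exact: lee_abs.
rewrite /= normrM EFinM muleC lee_pmul ?lee_fin//; last first.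
  by rewrite ger0_norm ?subord_le// subord_ge0.
exact: le_trans (gM _) (ler_norm M).
Qed.

Lemma Rintegral_subord_conv :
  \int[m]_w (subord E heat t (x - V w) * g (V w)) =
  \int[nu]_w gpot m V g heat (rho_of (E t w)) x.
Proof.
rewrite /Rintegral; congr fine.
transitivity (\int[m]_w fubini_F nu f w)%E.
  (* Sections are integrable for almost every [w], and for those [fine] loses nothing. *)
  apply: ae_eq_integral => //.
  - by case/integrableP: integrable_subord_conv.
  - exact: (@measurable_fubini_F _ _ _ _ _ m nu _ if_).
  have := @ae_integrable1 _ _ _ _ _ m nu _ ih.
  apply: filterS => w iw _; rewrite /fubini_F /f /=.
  rewrite /subord -RintegralZr// /Rintegral fineK//.
  apply: integrable_fin_num => //.
  have := integrableZr measurableT (g (V w)) iw.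
  by apply: eq_integrable => // w' _; rewrite /= -EFinM.
rewrite (@integral12_prod_meas1 _ _ _ _ _ m nu _ if_) -(@integral21_prod_meas1 _ _ _ _ _ m nu _ if_).
apply: eq_integral => w _; rewrite /fubini_G /f /gpot /Rintegral fineK//.
apply: integrable_fin_num => //.
exact: (integrable_gpot mV ge0_iint cg gM x heat_class (rho_of_gt0 (E_gt0 w t0))).
Qed.

Lemma conv_solution_subord :
  conv_solution (subord E heat) g t x = \int[nu]_w gpot m V g heat (rho_of (E t w)) x.
Proof.
rewrite /conv_solution leNgt t0 /= int_iint ?Rintegral_subord_conv//.
- by rewrite -Rintegral_subord_conv.
- move=> d' T tau Y _ mY; apply/measurable_EFinP; apply: measurable_funM.
    apply: (measurable_subord mE (tau := fun _ => t) (Y := fun w => x - Y w)) => //.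
    exact: measurable_coords_sub.
  exact: measurable_continuous_coords.
- exact: integrable_subord_conv.
Qed.

End fixed_time.

(** The case of the datum 1 at the origin in the convolution formula, since the heat kernel is
    even. *)
Lemma iint_subord t : 0 < t -> iint (fun y : 'rV[R]_n => (subord E heat t y)%:E) = 1%E.
Proof.
move=> t0.
have cst1_cont : continuous (fun _ : 'rV[R]_n => 1 : R) by exact: cst_continuous.
have cst1_le (y : 'rV[R]_n) : `|1 : R| <= 1 by rewrite normr1.
have hN rho (y : 'rV[R]_n) : heat rho (- y) = heat rho y.
  rewrite /heat (_ : sqn (- y) = sqn y)//.
  by apply: eq_bigr => i _; rewrite mxE sqrrN.
have sE w : subord E heat t (0 - V w) * 1 = subord E heat t (V w).
  by rewrite mulr1 sub0r; apply: eq_Rintegral => w' _; rewrite hN.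
rewrite ge0_iint; last 2 first.
- move=> d' T tau Y _ mY; apply/measurable_EFinP.
  exact: (measurable_subord mE (tau := fun _ => t)).
- by move=> y; rewrite lee_fin subord_ge0.
have iZ := @integrable_subord_conv t 0 t0 _ 1 cst1_cont cst1_le.
have := @Rintegral_subord_conv t 0 t0 _ 1 cst1_cont cst1_le.
under eq_Rintegral do rewrite sE.
rewrite (_ : \int[nu]_w _ = 1); last first.
  rewrite -[RHS](@Rintegral_unif01_cst R); apply: eq_Rintegral => w _.
  rewrite /gpot; under eq_Rintegral do rewrite mulr1.
  exact: (Rintegral_heat ge0_iint 0 (rho_of_gt0 (E_gt0 w t0))).
rewrite /Rintegral => <-; rewrite fineK//; apply: integrable_fin_num => //.
by move: iZ; apply: eq_integrable => // w _ /=; rewrite sE.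
Qed.

End subordinated_convolution.

Section scaling.
Context {R : realType} {n : nat}.

Lemma dirD_scale (c : R) (j : nat) (f : 'rV[R]_n -> R) : Ck_on (Some j) setT f ->
  forall vs, (size vs <= j)%N -> dirD vs (fun x => c * f x) = fun x => c * dirD vs f x.
Proof.
move=> Cf; elim => [//|v vs IH] /= jvs; apply/funext => x; rewrite IH ?(ltnW jvs)//.
have [_ /(_ jvs v) dv] := Cf vs (ltnW jvs) x I.
exact: (deriveZ c dv).
Qed.

Lemma Ck_on_scale (c : R) (j : nat) (f : 'rV[R]_n -> R) : Ck_on (Some j) setT f ->
  Ck_on (Some j) setT (fun x => c * f x).
Proof.
move=> Cf vs jvs x _; rewrite (dirD_scale c Cf jvs); have [cf df] := Cf vs jvs x I; split.
  exact: (cvgM (cvg_cst c) cf).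
by move=> jvs' v; case: (is_deriveZ c (derivableP (df jvs' v))).
Qed.

Lemma laplacian_scale (c : R) (f : 'rV[R]_n -> R) x : Ck_on (Some 2%N) setT f ->
  laplacian (fun y => c * f y) x = c * laplacian f x.
Proof.
by move=> Cf; rewrite /laplacian mulr_sumr; apply: eq_bigr => i _; rewrite (dirD_scale c Cf).
Qed.

Lemma powR_cvg_ge0 (a : R) (u : nat -> R) (l : R) : 0 < a -> (forall k, 0 <= u k) ->
  u k @[k --> \oo] --> l -> u k `^ a @[k --> \oo] --> l `^ a.
Proof.
move=> a0 u0 ul.
have l0 : 0 <= l.
  by rewrite -(cvg_lim (@Rhausdorff R) ul); apply: limr_ge; [apply/cvg_ex; exists l|exact: nearW].
have [l00|ln0] := eqVneq l 0; last first.
  have lp : 0 < l by rewrite lt0r ln0.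
  exact: (cvg_comp u (fun x => x `^ a) ul (is_derive1_cvg (is_derive1_powR a lp))).
rewrite l00 in ul *; rewrite powR0 ?gt_eqF//; apply/cvgrPdist_lt => /= eps eps0; near=> k.
rewrite sub0r normrN ger0_norm ?powR_ge0//.
have -> : eps = (eps `^ a^-1) `^ a by rewrite -powRrM mulVf ?gt_eqF// powRr1// ltW.
apply: gt0_ltr_powR => //; rewrite ?nnegrE ?powR_ge0//.
have : `|0 - u k| < eps `^ a^-1.
  by near: k; move/cvgrPdist_lt : ul; apply; rewrite powR_gt0.
by rewrite sub0r normrN ger0_norm.
Unshelve. all: by end_near. Qed.

End scaling.

(** * Verification of the LT-solution properties *)

Section lt_solution.
Context {R : realType} {n : nat} d (Om : measurableType d).
Local Notation U := (measurableTypeR R).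
Local Notation nu := (@unif01 R).
Local Notation mu := (@lebesgue_measure R).
Variables (m : {sigma_finite_measure set Om -> \bar R}) (V : Om -> 'rV[R]_n).
Hypothesis mV : measurable_coords V.
Hypothesis ge0_iint : forall F, borel_rV (fun _ : unit => F) -> (forall x, 0 <= F x)%E ->
  (iint F = \int[m]_w F (V w))%E.
Hypothesis int_iint : forall F, borel_rV (fun _ : unit => F) -> m.-integrable setT (F \o V) ->
  (iint F = \int[m]_w F (V w))%E.
Variables (k : R -> R) (H : R -> R -> R).
Local Notation f := (fun p => p * laplace k p).
Hypothesis hH : inverse_subordinator f H.
Hypothesis f0 : forall p : R, 0 < p -> 0 < f p.
Local Notation E := (hitting H).
Variables (w0 : 'rV[R]_n -> R) (M L gamma : R).
Hypothesis g01 : 0 < gamma <= 1.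
Hypothesis w0M : forall x, `|w0 x| <= M.
Hypothesis w0L : forall x y, `|w0 x - w0 y| <= L * enorm (x - y) `^ gamma.

Let cw0 : continuous w0 := holder_continuous g01 w0L.
Local Notation P := (gpot m V w0).

(** The heat semigroup extended by the identity at [s <= 0], so that averaging over the passage time
    also covers [t <= 0], where that time is 0. *)
Let Q (s : R) x : R := if s <= 0 then w0 x else P heat (rho_of s) x.

Let Q_bounded : exists2 K : R, 0 <= K & forall s x, `|Q s x| <= K.
Proof.
have [K hK] := heat_potential_bounded mV ge0_iint g01 w0M w0L.
exists (`|K| + `|M|) => [|s x]; first exact: addr_ge0.
rewrite /Q; case: ifPn => [_|]; first by rewrite (le_trans (w0M x))// (le_trans (ler_norm M))// lerDr.
by rewrite -ltNge => s0; rewrite (le_trans (hK s x s0))// (le_trans (ler_norm K))// lerDl.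
Qed.

Let Q_modulus : exists2 K : R, 0 <= K & forall s s' x, 0 <= s -> 0 <= s' ->
  `|Q s x - Q s' x| <= K * `|s `^ (gamma / 2) - s' `^ (gamma / 2)|.
Proof.
have [K1 hK1] := heat_potential_initial mV ge0_iint g01 w0M w0L.
have [K2 K20 hK2] := heat_potential_modulus mV ge0_iint g01 w0M w0L.
have g0 : gamma / 2 != 0 by case/andP: g01 => h _; rewrite gt_eqF// divr_gt0.
exists (`|K1| + K2) => [|s s' x]; first exact: addr_ge0.
wlog ss : s s' / s <= s'.
  move=> h s0 s'0; have [ss|/ltW ss] := leP s s'; first exact: h.
  by rewrite distrC [X in _ * X]distrC; exact: h.
move=> s0 s'0; rewrite /Q; have [s'e|s'p] := leP s' 0.
  have -> : s = s' by apply/eqP; rewrite eq_le ss (le_trans s'e).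
  by rewrite s'e !subrr normr0 mulr0.
have [se|sp] := leP s 0.
  have -> : s = 0 by apply/eqP; rewrite eq_le se.
  rewrite powR0// sub0r normrN distrC (le_trans (hK1 s' x s'p))// (@ger0_norm _ (s' `^ _)) ?powR_ge0//.
  by rewrite ler_wpM2r ?powR_ge0// (le_trans (ler_norm K1))// lerDl.
rewrite distrC (le_trans (hK2 s s' x sp ss))// [X in _ <= _ * X]distrC.
rewrite mulrDl (le_trans _ (_ : K2 * `|s' `^ (gamma / 2) - s `^ (gamma / 2)| <= _))//.
  by rewrite ler_wpM2l// ler_norm.
by rewrite lerDr mulr_ge0.
Qed.

Let mQ x : measurable_fun setT (Q ^~ x).
Proof.
rewrite /Q; apply: measurable_fun_if => //; first exact: measurable_fun_ler.
apply: (@measurable_funS _ _ _ _ pos_line); first exact: measurable_itv.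
  by move=> s [_ /=]; rewrite /pos_line/= in_itv/= andbT leNgt => /negbFE.
apply: measurable_pos_line_continuous => s s0.
exact: (continuous_gpot_time mV ge0_iint cw0 w0M heat_class s0).
Qed.

Let mE : measurable_fun setT (fun z : U * U => E z.1 z.2).
Proof. exact: (measurable_hitting hH f0). Qed.

Let mE2 t : measurable_fun setT (fun w : U => E t w : U).
Proof. exact: (measurable_fun_pair2 t mE). Qed.

Let A t x : R := \int[nu]_w Q (E t w) x.

Lemma conv_solution_mixture t x : conv_solution (subord E heat) w0 t x = A t x.
Proof.
have [t0|t0] := leP t 0.
  rewrite /conv_solution t0 -[LHS](@Rintegral_unif01_cst R); apply: eq_Rintegral => w _.
  by rewrite (hitting_le0 hH f0)// /Q lexx.
rewrite (conv_solution_subord mV ge0_iint int_iint _ mE x t0 cw0 w0M); last first.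
  by move=> t' w t'0; exact: (hitting_gt0 hH f0).
by apply: eq_Rintegral => w _; rewrite /Q leNgt (hitting_gt0 hH f0).
Qed.

Let mQE t x : measurable_fun setT (fun w : U => Q (E t w) x).
Proof. exact: (measurableT_comp (mQ x) (mE2 t)). Qed.

Let iQ0 t x : nu.-integrable setT (EFin \o (fun w => Q (E t w) x)).
Proof.
have [K K0 hK] := Q_bounded; apply: (@unif01_integrable _ _ K) => [|w]; last exact: hK.
exact: mQE.
Qed.

Let iQ t x (c : R) : nu.-integrable setT (EFin \o (fun w => Q (E t w) x + c)).
Proof.
have [K K0 hK] := Q_bounded.
apply: (@unif01_integrable _ _ (K + `|c|)) => [|w]; last first.
  by rewrite (le_trans (ler_normD _ _))// lerD.
apply: measurable_funD => //; exact: (measurableT_comp (mQ x) (mE2 t)).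
Qed.

Let A_bounded : exists2 K : R, 0 <= K & forall t x, `|A t x| <= K.
Proof.
have [K K0 hK] := Q_bounded; exists K => // t x.
have i := iQ0 t x.
apply: le_trans (le_normr_Rintegral _ i) _ => //.
rewrite -[leRHS](@Rintegral_unif01_cst R); apply: le_Rintegral => //.
  exact: integrable_abse i.
by apply: (@unif01_integrable _ _ K) => // w; rewrite ger0_norm.
Qed.

(* The truncated modulus [psi] does not depend on [x], so dominated convergence
   gives a rate that is uniform in [x]. *)
Lemma mixture_uniformly_continuous (t0 eps : R) : 0 < eps ->
  exists2 delta : R, 0 < delta & forall t, `|t - t0| < delta -> forall x, `|A t x - A t0 x| < eps.
Proof.
move=> eps0; have [K K0 hK] := Q_bounded; have [K2 K20 hK2] := Q_modulus.
pose a := gamma / 2; have a0 : 0 < a by case/andP: g01 => h _; rewrite divr_gt0.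
pose psi t w := Num.min (2 * K) (K2 * `|E t w `^ a - E t0 w `^ a|).
have psi0 t w : 0 <= psi t w by rewrite le_min !mulr_ge0.
have psiK t w : `|psi t w| <= 2 * K by rewrite ger0_norm// ge_min lexx.
have mpsi t : measurable_fun setT (psi t).
  apply: measurable_minr => //; apply: measurable_funM => //.
  apply: measurableT_comp => //; apply: measurable_funB;
    apply: (measurableT_comp (measurable_powR a)); exact: mE2.
have ipsi t : nu.-integrable setT (EFin \o psi t) by apply: (unif01_integrable (mpsi t) (psiK t)).
have cpsi : \int[nu]_w psi t w @[t --> t0] --> 0.
  apply: (@cvg_seq_at R R^o) => u ut.
  have ik : nu.-integrable setT (EFin \o (fun _ => 2 * K)).
    by apply: (@unif01_integrable _ _ (2 * K)) => // w; rewrite ger0_norm// mulr_ge0.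
  have := @dominated_convergence _ U R nu setT measurableT (fun j w => (psi (u j) w)%:E)
    (fun _ => 0%E) (fun _ => (2 * K)%:E).
  case=> //.
  - by move=> j; apply/measurable_EFinP; exact: mpsi.
  - apply: (@filterS _ _ (ae_filter_ringOfSetsType _) _ _ _ (hitting_ae_cvg hH f0 t0)) => w hw _.
    have c1 := powR_cvg_ge0 a0 (fun j => hitting_ge0 hH f0 (u j) w) (cvg_comp u (E ^~ w) ut hw).
    have c2 : K2 * `|E (u j) w `^ a - E t0 w `^ a| @[j --> \oo] --> (0:R).
      have c3 : E (u j) w `^ a - E t0 w `^ a @[j --> \oo] --> (0:R).
        by apply/subr_cvg0.
      have c4 : `|E (u j) w `^ a - E t0 w `^ a| @[j --> \oo] --> (0:R).
        have h := cvg_norm c3; rewrite normr0 in h; exact: h.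
      have h := cvgM (cvg_cst K2) c4; rewrite mulr0 in h; exact: h.
    apply: cvg_EFin; first exact: nearW.
    apply: (@squeeze_cvgr _ _ _ _ (fun _ => 0) (fun j => K2 * `|E (u j) w `^ a - E t0 w `^ a|)).
    - by apply: nearW => j; rewrite psi0 ge_min lexx orbT.
    - exact: cvg_cst.
    - exact: c2.
  - by apply: aeW => w j _; rewrite lee_fin psiK.
  move=> _ _ h.
  have e0 : \int[nu]_w psi t0 w = 0.
    rewrite -[RHS](@Rintegral_unif01_cst R); apply: eq_Rintegral => w _.
    by rewrite /psi subrr normr0 mulr0; apply/min_idPr; rewrite mulr_ge0.
  rewrite integral0 in h; exact: (fine_cvg h).
have : \forall t \near t0, `|0 - \int[nu]_w psi t w| < eps by move/cvgrPdist_lt : cpsi; exact.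
move=> /nbhs_normP[delta /= delta0 hd]; exists delta => // t td x.
have := hd t; rewrite /= distrC => /(_ td); rewrite sub0r normrN; apply: le_lt_trans.
have i12 := integrableB measurableT (iQ0 t x) (iQ0 t0 x).
rewrite /A -RintegralB//; apply: le_trans (le_normr_Rintegral _ i12) _ => //.
apply: le_trans (ler_norm _); apply: le_Rintegral => //.
  exact: integrable_abse i12.
move=> w _; rewrite le_min; apply/andP; split.
  by rewrite mulr2n mulrDl !mul1r (le_trans (ler_normB _ _))// lerD.
by apply: hK2; exact: (hitting_ge0 hH f0).
Qed.

Let mA x : measurable_fun setT (A ^~ x).
Proof.
have [K K0 hK] := Q_bounded.
(* The shift by [K] makes the integrand nonnegative, as the Tonelli measurability of the partial
   integral requires. *)
have -> : A ^~ x = fun t => fine (\int[nu]_w (Q (E t w) x + K)%:E)%E - K.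
  apply/funext => t; rewrite -/(Rintegral nu setT (fun w => Q (E t w) x + K)).
  rewrite RintegralD//; last by apply: (@unif01_integrable _ _ K) => // w; rewrite ger0_norm.
  by rewrite Rintegral_unif01_cst addrK.
apply: measurable_funB => //; apply: (measurableT_comp (fine_measurable measurableT)).
apply: (@measurable_fun_fubini_tonelli_F _ _ U U R nu (fun z => (Q (E z.1 z.2) x + K)%:E)).
  apply/measurable_EFinP; apply: measurable_funD => //.
  exact: (measurableT_comp (mQ x) mE).
move=> z; rewrite lee_fin -lerBlDr sub0r lerNl; apply: le_trans (hK (E z.1 z.2) x).
by rewrite -normrN ler_norm.
Qed.

Let Rintegral_exp_density (r : R) : 0 < r -> \int[mu]_t exp_density r t = r^-1.
Proof. by move=> r0; rewrite /Rintegral integral_exp_density. Qed.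

Let integrable_exp_density (r : R) : 0 < r -> mu.-integrable setT (EFin \o exp_density r).
Proof.
move=> r0; apply/integrableP; split; first by apply/measurable_EFinP; exact: measurable_exp_density.
rewrite (_ : (\int[mu]_t _)%E = (\int[mu]_t (exp_density r t)%:E)%E); last first.
  by apply: eq_integral => t _ /=; rewrite ger0_norm// exp_density_ge0.
by rewrite integral_exp_density// ltry.
Qed.

Let integrable_bounded_exp (r B : R) (g : R -> R) : 0 < r -> measurable_fun setT g ->
  (forall t, `|g t| <= B) -> mu.-integrable setT (EFin \o (fun t => g t * exp_density r t)).
Proof.
move=> r0 mg gB; have iB := @integrableZl _ _ _ mu _ measurableT B _ (integrable_exp_density r0).
apply: (le_integrable measurableT _ _ iB).
  by apply/measurable_EFinP; apply: measurable_funM => //; exact: measurable_exp_density.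
move=> t _ /=; rewrite lee_fin !normrM ler_wpM2r//.
by apply: le_trans (gB t) (ler_norm B).
Qed.

Let split_exp (r K B : R) (g : R -> R) : 0 < r -> measurable_fun setT g -> (forall t, `|g t| <= B) ->
  \int[mu]_t ((g t + K) * exp_density r t) = \int[mu]_t (g t * exp_density r t) + K * r^-1.
Proof.
move=> r0 mg gB.
have iK : mu.-integrable setT (EFin \o (fun t => K * exp_density r t)).
  exact: (@integrable_bounded_exp r `|K| (fun _ => K)).
under eq_Rintegral do rewrite mulrDl.
rewrite RintegralD//; last exact: (integrable_bounded_exp r0 mg gB).
rewrite RintegralZl//; last exact: integrable_exp_density.
by rewrite Rintegral_exp_density.
Qed.

Let Rintegral_exp_halfline (r : R) (g : R -> R) :
  \int[mu]_t (g t * exp_density r t) = \int[mu]_(t in `[0%R, +oo[) (expR (- (r * t)) * g t).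
Proof.
rewrite [RHS]Rintegral_mkcond; apply: eq_Rintegral => t _.
rewrite patchE /exp_density indicE; case: ifP => _; first by rewrite mulr1 mulrC.
by rewrite !mulr0.
Qed.

(** [hitting_law] is stated for nonnegative functions, so the bounded [Q] is shifted by [K]; the
    shift contributes [K / p] on both sides and cancels. The remaining factor [f p / p] is
    [laplace k p]. *)
Lemma laplace_mixture p x : 0 < p ->
  laplace (conv_solution (subord E heat) w0 ^~ x) p = laplace k p * lap m V w0 (f p) heat x.
Proof.
move=> p0; have fp0 : 0 < f p by exact: f0.
have [K K0 hK] := Q_bounded; have [KA KA0 hKA] := A_bounded.
have QK s : 0 <= Q s x + K.
  by rewrite -lerBlDr sub0r lerNl (le_trans _ (hK s x))// -normrN ler_norm.
have -> : laplace (conv_solution (subord E heat) w0 ^~ x) p = \int[mu]_t (A t x * exp_density p t).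
  rewrite Rintegral_exp_halfline /laplace; apply: eq_Rintegral => t _.
  by rewrite conv_solution_mixture.
have HL : (\int[mu]_t ((A t x + K) * exp_density p t)%:E =
    \int[mu]_s ((Q s x + K) * (f p / p * exp_density (f p) s))%:E)%E.
  have mphi : measurable_fun setT (fun s : U => (Q s x + K)%:E).
    apply/measurable_EFinP; apply: measurable_funD; last exact: measurable_cst.
    exact: mQ.
  have h := hitting_law hH f0 p0 mphi (fun s => QK s).
  transitivity (\int[mu]_s ((Q s x + K)%:E * (f p / p * exp_density (f p) s)%:E))%E => //.
  rewrite -h; apply: eq_integral => t _.
  have iQe : nu.-integrable setT (EFin \o (fun w => (Q (E t w) x + K) * exp_density p t)).
    have i := @integrableZr _ _ _ nu _ measurableT (exp_density p t) _ (iQ t x K).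
    exact: i.
  have -> : (A t x + K) * exp_density p t = \int[nu]_w ((Q (E t w) x + K) * exp_density p t).
    rewrite RintegralZr//; congr (_ * _).
    rewrite RintegralD//; last by apply: (@unif01_integrable _ _ K) => // w; rewrite ger0_norm.
    by rewrite Rintegral_unif01_cst.
  by rewrite /Rintegral fineK// integrable_fin_num.
have HR : \int[mu]_t ((A t x + K) * exp_density p t) =
    f p / p * \int[mu]_s ((Q s x + K) * exp_density (f p) s).
  rewrite -RintegralZl//.
    rewrite [LHS]/Rintegral HL; apply: eq_Rintegral => s _.
    by rewrite mulrCA.
  apply: (@integrable_bounded_exp (f p) (K + K) (fun s => Q s x + K)) => //.
    exact: measurable_funD.
  by move=> s; rewrite (le_trans (ler_normD _ _))// lerD// ger0_norm.
rewrite (split_exp K p0 (mA x) (hKA ^~ x)) (split_exp K fp0 (mQ x) (hK ^~ x)) in HR.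
have -> : lap m V w0 (f p) heat x = \int[mu]_s (Q s x * exp_density (f p) s).
  rewrite Rintegral_exp_halfline -Rintegral_itv_obnd_cbnd.
    apply: eq_Rintegral => s; rewrite inE /pos_line/= in_itv/= andbT => s0.
    by rewrite /Q leNgt s0.
  have i : mu.-integrable setT (EFin \o (fun s => Q s x * exp_density (f p) s)).
    exact: (integrable_bounded_exp fp0 (mQ x) (hK ^~ x)).
  have i2 : mu.-integrable `]0%R, +oo[ (EFin \o (fun s => Q s x * exp_density (f p) s)).
    by apply: integrableS i => //; exact: measurable_itv.
  move: i2; apply: eq_integrable => // s; rewrite inE/= in_itv/= andbT => s0.
  by rewrite /exp_density indicE mem_set ?mulr1/= ?in_itv/= ?andbT ?(ltW s0)// mulrC.
set J := (X in _ = _ * X); rewrite -/J mulrDr in HR.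
have e2 : f p / p * (K * (f p)^-1) = K * p^-1.
  by move: (f p) fp0 => q q0; field; rewrite !gt_eqF.
have -> : laplace k p = f p / p by rewrite mulrC mulKf ?gt_eqF.
by rewrite e2 in HR; exact: (addIr (K * p^-1) HR).
Qed.

Lemma LT_solution_subord : LT_solution k (conv_solution (subord E heat) w0) w0.
Proof.
split.
- have [K K0 hK] := A_bounded; exists K => t x _.
  by rewrite conv_solution_mixture.
- move=> t0 _ eps eps0; have [delta delta0 hd] := mixture_uniformly_continuous t0 eps0.
  by exists delta => // t _ td x; rewrite !conv_solution_mixture; exact: hd.
- by move=> x; rewrite /conv_solution lexx.
- move=> p p0; under eq_fun do rewrite laplace_mixture//.
  by apply: Ck_on_scale; exact: (Ck_resolvent mV ge0_iint g01 w0M w0L (f0 p0)).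
move=> p p0 x; have CK := Ck_resolvent mV ge0_iint g01 w0M w0L (f0 p0).
under [in RHS]eq_fun do rewrite laplace_mixture//.
(* The transformed equation is the resolvent equation at [f p], multiplied by [laplace k p]. *)
rewrite laplacian_scale// -(resolvent_equation mV ge0_iint g01 w0M w0L (f0 p0)).
rewrite laplace_mixture//; ring.
Qed.

End lt_solution.

Theorem theorem3 (R : realType) (n : nat) (k : R -> R) :
  (0 < n)%N ->
  kernel_ok k ->
  assumption_star k ->
  exists Z : R -> 'rV[R]_n -> R,
    [/\ (forall t x, 0 < t -> x != 0 -> 0 <= Z t x),
        (forall x, x != 0 -> forall T : R, 0 < T ->
           lebesgue_measure.-integrable `]0, T] (fun t => (Z t x)%:E)),
        (forall t, 0 < t -> Ck_on None [set x | x != 0] (Z t)),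
        (forall t, 0 < t -> iint (fun x => (Z t x)%:E) = 1%E) &
        (forall w0 : 'rV[R]_n -> R,
           bounded_fun w0 -> globally_holder w0 ->
           LT_solution k (conv_solution Z w0) w0)].
Proof.
move=> n0 _ hk; have [[H hH] f0] := star_inverse_subordinator hk.
have [d [Om [m [V [mV ge0_iint int_iint]]]]] := @iint_representation R n.
have mE := measurable_hitting hH f0.
exists (subord (hitting H) heat); split.
- by move=> t x _ _; exact: subord_ge0.
- by move=> x x0 T T0; exact: (integrable_subord mE).
- by move=> t _; exact: (Ck_subord mE).
- by move=> t; apply: (iint_subord mV ge0_iint _ mE) => s w; exact: (hitting_gt0 hH f0).
move=> w0 [M [_ hM]] [L [gamma [g0 [g1 hL]]]].
(* [bounded_fun] only provides bounds strictly above its witness [M], hence [M + 1]. *)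
apply: (LT_solution_subord mV ge0_iint int_iint hH f0 (M := M + 1) _ _ hL).
  by rewrite g0.
by move=> x; apply: hM => //; rewrite ltrDl.
Qed.
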